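(* Let $\alpha\in(0,1)$ and $a,k\ge 0$. If the magnetic graph $(b,\theta,q,m)$ over the infinite discrete set $X$ is $(a,k)_1$-magnetic-sparse and $q\in\mathcal{K}_\alpha^{\theta}$, then the following statements are equivalent: (i) $H_\theta$ has purely discrete spectrum. (ii) $D_\infty=\infty$. In this case we have for the eigenvalues $\lambda_n$ of $H_\theta$ $$\frac{2(1-\alpha)}{5(1+a)^2-\alpha}\le\liminf_{n\to\infty}\frac{\lambda_n}{D_n}\le\limsup_{n\to\infty}\frac{\lambda_n}{D_n}.$$
   Context: Let $X$ be a discrete set and $C_c(X)$ the space of complex-valued functions on $X$ with finite support. A magnetic graph $(b,\theta,q,m)$ over $X$ consists of: a symmetric function $b:X\times X\to[0,\infty)$ with zero diagonal and $\sum_{y\in X}b(x,y)<\infty$ for all $x\in X$; an antisymmetric function $\theta:X\times X\to\mathbb{R}/2\pi\mathbb{Z}$ (magnetic potential); a function $q:X\to\mathbb{R}$ (potential), $q_\pm=(\pm q)\vee 0$; and a function $m:X\to(0,\infty)$ (measure). $\|f\|_2^2=\sum_x|f(x)|^2m(x)$ and $\langle g,f\rangle=\sum_{x}g(x)f(x)m(x)$. For $f\in C_c(X)$ let $$Q_{b,\theta,q,m}(f)=\frac12\sum_{x,y\in X}b(x,y)|f(x)-e^{i\theta(x,y)}f(y)|^2+\sum_{x\in X}q(x)|f(x)|^2m(x).$$ $q\in\mathcal{K}_\alpha^\theta$ means that there is $C_\alpha\ge0$ with $\langle q_-,|f|^2\rangle\le\alpha Q_{b,\theta,q_+,m}(f)+C_\alpha\|f\|_2^2$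 for all $f\in C_c(X)$. For $q\in\mathcal{K}^\theta_\alpha$ with $\alpha\in(0,1)$ the form $Q_{b,\theta,q,m}$ is closable in $\ell^2(X,m)$; its closure is $Q_\theta$ and $H_\theta$ denotes the self-adjoint operator on $\ell^2(X,m)$ associated with $Q_\theta$. Frustration index: for finite $W\subseteq X$ and $\mathbb{T}=\{z\in\mathbb{C}:|z|=1\}$, $\iota_{1,\theta}(W)=\min_{\tau:W\to\mathbb{T}}\frac12\sum_{x,y\in W}b(x,y)|\tau(x)-e^{i\theta(x,y)}\tau(y)|$. A non-negative function $g$ on a discrete set is extended to subsets by $g(A)=\sum_{x\in A}g(x)$; $\partial W=(W\times(X\setminus W))\cup((X\setminus W)\times W)$. The magnetic graph is $(a,k)_1$-magnetic-sparse if for all finite $W\subseteq X$ $$b(W\times W)\le(1+a)\iota_{1,\theta}(W)+a\Big(\tfrac12b(\partial W)+(q_+m)(W)\Big)+k\,m(W).$$ Purely discrete spectrum means that the spectrum of $H_\theta$ consists of discrete eigenvalues of finite multiplicity; in this case $\lambda_n$, $n\ge0$, are the eigenvalues counted with multiplicity in increasing order. Let $\mathrm{Deg}(x)=\frac1{m(x)}\sum_{y\in X}b(x,y)+q(x)$ and $$D_\infty=\sup_{K\subseteq X\text{ finite}}\ \inf_{x\in X\setminus K}\mathrm{Deg}(x).$$ If $D_\infty=\infty$, the vertices are enumerated bijectively $\mathbb{N}_0\to X$, $n\mapsto x_n$, such that $D_n:=\mathrm{Deg}(x_n)\le\mathrm{Deg}(x_{n+1})$ for all $n$. *)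

(* Defs.v *)
From HB Require Import structures.
From mathcomp Require Import all_boot all_order all_algebra.
From mathcomp Require Import all_classical all_reals all_analysis.
From mathcomp Require Import complex.

Set Implicit Arguments.
Unset Strict Implicit.
Unset Printing Implicit Defensive.

Import Order.TTheory GRing.Theory Num.Theory.
Import numFieldNormedType.Exports.
Import Normc.

Local Open Scope classical_set_scope.
Local Open Scope ring_scope.
Local Open Scope complex_scope.

Definition expi {R : realType} (t : R) : R[i] := cos t +i* sin t.

Section Magnetic.
Variables (R : realType) (X : choiceType).
Implicit Types (b theta : X -> X -> R) (q m : X -> R) (f g : X -> R[i]).

(* Values of theta are real representatives of classes in R/2piZ, hence
   antisymmetry is required modulo 2pi only; theta is used only through
   expi (theta x y). *)
Definition magnetic_graph b theta m : Prop :=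
  [/\ (forall x y, 0 <= b x y),
      (forall x y, b x y = b y x),
      (forall x, b x x = 0),
      (forall x, (\esum_(y in [set: X]) (b x y)%:E < +oo)%E) &
      (forall x y, exists z : int, theta y x = - theta x y + z%:~R * (2 * pi))
      /\ (forall x, 0 < m x)].

Definition Cc f : Prop := finite_set [set x | f x != 0].

Definition normsq m f : \bar R :=
  \esum_(x in [set: X]) (normc (f x) ^+ 2 * m x)%:E.

Definition ell2 m f : Prop := (normsq m f < +oo)%E.

(* Sums of absolutely summable real and complex families. *)
Definition rsum (u : X -> R) : R :=
  fine (\esum_(x in [set: X]) (u^\+ x)%:E) -
  fine (\esum_(x in [set: X]) (u^\- x)%:E).

Definition csum (u : X -> R[i]) : R[i] :=
  rsum (fun x => complex.Re (u x)) +i* rsum (fun x => complex.Im (u x)).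

Definition inner m f g : R[i] := csum (fun x => f x * (g x)^* * (m x)%:C).

Definition Qform b theta q m f : R :=
  2^-1 * fine (\esum_(p in [set: X * X])
     (b p.1 p.2 * normc (f p.1 - expi (theta p.1 p.2) * f p.2) ^+ 2)%:E)
  + \sum_(x \in [set: X]) q x * normc (f x) ^+ 2 * m x.

Definition Kclass b theta q m (alpha : R) : Prop :=
  exists2 C : R, 0 <= C & forall f, Cc f ->
    \sum_(x \in [set: X]) (q^\- x) * normc (f x) ^+ 2 * m x <=
    alpha * Qform b theta q^\+ m f + C * fine (normsq m f).

(* Sesquilinear form (linear in the first argument) of a quadratic form. *)
Definition polar (Q : (X -> R[i]) -> R) f g : R[i] :=
  4^-1 * ((Q (f + g))%:C - (Q (f - g))%:C
    + 'i * (Q (f + (fun x => 'i * g x)))%:C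
    - 'i * (Q (f - (fun x => 'i * g x)))%:C).

(* Approximating sequences in Kato's sense: for a form Q on Cc bounded from
   below, being Cauchy for the form norm amounts, along an ell2-convergent
   sequence, to Q (u n - u k) --> 0. *)
Definition form_approx m (Q : (X -> R[i]) -> R) (u : nat -> X -> R[i]) f : Prop :=
  [/\ (forall n, Cc (u n)),
      normsq m (u n - f) @[n --> \oo] --> 0%E &
      forall e : R, 0 < e ->
        exists N, forall n k, (N <= n)%N -> (N <= k)%N -> `|Q (u n - u k)| < e].

Definition closure_dom m (Q : (X -> R[i]) -> R) f : Prop :=
  ell2 m f /\ exists u, form_approx m Q u f.

(* The value does not depend on the chosen sequence when Q is closable. *)
Definition form_closure m (Q : (X -> R[i]) -> R) f : R :=
  let u := xget (fun _ _ => 0) [set u | form_approx m Q u f] in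
  lim (Q (u n) @[n --> \oo]).

(* Graph of the operator associated with the closure of Q: H f g means that
   f is in the domain of H and H f = g. *)
Definition form_operator m (Q : (X -> R[i]) -> R) f g : Prop :=
  [/\ closure_dom m Q f, ell2 m g &
      forall h, closure_dom m Q h -> polar (form_closure m Q) f h = inner m g h].

Definition magnetic_operator b theta q m : (X -> R[i]) -> (X -> R[i]) -> Prop :=
  form_operator m (Qform b theta q m).

Section Spectrum.
Variables (m : X -> R) (T : (X -> R[i]) -> (X -> R[i]) -> Prop).

(* T f (fun x => g x + z * f x) reads (T - z) f = g. *)
Definition resolvent_set : set R[i] :=
  [set z | (forall g, ell2 m g -> exists! f, T f (fun x => g x + z * f x)) /\
     exists C : R, forall f g, T f (fun x => g x + z * f x) ->
       (normsq m f <= C%:E * normsq m g)%E].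

Definition spectrum : set R[i] := ~` resolvent_set.

Definition eigenspace_of (z : R[i]) : set (X -> R[i]) :=
  [set f | T f (fun x => z * f x)].

Definition has_dim (E : set (X -> R[i])) (d : nat) : Prop :=
  exists v : 'I_d -> X -> R[i],
    (forall f, E f <->
       exists c : 'I_d -> R[i], f = fun x => \sum_i c i * v i x) /\
    (forall c : 'I_d -> R[i],
       (forall x, \sum_i c i * v i x = 0) -> forall i, c i = 0).

Definition purely_discrete_spectrum : Prop :=
  forall z, spectrum z ->
    (exists2 e : R, 0 < e &
       forall w, spectrum w -> normc (w - z) < e -> w = z) /\
    exists2 d : nat, (0 < d)%N & has_dim (eigenspace_of z) d.

Definition eigenvalue_enumeration (lambda : nat -> R) : Prop :=
  {homo lambda : n k / (n <= k)%N >-> n <= k} /\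
  forall z : R[i], exists2 d : nat, has_dim (eigenspace_of z) d &
    ([set n | (lambda n)%:C = z] #= `I_d)%card.

End Spectrum.

(* g(A) for nonnegative g. *)
Definition mass (S : choiceType) (g : S -> R) (A : set S) : \bar R :=
  \esum_(s in A) (g s)%:E.

Definition edge_boundary (W : set X) : set (X * X) :=
  (W `*` ~` W) `|` (~` W `*` W).

Definition frustration b theta (W : set X) : R :=
  inf [set r | exists2 tau : X -> R[i],
         (forall x, W x -> normc (tau x) = 1) &
         r = 2^-1 * \sum_(p \in W `*` W)
               b p.1 p.2 * normc (tau p.1 - expi (theta p.1 p.2) * tau p.2)].

Definition magnetic_sparse b theta q m (a k : R) : Prop :=
  forall W : set X, finite_set W ->
    (mass (fun p : X * X => b p.1 p.2) (W `*` W) <=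
     ((1 + a) * frustration b theta W)%:E
     + a%:E * ((2^-1)%:E * mass (fun p : X * X => b p.1 p.2) (edge_boundary W)
               + mass (fun x => (q^\+ x * m x)%R) W)
     + k%:E * mass m W)%E.

Definition Deg b q m (x : X) : R :=
  fine (\esum_(y in [set: X]) (b x y)%:E) / m x + q x.

Definition Dinfty b q m : \bar R :=
  ereal_sup [set ereal_inf [set (Deg b q m x)%:E | x in ~` K]
            | K in [set K : set X | finite_set K]].

Definition vertex_enumeration b q m (x : nat -> X) : Prop :=
  bijective x /\ forall n, Deg b q m (x n) <= Deg b q m (x n.+1).

End Magnetic.

(* Main.v *)
Require Import Defs.
From HB Require Import structures.
From mathcomp Require Import all_boot all_order all_algebra.
From mathcomp Require Import all_classical all_reals all_analysis.
From mathcomp Require Import complex.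
From mathcomp Require Import zify ring lra.

(** The operator [H] is studied through its bounded inverse [T = (H + C + 1)^-1],
    where [C] is the constant of the relative bound on the negative part of
    the potential. Since [alpha < 1], the shifted form dominates the squared
    norm, so [T] exists by minimization ([shifted_riesz]), it is symmetric,
    positive and injective, and every statement on [H], its eigenspaces and
    its resolvent translates into one on [T] ([operator_eqP]).

    The graph enters by one inequality, [sparse_form_bound]. Sparseness is a
    statement on indicator functions of finite sets. Integrating it over the
    superlevel sets of [|f|^2], with the phase of [f] as competitor in the
    frustration index, and using an elementary inequality on each edge, bounds
    the degrees by the form:
      [sum_x (deg + q_+ m) |f|^2 <= 5/2 (1 + a)^2 Q_(q_+)(f) + 2 k |f|^2].
    Interpolating with the relative bound on [q_-] gives
      [g Deg - c <= H],   [g = 2 (1 - alpha) / (5 (1 + a)^2 - alpha)]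
    in the sense of forms ([form_lower_bound]).

    If [Dinfty] is infinite, this makes [H] larger than any constant up to the
    values of [f] at finitely many vertices, which says for [T] that its form
    is small up to finitely many linear functionals. This weak compactness
    forces each supremum of [<T x, x>] over the unit sphere of a complement of
    eigenvectors to be attained ([quasi_compact_top_attained]), so that
    eigenvectors can be peeled off one by one. Their eigenvalues [s_n] tend to
    zero, they span the space, and the resolvent of [H] can be written as a
    series: the spectrum of [H] consists of the numbers [s_n^-1 - C - 1]
    ([purely_discrete]).

    Conversely, if the spectrum of [H] is purely discrete, a positive supremum
    of [<T x, x>] is isolated in the spectrum of [T], hence again attained
    ([discrete_top_attained]), and the same peeling yields [s_n -> 0]. Then
    [<T e, e>] tends to zero along any orthonormal sequence, whereas it is at
    least [(Deg x + C + 1)^-1] for the normalized indicator of a vertex [x];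
    so only finitely many vertices have degree below a given bound.

    For the eigenvalues, some nonzero vector spanned by the first [n + 1]
    eigenvectors vanishes at the [n] vertices of smallest degree. Evaluating
    the form at this vector gives [g D_n - c <= s_n^-1 - C - 1]
    ([inverse_eigenvalue_ge]). An enumeration of eigenvalues is determined by
    the multiplicities ([eigenvalue_enumeration_le]), so that the bound
    holds for every enumeration, and dividing by [D_n -> oo] gives the claim. *)

Set Implicit Arguments.
Unset Strict Implicit.
Unset Printing Implicit Defensive.

Import Order.TTheory GRing.Theory Num.Theory.
Import numFieldNormedType.Exports.

Local Open Scope classical_set_scope.
Local Open Scope ring_scope.

Local Notation Re := complex.Re.
Local Notation Im := complex.Im.

(** * Complex inner product spaces *)

Section ComplexFacts.
Variable R : realType.
Implicit Types z w : R[i].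

Lemma conjcD z w : (z + w)^*%C = z^*%C + w^*%C. Proof. exact: rmorphD. Qed.

Lemma conjcM z w : (z * w)^*%C = z^*%C * w^*%C. Proof. exact: rmorphM. Qed.

Lemma conjcN z : (- z)^*%C = - z^*%C. Proof. exact: rmorphN. Qed.

End ComplexFacts.

Section Hilbert.
Variables (R : realType) (V : lmodType R[i]).
Implicit Types (x y z : V) (a : R[i]) (t : R).

(** The inner product is a plain function and completeness is stated with it, so
    that no topology on [V] has to be constructed. *)
Record hilbert_space (ip : V -> V -> R[i]) : Prop := HilbertSpace {
  ipDl : forall x y z, ip (x + y) z = ip x z + ip y z;
  ipZl : forall a x y, ip (a *: x) y = a * ip x y;
  ipC : forall x y, ip y x = (ip x y)^*%C;
  ip_ge0 : forall x, 0 <= Re (ip x x);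
  ip_eq0 : forall x, Re (ip x x) = 0 -> x = 0;
  ip_complete : forall u : nat -> V,
    (forall e : R, 0 < e -> exists N, forall n k, (N <= n)%N -> (N <= k)%N ->
       Re (ip (u n - u k) (u n - u k)) < e) ->
    exists x, (fun n => Re (ip (u n - x) (u n - x))) @ \oo --> (0 : R) }.

Variable ip : V -> V -> R[i].
Hypothesis hs : hilbert_space ip.

Definition rip x y : R := Re (ip x y).
Definition nsq x : R := rip x x.

Lemma ipDr x y z : ip x (y + z) = ip x y + ip x z.
Proof. by rewrite (ipC hs) (ipDl hs) conjcD -!(ipC hs). Qed.

Lemma ipZr a x y : ip x (a *: y) = a^*%C * ip x y.
Proof. by rewrite (ipC hs) (ipZl hs) conjcM -(ipC hs). Qed.

Lemma ip0l x : ip 0 x = 0.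
Proof. by rewrite -(scale0r 0) (ipZl hs) mul0r. Qed.

Lemma ip0r x : ip x 0 = 0.
Proof. by rewrite (ipC hs) ip0l conjc0. Qed.

Lemma ipNl x y : ip (- x) y = - ip x y.
Proof. by rewrite -scaleN1r (ipZl hs) mulN1r. Qed.

Lemma ipNr x y : ip x (- y) = - ip x y.
Proof. by rewrite (ipC hs) ipNl conjcN -(ipC hs). Qed.

Lemma ipBl x y z : ip (x - y) z = ip x z - ip y z.
Proof. by rewrite (ipDl hs) ipNl. Qed.

Lemma ipBr x y z : ip x (y - z) = ip x y - ip x z.
Proof. by rewrite ipDr ipNr. Qed.

Lemma ip_suml I (r : seq I) (P : pred I) (F : I -> V) y :
  ip (\sum_(i <- r | P i) F i) y = \sum_(i <- r | P i) ip (F i) y.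
Proof.
by apply: (big_morph (fun x => ip x y)) => [u v|]; rewrite ?(ipDl hs)// ip0l.
Qed.

Lemma ip_sumr I (r : seq I) (P : pred I) (F : I -> V) y :
  ip y (\sum_(i <- r | P i) F i) = \sum_(i <- r | P i) ip y (F i).
Proof.
by apply: (big_morph (fun x => ip y x)) => [u v|]; rewrite ?ipDr// ip0r.
Qed.

Lemma ripC x y : rip x y = rip y x.
Proof. by rewrite /rip (ipC hs); case: (ip y x). Qed.

Lemma ripDl x y z : rip (x + y) z = rip x z + rip y z.
Proof. by rewrite /rip (ipDl hs) raddfD. Qed.

Lemma ripDr x y z : rip x (y + z) = rip x y + rip x z.
Proof. by rewrite /rip ipDr raddfD. Qed.

Lemma ripNl x y : rip (- x) y = - rip x y.
Proof. by rewrite /rip ipNl raddfN. Qed.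

Lemma ripNr x y : rip x (- y) = - rip x y.
Proof. by rewrite /rip ipNr raddfN. Qed.

Lemma ripBl x y z : rip (x - y) z = rip x z - rip y z.
Proof. by rewrite ripDl ripNl. Qed.

Lemma ripBr x y z : rip x (y - z) = rip x y - rip x z.
Proof. by rewrite ripDr ripNr. Qed.

Lemma ripZl t x y : rip (t%:C%C *: x) y = t * rip x y.
Proof.
by rewrite /rip (ipZl hs); case: (ip x y) => u v /=; rewrite mul0r subr0.
Qed.

Lemma ripZr t x y : rip x (t%:C%C *: y) = t * rip x y.
Proof. by rewrite ripC ripZl ripC. Qed.

Definition ripE := (ripDl, ripDr, ripNl, ripNr, ripZl, ripZr).

Lemma nsq_ge0 x : 0 <= nsq x. Proof. exact: ip_ge0. Qed.

Lemma nsq0 : nsq 0 = 0. Proof. by rewrite /nsq /rip ip0l. Qed.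

Lemma nsq_eq0 x : nsq x = 0 -> x = 0. Proof. exact: ip_eq0. Qed.

Lemma nsq_gt0 x : x <> 0 -> 0 < nsq x.
Proof.
by move=> x0; rewrite lt_neqAle nsq_ge0 andbT; apply/eqP => /esym/nsq_eq0.
Qed.

Lemma nsqN x : nsq (- x) = nsq x.
Proof. by rewrite /nsq ripNl ripNr opprK. Qed.

Lemma nsqZ t x : nsq (t%:C%C *: x) = t ^+ 2 * nsq x.
Proof. by rewrite /nsq ripZl ripZr; ring. Qed.

Lemma ip_nsq x : ip x x = (nsq x)%:C%C.
Proof.
rewrite /nsq /rip; have := ipC hs x x; case: (ip x x) => u v [] /= h.
by congr (_ +i* _)%C; lra.
Qed.

Lemma ip_rip x y : ip x y = 0 <-> rip x y = 0 /\ rip ('i%C *: x) y = 0.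
Proof.
rewrite /rip (ipZl hs); case: (ip x y) => u v /=; split.
  by move=> [-> ->]; rewrite !mul0r mulr0 subr0.
by rewrite mul0r mul1r sub0r => -[-> /eqP]; rewrite oppr_eq0 => /eqP ->.
Qed.

(** A quadratic polynomial without sign change. Besides Cauchy-Schwarz, it yields
    the Euler-Lagrange inequality of an approximate minimizer. *)
Lemma discriminant (p q r : R) : 0 <= r ->
  (forall t, 0 <= p + 2 * t * q + t ^+ 2 * r) -> q ^+ 2 <= p * r.
Proof.
move=> r0 h; have p0 : 0 <= p by have := h 0; rewrite expr0n/=; lra.
have [r1|r1] := eqVneq r 0.
  have [->|q0] := eqVneq q 0; first by rewrite expr0n/= mulr_ge0.
  have := h (- (p + 1) / (2 * q)); rewrite r1.
  have -> : 2 * (- (p + 1) / (2 * q)) * q = - (p + 1) by field.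
  lra.
have := h (- q / r); rewrite -(pmulr_rge0 _ (_ : 0 < r)) ?lt_neqAle 1?eq_sym ?r1//.
have -> : r * (p + 2 * (- q / r) * q + (- q / r) ^+ 2 * r) = p * r - q ^+ 2.
  by field.
lra.
Qed.

(** Cauchy-Schwarz for a symmetric real bilinear form that is nonnegative only
    on a subspace [P]: it is used for [rip] itself and for the forms of
    operators that are positive on an invariant subspace. *)
Lemma form_cauchy_schwarz (B : V -> V -> R) (P : V -> Prop) x y :
  (forall x y, B x y = B y x) ->
  (forall x y z, B (x + y) z = B x z + B y z) ->
  (forall t x z, B (t%:C%C *: x) z = t * B x z) ->
  (forall t, P (x + t%:C%C *: y)) -> P y -> (forall x, P x -> 0 <= B x x) ->
  B x y ^+ 2 <= B x x * B y y.
Proof.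
move=> BC BD BZ PD Py B0; apply: discriminant; first exact: B0.
move=> t; have := B0 _ (PD t); rewrite BD BZ ![B _ (x + _)]BC !BD !BZ [B y x]BC.
by congr (_ <= _); ring.
Qed.

Lemma cauchy_schwarz x y : rip x y ^+ 2 <= nsq x * nsq y.
Proof.
apply: (@form_cauchy_schwarz rip (fun=> True)) => //.
- exact: ripC.
- exact: ripDl.
- exact: ripZl.
- by move=> z _; exact: nsq_ge0.
Qed.

Lemma nsqD_le x y : nsq (x + y) <= 2 * nsq x + 2 * nsq y.
Proof.
have := nsq_ge0 (x - y); rewrite /nsq !ripE (ripC y x); lra.
Qed.

Lemma nsqBZ x y t :
  nsq (x - t%:C%C *: y) = nsq x - 2 * t * rip x y + t ^+ 2 * nsq y.
Proof. rewrite /nsq !ripE (ripC y x); ring. Qed.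

Lemma young x y t : 0 < t -> 2 * rip x y <= t * nsq x + t^-1 * nsq y.
Proof.
move=> t0; have := nsq_ge0 (t%:C%C *: x - y); rewrite /nsq !ripE (ripC y x) => h.
rewrite -(@ler_pM2l _ t)//.
have -> : t * (t * rip x x + t^-1 * rip y y) = t ^+ 2 * rip x x + rip y y.
  by rewrite mulrDr mulVKf ?gt_eqF//; ring.
lra.
Qed.

End Hilbert.

(** * The top of a positive operator on an invariant subspace *)

Section Convergence.
Variables (R : realType) (V : lmodType R[i]) (ip : V -> V -> R[i]).
Hypothesis hs : hilbert_space ip.
Implicit Types (x y z : V) (u : nat -> V).

Local Notation rip := (rip ip).
Local Notation nsq := (nsq ip).

(** The form in which Cauchy-Schwarz turns norm convergence into convergence of
    inner products. *)
Lemma sqr_cvg0 (f g : nat -> R) (c : R) :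
  (forall n, f n ^+ 2 <= c * g n) -> g @ \oo --> 0 -> f @ \oo --> 0.
Proof.
move=> fg g0; apply/cvgr0Pnorm_lt => e e0.
have cg0 : (fun n => c * g n) @ \oo --> 0.
  by rewrite -[X in _ --> X](mulr0 c); apply: cvgMl_tmp.
have /cvgr0Pnorm_lt/(_ (e ^+ 2)) := cg0.
move=> /(_ (exprn_gt0 _ e0)); apply: filterS => n h.
rewrite -(@ltr_pXn2r _ 2) ?nnegrE// ?(ltW e0)// real_normK ?num_real//.
exact: le_lt_trans (fg n) (le_lt_trans (ler_norm _) h).
Qed.

Lemma seq_lim_unique (f : nat -> R) (a b : R) :
  f @ \oo --> a -> f @ \oo --> b -> a = b.
Proof.
by move=> fa fb; rewrite -(cvg_lim (@Rhausdorff R) fa) (cvg_lim (@Rhausdorff R) fb).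
Qed.

Lemma ler_lim_seq (f g : nat -> R) (a b : R) :
  f @ \oo --> a -> g @ \oo --> b -> (forall n, f n <= g n) -> a <= b.
Proof. by move=> fa gb fg; apply: ler_cvg_to fa gb _; apply: nearW. Qed.

Definition cv u x := (fun n => nsq (u n - x)) @ \oo --> (0 : R).

Lemma cv_rip u x y : cv u x -> (fun n => rip (u n) y) @ \oo --> rip x y.
Proof.
move=> ux; apply/subr_cvg0/(@sqr_cvg0 _ _ (nsq y)); last exact: ux.
by move=> n; rewrite -(ripBl hs) mulrC; exact: cauchy_schwarz.
Qed.

Lemma cv_nsq u x : cv u x -> (fun n => nsq (u n)) @ \oo --> nsq x.
Proof.
move=> ux.
have -> : (fun n => nsq (u n)) = (fun n => nsq (u n - x) + 2 * rip (u n) x - nsq x).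
  apply/funext => n; rewrite /nsq !(ripE hs) (ripC hs x); ring.
have {2}-> : nsq x = 0 + 2 * rip x x - nsq x by rewrite /nsq; ring.
by apply: cvgB; [apply: cvgD; [exact: ux|apply: cvgMl_tmp; exact: cv_rip]|exact: cvg_cst].
Qed.

Lemma cv_ip_eq0 u x y : cv u x -> (forall n, ip (u n) y = 0) -> ip x y = 0.
Proof.
have rlim z : cv u x -> (forall n, ip (u n) z = 0) -> rip x z = 0.
  move=> ux h; apply: (@seq_lim_unique (fun n => rip (u n) z)).
    exact: cv_rip.
  by rewrite /rip; under eq_fun do rewrite h /=; exact: cvg_cst.
move=> ux h; apply/(ip_rip hs); split; first exact: rlim.
suff: rip x (- 'i%C *: y) = 0.
  by rewrite /rip (ipZl hs) (ipZr hs); case: (ip x y) => a b /=; lra.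
by apply: rlim => // n; rewrite (ipZr hs) h mulr0.
Qed.

End Convergence.

Section FormInf.
Variables (R : realType) (V : lmodType R[i]) (ip : V -> V -> R[i]).
Hypothesis hs : hilbert_space ip.
Local Notation nsq := (nsq ip).

(** By homogeneity it suffices to take the infimum over the unit sphere. *)
Lemma form_infimum (W : V -> Prop) (q : V -> R) (c : R) :
  (forall (t : R) x, W x -> W (t%:C%C *: x)) ->
  (forall (t : R) x, q (t%:C%C *: x) = t ^+ 2 * q x) ->
  (forall x, W x -> c * nsq x <= q x) ->
  (exists2 x, W x & x <> 0) ->
  exists k, [/\ c <= k, (forall x, W x -> k * nsq x <= q x) &
    forall e, 0 < e -> exists x, [/\ W x, nsq x = 1 & q x < k + e]].
Proof.
move=> WZ qZ qc [x0 Wx0 x0n0].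
pose S := [set r | exists x, [/\ W x, nsq x = 1 & r = q x]].
have unit x : x <> 0 -> W x -> exists t, [/\ t ^+ 2 * nsq x = 1, 0 < t ^+ 2 &
    W (t%:C%C *: x)].
  move=> xn0 Wx; exists (Num.sqrt (nsq x)^-1); have n0 := nsq_gt0 hs xn0.
  by rewrite sqr_sqrtr ?invr_ge0 ?ltW// mulVf ?gt_eqF// invr_gt0; split => //; exact: WZ.
have Sn0 : S !=set0.
  have [t [t1 _ Wt]] := unit _ x0n0 Wx0.
  by exists (q (t%:C%C *: x0)); exists (t%:C%C *: x0); rewrite (nsqZ hs).
have Slb : lbound S c.
  by move=> _ [x [Wx x1 ->]]; have := qc _ Wx; rewrite x1 mulr1.
have Shas : has_inf S by split => //; exists c.
exists (inf S); split.
- by apply: lb_le_inf.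
- move=> x Wx; have [->|/eqP xn0] := eqVneq x 0.
    by have := qZ 0 x; rewrite scale0r => ->; rewrite (nsq0 hs) mulr0 expr0n mul0r.
  have [t [t1 t0 Wt]] := unit _ xn0 Wx.
  have : inf S <= q (t%:C%C *: x).
    by apply: ge_inf; [exists c|exists (t%:C%C *: x); rewrite (nsqZ hs)].
  rewrite qZ -(ler_pM2l t0) mulrCA t1; lra.
- move=> e e0; have [_ [x [Wx x1 ->]] qe] := inf_adherent e0 Shas.
  by exists x.
Qed.

End FormInf.

Section PositiveOperator.
Variables (R : realType) (V : lmodType R[i]) (ip : V -> V -> R[i]).
Hypothesis hs : hilbert_space ip.
Implicit Types (x y z : V).

Local Notation rip := (rip ip).
Local Notation nsq := (nsq ip).
Local Notation cv := (cv ip).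

Variables (T : {linear V -> V}) (W : V -> Prop) (s : R).
Hypotheses (Tsym : forall x y, ip (T x) y = ip x (T y))
  (Tpos : forall x, 0 <= rip (T x) x).
Hypotheses (WD : forall x y, W x -> W y -> W (x + y))
  (WZ : forall (a : R[i]) x, W x -> W (a *: x))
  (WT : forall x, W x -> W (T x))
  (Wcv : forall u x, (forall n, W (u n)) -> cv u x -> W x).
Hypotheses (s_gt0 : 0 < s) (Tles : forall x, W x -> rip (T x) x <= s * nsq x).

Lemma rT_sym x y : rip (T x) y = rip x (T y).
Proof. by rewrite /rip Tsym. Qed.

Lemma rT_formC x y : rip (T x) y = rip (T y) x.
Proof. by rewrite rT_sym (ripC hs). Qed.

(** Cauchy-Schwarz for the form of [T], applied to [x] and [T x]. *)
Lemma nsqT_le x : W x -> nsq (T x) <= s * rip (T x) x.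
Proof.
move=> Wx.
have h : nsq (T x) ^+ 2 <= rip (T x) x * rip (T (T x)) (T x).
  have -> : nsq (T x) = rip (T x) (T x) by [].
  apply: (@form_cauchy_schwarz _ _ (fun x y => rip (T x) y) (fun=> True)) => //.
  - exact: rT_formC.
  - by move=> y z w; rewrite linearD (ripDl hs).
  - by move=> t y z; rewrite linearZ (ripZl hs).
have [n0|n0] := eqVneq (nsq (T x)) 0; first by rewrite n0 mulr_ge0// ltW.
have {}n0 : 0 < nsq (T x) by rewrite lt_neqAle eq_sym n0 nsq_ge0.
rewrite -(ler_pM2l n0) -expr2; apply: le_trans h _.
rewrite [leRHS](_ : _ = rip (T x) x * (s * nsq (T x))); last by ring.
by apply: ler_wpM2l; [exact: Tpos|apply: Tles; exact: WT].
Qed.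

Lemma cv_rT u x : (forall n, W (u n)) -> cv u x ->
  (fun n => rip (T (u n)) (u n)) @ \oo --> rip (T x) x.
Proof.
move=> Wu ux; have Wx := Wcv Wu ux.
have WB n : W (u n - x) by apply: WD => //; rewrite -scaleN1r; exact: WZ.
have -> : (fun n => rip (T (u n)) (u n)) =
   (fun n => rip (T (u n - x)) (u n - x) + 2 * rip (u n) (T x) - rip (T x) x).
  apply/funext => n; rewrite linearB !(ripE hs) -rT_sym (rT_formC x); ring.
have {2}-> : rip (T x) x = 0 + 2 * rip x (T x) - rip (T x) x.
  by rewrite -rT_sym; ring.
apply: cvgB; last exact: cvg_cst.
apply: cvgD; last by apply: cvgMl_tmp; exact: cv_rip.
apply: (@squeeze_cvgr _ _ _ _ (fun=> 0) (fun n => s * nsq (u n - x))).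
- by apply: nearW => n; rewrite Tpos Tles.
- exact: cvg_cst.
- by rewrite -[X in _ --> X](mulr0 s); apply: cvgMl_tmp.
Qed.

Let A x := s%:C%C *: x - T x.
Let a x := rip (A x) x.

Let aE x : a x = s * nsq x - rip (T x) x.
Proof. by rewrite /a /A (ripBl hs) (ripZl hs). Qed.

Let a_ge0 x : W x -> 0 <= a x.
Proof. by move=> Wx; rewrite aE subr_ge0 Tles. Qed.

Let A_sym x y : rip (A x) y = rip x (A y).
Proof. by rewrite /A !(ripE hs) rT_sym. Qed.

Let ADZ x y t : A (x + t%:C%C *: y) = A x + t%:C%C *: A y.
Proof.
have TD : T (x + t%:C%C *: y) = T x + t%:C%C *: T y by rewrite linearD linearZ.
by rewrite /A TD !scalerDr !scalerN !scalerA opprD addrACA (mulrC t%:C%C).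
Qed.

Let A_CS x y : W x -> W y -> rip (A x) y ^+ 2 <= a x * a y.
Proof.
move=> Wx Wy; apply: (@form_cauchy_schwarz _ _ (fun x y => rip (A x) y) W) => //.
- by move=> *; rewrite A_sym (ripC hs).
- by move=> *; rewrite !A_sym (ripDl hs).
- by move=> *; rewrite !A_sym (ripZl hs).
- by move=> t; apply: WD => //; exact: WZ.
Qed.

Let WA x : W x -> W (A x).
Proof.
by move=> Wx; apply: WD; [exact: WZ|rewrite -scaleN1r; apply/WZ/WT].
Qed.

Let U x := (s^-1)%:C%C *: T x.

Let W_iterU n x : W x -> W (iter n U x).
Proof. by move=> Wx; elim: n => //= n IH; apply/WZ/WT. Qed.

Let U_sym x y : rip (U x) y = rip x (U y).
Proof. by rewrite /U !(ripE hs) rT_sym. Qed.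

Let iterU_sym n x y : rip (iter n U x) y = rip x (iter n U y).
Proof. by elim: n x y => //= n IH x y; rewrite U_sym IH -iterSr. Qed.

Let AU x : A x = s%:C%C *: (x - U x).
Proof.
rewrite /A /U scalerBr scalerA -rmorphM/= mulfV ?gt_eqF//.
by rewrite scale1r.
Qed.

Let U_le x : W x -> rip (U x) x <= nsq x.
Proof.
move=> Wx; rewrite /U (ripZl hs) -(ler_pM2l s_gt0) mulVKf ?gt_eqF//.
exact: Tles.
Qed.

Let nsqU_le x : W x -> nsq (U x) <= rip (U x) x.
Proof.
move=> Wx; rewrite /U (nsqZ hs) (ripZl hs) -(ler_pM2l (exprn_gt0 2 s_gt0)).
have -> : s ^+ 2 * (s^-1 * rip (T x) x) = s * rip (T x) x.
  by field; rewrite gt_eqF.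
rewrite exprVn mulVKf ?expf_neq0 ?gt_eqF//; exact: nsqT_le.
Qed.

(** Mean ergodic theorem: as [0 <= T <= s] on [W], the numbers
    [<(T/s)^k x, x>] decrease, which makes [(T/s)^n x] a Cauchy sequence; its
    limit is the component of [x] in the kernel of [s - T]. *)
Lemma power_converges x : W x -> exists y, [/\ cv (fun n => iter n U x) y,
  W y, T y = s%:C%C *: y &
  forall n, exists2 z, W z & x - iter n U x = A z].
Proof.
move=> Wx; pose d k := rip (iter k U x) x.
have dD n k : rip (iter n U x) (iter k U x) = d (n + k)%N.
  by rewrite /d addnC iterD [in RHS]iterU_sym.
(* [d] is a squared norm at even indices and a value of the form at odd ones. *)
have dS k : 0 <= d k /\ d k.+1 <= d k.
  have de j : d j.*2 = nsq (iter j U x) by rewrite -addnn -dD.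
  have dod j : d j.*2.+1 = rip (U (iter j U x)) (iter j U x).
    by rewrite -addnn -addSn -dD.
  rewrite -[k]odd_double_half; case: (odd k); rewrite ?add1n ?add0n.
    rewrite -doubleS de dod /U; split; last by apply: nsqU_le; exact: W_iterU.
    by rewrite (ripZl hs) mulr_ge0 ?invr_ge0 ?(ltW s_gt0).
  by rewrite de dod; split; [exact: nsq_ge0|apply: U_le; exact: W_iterU].
have d0 k : 0 <= d k by have [] := dS k.
have dni : nonincreasing_seq d by apply/nonincreasing_seqP => k; have [] := dS k.
have dcv : cvgn d by apply: nonincreasing_is_cvgn => //; exists 0 => _ [k _ <-].
have dlim k : limn d <= d k by apply: nonincreasing_cvgn_ge.
have [y xy] : exists y, cv (fun n => iter n U x) y.
  apply: (ip_complete hs) => e e0.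
  have /cvgrPdist_lt/(_ (e / 2)) := dcv.
  move=> /(_ _)[|N _ hN]; first by rewrite divr_gt0.
  exists N => n k Nn Nk.
  have dl j : (N <= j)%N -> d j < limn d + e / 2.
    by move=> /hN /=; rewrite ltr_norml => /andP[]; lra.
  have -> : Re (ip (iter n U x - iter k U x) (iter n U x - iter k U x)) =
      d (n + n)%N + d (k + k)%N - 2 * d (n + k)%N.
    rewrite -/(rip _ _) !(ripE hs) !dD addnC; ring.
  have := dl (n + n)%N (leq_trans Nn (leq_addr _ _)).
  have := dl (k + k)%N (leq_trans Nk (leq_addr _ _)).
  have := dlim (n + k)%N; lra.
exists y; split => //; first by apply: Wcv xy => n; exact: W_iterU.
- apply/eqP; rewrite -subr_eq0; apply/eqP/(nsq_eq0 hs).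
  set w := T y - _; rewrite {1}/nsq {1}/w (ripBl hs) (ripZl hs) rT_sym.
  suff -> : rip y (T w) = s * rip y w by rewrite subrr.
  apply: (@seq_lim_unique _ (fun n => rip (iter n U x) (T w))).
    exact: cv_rip.
  have -> : (fun n => rip (iter n U x) (T w)) = (fun n => s * rip (iter n.+1 U x) w).
    apply/funext => n /=; rewrite {2}/U (ripZl hs) mulVKf ?gt_eqF//.
    by rewrite rT_sym.
  apply: cvgMl_tmp; have := @cv_rip _ _ _ hs _ _ w xy.
  by rewrite -(cvg_shiftS (fun n => rip (iter n U x) w)).
- elim=> [|n [z Wz IH]].
    by exists 0; [rewrite -(scale0r x); exact: WZ|rewrite /A/= subrr (linear0 T) scaler0 subr0].
  exists (z + (s^-1)%:C%C *: iter n U x).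
    by apply: WD => //; apply/WZ/W_iterU.
  rewrite ADZ -IH AU scalerA -rmorphM/= mulVf ?gt_eqF// scale1r.
  by rewrite addrA subrK.
Qed.

(** If [s] is no eigenvalue on [W] then the powers of [T/s] tend to [0], so the
    range of [s - T] is dense and a bound valid on that range is valid on [W]. *)
Lemma range_bound (d : R) :
  (forall y, W y -> T y = s%:C%C *: y -> y = 0) ->
  (forall z, W z -> d * nsq (A z) <= a (A z)) ->
  forall x, W x -> d * nsq x <= a x.
Proof.
move=> ker0 ran x Wx; have [y [xy Wy Ty xU]] := power_converges Wx.
have y0 : y = 0 by exact: ker0.
pose u n := x - iter n U x.
have Wu n : W (u n).
  by apply: WD => //; rewrite -scaleN1r; apply/WZ/W_iterU.
have ux : cv u x.
  rewrite /cv (_ : (fun n => _) = fun n => nsq (iter n U x - y)) //.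
  by apply/funext => n; rewrite y0 subr0 /u addrAC subrr sub0r (nsqN hs).
have ua : (fun n => a (u n)) @ \oo --> a x.
  under eq_fun do rewrite aE; rewrite aE; apply: cvgB; last exact: cv_rT.
  by apply: cvgMl_tmp; exact: cv_nsq ux.
have un : (fun n => d * nsq (u n)) @ \oo --> d * nsq x.
  by apply: cvgMl_tmp; exact: cv_nsq ux.
apply: (ler_lim_seq un ua) => n.
by have [z Wz xUz] := xU n; rewrite /u xUz; exact: ran.
Qed.

Hypothesis a_inf0 : forall c, 0 < c -> exists x, [/\ W x, nsq x = 1 &
  rip (s%:C%C *: x - T x) x < c].

Let not_bounded_below c : 0 < c -> ~ (forall x, W x -> c * nsq x <= a x).
Proof.
move=> c0 h; have [x [Wx x1 ax]] := a_inf0 c0.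
by have := h x Wx; rewrite x1 /a /A leNgt mulr1 ax.
Qed.

Let eigenvector_of_kernel :
  ~ (forall y, W y -> T y = s%:C%C *: y -> y = 0) ->
  exists y, [/\ W y, y <> 0 & T y = s%:C%C *: y].
Proof.
move=> h; apply: contrapT => h'; apply: h => y Wy Ty; apply: contrapT => y0.
by apply: h'; exists y.
Qed.

(** If the spectral value [s] were no eigenvalue, each of the finitely many
    functionals [<., v>] would be small for the form of [s - T] up to an error
    [eta |x|^2], and [s - T] would be bounded below on [W]. *)
Lemma top_attained_of_compact (vs : seq V) (C : R) : 0 <= C ->
  (forall v, v \in vs -> W v) ->
  (forall x, W x ->
     rip (T x) x <= s / 2 * nsq x + C * \sum_(v <- vs) rip x v ^+ 2) ->
  exists y, [/\ W y, y <> 0 & T y = s%:C%C *: y].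
Proof.
move=> C0 Wvs Tvs; apply: eigenvector_of_kernel => ker0.
have small v eta : 0 < eta -> W v -> exists2 B, 0 <= B &
    forall x, W x -> rip x v ^+ 2 <= B * a x + eta * nsq x.
  move=> eta0 Wv; have [y [vy Wy Ty vU]] := power_converges Wv.
  have y0 : y = 0 by exact: ker0.
  have /cvgr0Pnorm_lt/(_ (eta / 2)) := vy.
  move=> /(_ _)[|N _ /(_ N (leqnn N)) /=]; first by rewrite divr_gt0.
  rewrite y0 subr0 ger0_norm ?nsq_ge0//; set v' := iter N U v => v'eta.
  have [z Wz vz] := vU N; exists (2 * a z); first by rewrite mulr_ge0 ?a_ge0.
  move=> x Wx; have -> : v = A z + v' by rewrite -vz subrK.
  rewrite (ripDr hs) -A_sym.
  have h1 := A_CS Wx Wz; have h2 := cauchy_schwarz hs x v'.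
  have h3 : nsq x * nsq v' <= nsq x * (eta / 2).
    by apply: ler_wpM2l; [exact: nsq_ge0|exact: ltW].
  have h4 : 0 <= (rip (A x) z - rip x v') ^+ 2 by exact: sqr_ge0.
  nra.
have smalls eta : 0 < eta -> exists2 B, 0 <= B & forall x, W x ->
    \sum_(v <- vs) rip x v ^+ 2 <= B * a x + eta * nsq x.
  elim: vs eta Wvs {Tvs} => [|v vs IH] eta Wvs eta0.
    by exists 0 => // x Wx; rewrite big_nil mul0r add0r mulr_ge0 ?nsq_ge0 ?ltW.
  have e20 : 0 < eta / 2 by rewrite divr_gt0.
  have [|B B0 hB] := IH (eta / 2) _ e20.
    by move=> w wvs; apply: Wvs; rewrite in_cons wvs orbT.
  have [B' B'0 hB'] := @small v (eta / 2) e20 (Wvs _ (mem_head _ _)).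
  exists (B + B'); first exact: addr_ge0.
  by move=> x Wx; rewrite big_cons; have := hB x Wx; have := hB' x Wx; lra.
(* Then [C] times the error is at most [s / 4], which leaves [a x] a quarter of
   [s |x|^2]. *)
have [|B B0 hB] := smalls (s / (4 * (C + 1))); first by rewrite divr_gt0// mulr_gt0//; lra.
have CB : 0 < 1 + C * B by have := mulr_ge0 C0 B0; lra.
apply: (@not_bounded_below (s / 4 / (1 + C * B))); first by rewrite !divr_gt0.
move=> x Wx; rewrite mulrAC ler_pdivrMr//.
have h1 := Tvs _ Wx; have h2 := ler_wpM2l C0 (hB _ Wx).
have h3 : C * (s / (4 * (C + 1)) * nsq x) <= s / 4 * nsq x.
  rewrite mulrA; apply: ler_wpM2r; first exact: nsq_ge0.
  have C1 : 0 < C + 1 by lra.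
  have -> : C * (s / (4 * (C + 1))) = s / 4 * (C / (C + 1)).
    by field; rewrite gt_eqF.
  have : C / (C + 1) <= 1 by rewrite ler_pdivrMr// mul1r lerDl.
  by move: s_gt0; nra.
by have := aE x; lra.
Qed.

(** Let [A = s - T]. It suffices that [A^2 >= d A] on [W]: this gives [A >= d] on
    the range of [A], which is dense if [s] is no eigenvalue. If the infimum [k]
    of [A^2 - d A] were negative, then [A^2 - d A - k = (A - r1) (A - r2)] with
    [r1] and [r2] in the gap would be invertible, nonnegative, and arbitrarily
    small at unit vectors, which is impossible as in [top_not_invertible]. *)
Lemma top_attained_of_gap (d : R) : 0 < d ->
  (forall t, s - d < t -> t < s -> exists (G : V -> V) (C : R), forall g,
     [/\ t%:C%C *: G g - T (G g) = g, nsq (G g) <= C * nsq g & W g -> W (G g)]) ->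
  exists y, [/\ W y, y <> 0 & T y = s%:C%C *: y].
Proof.
move=> d0 inv; apply: eigenvector_of_kernel => ker0.
suff gap x : W x -> d * a x <= nsq (A x).
  apply: (not_bounded_below d0) => x Wx; apply: range_bound => // z Wz.
  have h1 := A_CS Wz (WA Wz); have h2 := gap _ Wz; have a0 := a_ge0 (WA Wz).
  have [n0|n0] := eqVneq (nsq (A z)) 0; first by rewrite n0 mulr0.
  have {}n0 : 0 < nsq (A z) by rewrite lt_neqAle eq_sym n0 nsq_ge0.
  rewrite -(ler_pM2l n0); change (rip (A z) (A z)) with (nsq (A z)) in h1.
  by nra.
pose q x := nsq (A x) - d * a x.
have AZ t z : A (t%:C%C *: z) = t%:C%C *: A z.
  by rewrite -[t%:C%C *: z]add0r ADZ /A (linear0 T) scaler0 subr0 add0r.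
have qZ t z : q (t%:C%C *: z) = t ^+ 2 * q z.
  by rewrite /q /a AZ (nsqZ hs) !(ripE hs); ring.
have qlow z : W z -> - (d ^+ 2 / 4) * nsq z <= q z.
  move=> Wz; have := nsq_ge0 hs (A z - (d / 2)%:C%C *: z).
  by rewrite (nsqBZ hs) /q /a; lra.
have W1 : exists2 x, W x & x <> 0.
  have [y [Wy y1 _]] := a_inf0 ltr01; exists y => // y0.
  by move: y1; rewrite y0 (nsq0 hs); lra.
have [k [lek kq qk]] := form_infimum hs (fun t => @WZ t%:C%C) qZ qlow W1.
suff k0 : 0 <= k.
  move=> Wx; have := kq _ Wx; have := mulr_ge0 k0 (nsq_ge0 hs x); rewrite /q; lra.
rewrite leNgt; apply/negP => k0.
(* The roots of [x^2 - d x - k] are [d / 2 - D] and [d / 2 + D]. *)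
pose D := Num.sqrt (d ^+ 2 / 4 + k).
have D0 : 0 <= D by exact: sqrtr_ge0.
have D2 : D ^+ 2 = d ^+ 2 / 4 + k by rewrite sqr_sqrtr//; lra.
have Dd : D < d / 2 by nra.
have [||G1 [C1 hG1]] := inv (s - (d / 2 - D)); [lra|lra|].
have [||G2 [C2 hG2]] := inv (s - (d / 2 + D)); [lra|lra|].
pose B x y := rip (A x) (A y) - d * rip (A x) y - k * rip x y.
pose M := (1 + `|C1| * `|C2|) / 2.
have M0 : 0 < M by rewrite divr_gt0// ltr_wpDr// mulr_ge0.
have [|f [Wf f1 qf]] := qk (M + 1)^-1; first by rewrite invr_gt0; lra.
have [E1 N1 WG1] := hG1 f; have [E2 N2 WG2] := hG2 (G1 f).
pose h := G2 (G1 f); have Wh : W h by exact/WG2/WG1.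
have Ah : A h = G1 f + (d / 2 + D)%:C%C *: h.
  by rewrite -{1}E2 -/h /A rmorphB/= scalerBl addrAC subrK.
have AG : A (G1 f) = f + (d / 2 - D)%:C%C *: G1 f.
  by rewrite -{2}E1 /A (rmorphB _ s)/= scalerBl addrAC subrK.
(* [h] is the preimage of [f] under [(A - r1) (A - r2)]. *)
have Bhy y : B h y = rip f y.
  have e1 : rip (A h) (A y) =
      rip f y + (d / 2 - D) * rip (G1 f) y + (d / 2 + D) * rip (A h) y.
    by rewrite -(A_sym (A h)) {1}Ah ADZ AG 2!(ripDl hs) !(ripZl hs).
  have e2 : rip (A h) y = rip (G1 f) y + (d / 2 + D) * rip h y.
    by rewrite Ah (ripDl hs) (ripZl hs).
  have -> : B h y = rip f y + (D ^+ 2 - d ^+ 2 / 4 - k) * rip h y.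
    by rewrite /B e1 e2; field.
  by rewrite D2; ring.
have BWW y : W y -> 0 <= B y y.
  by move=> Wy; rewrite /B subr_ge0; exact: kq.
have := @form_cauchy_schwarz _ _ B W h f.
rewrite !Bhy -/(nsq f) f1 expr1n => /(_ _ _ _ _ Wf BWW) CS.
have Bff : B f f < (M + 1)^-1 by move: qf; rewrite /q /B -/(nsq f) f1 -/(nsq (A f)) -/(a f); lra.
have nh : nsq h <= `|C1| * `|C2|.
  apply: le_trans N2 _; rewrite mulrC.
  apply: le_trans (ler_wpM2l (nsq_ge0 hs _) (ler_norm C2)) _.
  rewrite ler_wpM2r//; apply: le_trans N1 _.
  by rewrite f1 mulr1 ler_norm.
have hf : rip h f <= M.
  by have := young hs h f ltr01; rewrite invr1 !mul1r f1 /M; lra.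
have : 1 <= rip h f * B f f.
  rewrite (ripC hs); apply: CS => [y z|y z w|t y w|t].
  - rewrite /B (A_sym y z) (ripC hs (A y) (A z)) (ripC hs y (A z)).
    by rewrite (ripC hs y z).
  - by rewrite /B !A_sym !(ripDl hs); ring.
  - by rewrite /B !A_sym !(ripZl hs); ring.
  - by apply: WD => //; apply: WZ.
have : rip h f * B f f <= M * (M + 1)^-1.
  apply: le_trans (ler_wpM2r (BWW _ Wf) hf) _.
  by apply: ler_wpM2l; exact: ltW.
have : M * (M + 1)^-1 < 1 by rewrite ltr_pdivrMr; lra.
lra.
Qed.

(** With [A = s - T], Cauchy-Schwarz for the form of [A] gives
    [|x|^4 <= <A x, x> <x, G x>]; a bounded [G] cannot survive unit vectors for
    which [<A x, x>] is arbitrarily small. *)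
Lemma top_not_invertible (G : V -> V) (C : R) :
  (forall g, [/\ A (G g) = g, nsq (G g) <= C * nsq g & W g -> W (G g)]) -> False.
Proof.
move=> hG; pose M := (1 + `|C|) / 2.
have M0 : 0 < M by rewrite divr_gt0// ltr_wpDr.
have [|x [Wx x1 ax]] := @a_inf0 (M + 1)^-1; first by rewrite invr_gt0; lra.
have [E N /(_ Wx) WG] := hG x.
have CS := A_CS WG Wx; rewrite /a E -/(nsq x) x1 expr1n in CS.
have aM : rip x (G x) <= M.
  have := young hs x (G x) ltr01; rewrite invr1 !mul1r x1 /M.
  by move: N; rewrite x1 mulr1; have := ler_norm C; lra.
have : rip x (G x) * a x <= M * (M + 1)^-1.
  apply: le_trans (ler_wpM2r (a_ge0 Wx) aM) _.
  by apply: ler_wpM2l; exact: ltW.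
have : M * (M + 1)^-1 < 1 by rewrite ltr_pdivrMr; lra.
rewrite -/(a x) in CS; lra.
Qed.

End PositiveOperator.

(** * Orthonormal sequences *)

Section Orthonormal.
Variables (R : realType) (V : lmodType R[i]) (ip : V -> V -> R[i]).
Hypothesis hs : hilbert_space ip.
Implicit Types (x y : V) (v : nat -> V) (c : nat -> R[i]).
Local Notation rip := (rip ip).
Local Notation nsq := (nsq ip).
Local Notation cv := (cv ip).
Local Notation normc := Normc.normc.

Lemma normc2E (z : R[i]) : normc z ^+ 2 = Re z ^+ 2 + Im z ^+ 2.
Proof.
by case: z => a b; rewrite /= sqr_sqrtr// addr_ge0 ?sqr_ge0.
Qed.

Lemma mulconjc (z : R[i]) : z * z^*%C = (normc z ^+ 2)%:C%C.
Proof.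
rewrite normc2E; case: z => a b /=; apply/eqP; rewrite eq_complex /=.
by apply/andP; split; apply/eqP; ring.
Qed.

Lemma normc_ge0 (z : R[i]) : 0 <= normc z.
Proof. by case: z => a b; exact: sqrtr_ge0. Qed.

Definition orthonormal_seq v := forall i j, ip (v i) (v j) = (i == j)%:R.

Variable v : nat -> V.
Hypothesis ov : orthonormal_seq v.

Definition comb c n := \sum_(i < n) c i *: v i.

Lemma ip_comb c n k : ip (comb c n) (v k) = if (k < n)%N then c k else 0.
Proof.
rewrite /comb (ip_suml hs); under eq_bigr do rewrite (ipZl hs) ov.
case: ltnP => kn.
  rewrite (bigD1 (Ordinal kn))//= eqxx mulr1 big1 ?addr0// => i.
  by rewrite -val_eqE/= => /negbTE ->; rewrite mulr0.
by rewrite big1// => i _; rewrite ltn_eqF ?mulr0// (leq_trans (ltn_ord i)).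
Qed.

Lemma nsq_comb c n : nsq (comb c n) = \sum_(i < n) normc (c i) ^+ 2.
Proof.
rewrite /nsq /rip {2}/comb (ip_sumr hs).
transitivity (Re (\sum_(i < n) (normc (c i) ^+ 2)%:C%C)).
  congr Re; apply: eq_bigr => i _.
  by rewrite (ipZr hs) ip_comb ltn_ord mulrC mulconjc.
by rewrite -(rmorph_sum (@real_complex R)).
Qed.

Lemma nsqB_comb x n :
  nsq (x - comb (fun i => ip x (v i)) n) =
  nsq x - \sum_(i < n) normc (ip x (v i)) ^+ 2.
Proof.
rewrite -(nsq_comb (fun i => ip x (v i))); set y := comb _ _.
have xy : rip x y = nsq y.
  rewrite /nsq /rip {1 3}/y /comb !(ip_sumr hs); congr Re.
  by apply: eq_bigr => i _; rewrite !(ipZr hs) ip_comb ltn_ord.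
by rewrite {1}/nsq !(ripE hs) (ripC hs y x) xy /nsq; ring.
Qed.

Lemma bessel x n : \sum_(i < n) normc (ip x (v i)) ^+ 2 <= nsq x.
Proof. by have := nsq_ge0 hs (x - comb (fun i => ip x (v i)) n); rewrite nsqB_comb; lra. Qed.

Lemma bounded_series_cvg (u : nat -> R) (M : R) :
  (forall n, 0 <= u n) -> (forall n, \sum_(i < n) u i <= M) -> cvgn (series u).
Proof.
move=> u0 uM; apply: nondecreasing_is_cvgn.
  by apply: nondecreasing_series => n _ _; exact: u0.
by exists M => _ [n _ <-]; rewrite /series /= big_mkord.
Qed.

(** The terms of a convergent series: orthonormal sequences tend weakly to zero. *)
Lemma bessel_cvg x : (fun n => normc (ip x (v n)) ^+ 2) @ \oo --> 0.
Proof.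
apply: cvg_series_cvg_0; apply: (@bounded_series_cvg _ (nsq x)) => n.
  exact: sqr_ge0.
exact: bessel.
Qed.

Lemma rip2_le x y : rip x y ^+ 2 <= normc (ip x y) ^+ 2.
Proof. by rewrite normc2E lerDl sqr_ge0. Qed.

(** Riesz-Fischer: the norms of the increments of [comb c] are tails of a
    convergent series. *)
Lemma comb_cvg c (M : R) : (forall n, \sum_(i < n) normc (c i) ^+ 2 <= M) ->
  exists y, [/\ cv (comb c) y, forall k, ip y (v k) = c k & nsq y <= M].
Proof.
move=> cM; pose u i := normc (c i) ^+ 2.
have u0 i : 0 <= u i by exact: sqr_ge0.
have ucv : cvgn (series u) by exact: bounded_series_cvg u0 cM.
have combB n k : (n <= k)%N -> nsq (comb c k - comb c n) = series u k - series u n.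
  move=> nk; rewrite /series /= !big_mkord -(subnKC nk).
  have -> : comb c (n + (k - n)) - comb c n =
      comb (fun i => if (i < n)%N then 0 else c i) (n + (k - n)).
    rewrite /comb !big_split_ord /= addrAC subrr add0r.
    rewrite [X in _ = X + _]big1 ?add0r => [|i _]; last by rewrite ltn_ord scale0r.
    by apply: eq_bigr => i _; rewrite ltnNge leq_addr.
  rewrite nsq_comb !big_split_ord /= [X in X + _ = _]big1 ?add0r; last first.
    by move=> i _; rewrite ltn_ord Normc.normc0 expr0n.
  rewrite addrAC subrr add0r; apply: eq_bigr => i _.
  by rewrite ltnNge leq_addr.
have [y cy] : exists y, cv (comb c) y.
  apply: (ip_complete hs) => e e0.
  have /cvgrPdist_lt/(_ (e / 2)) := ucv.
  move=> /(_ _)[|N _ hN]; first by rewrite divr_gt0.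
  exists N => n k Nn Nk.
  rewrite -[Re _]/(nsq (comb c n - comb c k)).
  have := hN _ Nn; have := hN _ Nk; rewrite /= !ltr_norml => /andP[a1 a2] /andP[b1 b2].
  wlog nk : n k Nn Nk a1 a2 b1 b2 / (n <= k)%N.
    move=> w; have [nk|/ltnW nk] := leqP n k; first exact: (w n k).
    by rewrite -opprB (nsqN hs); exact: (w k n).
  by rewrite -(nsqN hs) opprB combB//; lra.
exists y; split => //.
- move=> k; apply/eqP; rewrite -subr_eq0 -[c k]mulr1.
  have -> : 1 = ip (v k) (v k) by rewrite ov eqxx.
  rewrite -(ipZl hs) -(ipBl hs); apply/eqP.
  apply: (@cv_ip_eq0 _ _ _ hs (fun n => comb c (n + k.+1) - c k *: v k)).
    have := cy; rewrite /cv -(cvg_shiftn k.+1) => h.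
    rewrite (_ : (fun n => _) = (fun n => nsq (comb c (n + k.+1) - y))) //.
    by apply/funext => n; congr nsq; rewrite opprB addrA subrK.
  by move=> n; rewrite (ipBl hs) (ipZl hs) ov eqxx mulr1 ip_comb leq_addl subrr.
- apply: (ler_lim_seq (cv_nsq hs cy) (cvg_cst M)) => n.
  by rewrite nsq_comb.
Qed.

End Orthonormal.

(** * Peeling off eigenvectors *)

Section Peeling.
Variables (R : realType) (V : lmodType R[i]) (ip : V -> V -> R[i]).
Hypothesis hs : hilbert_space ip.
Implicit Types (x y : V) (es : seq V).
Local Notation rip := (rip ip).
Local Notation nsq := (nsq ip).
Local Notation cv := (cv ip).

Variables (T : {linear V -> V}) (M : R).
Hypotheses (Tsym : forall x y, ip (T x) y = ip x (T y))
  (Tpos : forall x, 0 <= rip (T x) x) (M_gt0 : 0 < M)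
  (TM : forall x, rip (T x) x <= M * nsq x)
  (Tinj : forall x, T x = 0 -> x = 0).

Definition perp es x := forall e, e \in es -> ip x e = 0.

Definition orthonormal_eigenvectors es :=
  [/\ uniq es, (forall e e', e \in es -> e' \in es -> ip e e' = (e == e')%:R) &
      forall e, e \in es -> exists l : R, T e = l%:C%C *: e].

Lemma perpD es x y : perp es x -> perp es y -> perp es (x + y).
Proof. by move=> px py e ees; rewrite (ipDl hs) px// py// addr0. Qed.

Lemma perpZ es (a : R[i]) x : perp es x -> perp es (a *: x).
Proof. by move=> px e ees; rewrite (ipZl hs) px// mulr0. Qed.

Lemma perpT es x : orthonormal_eigenvectors es -> perp es x -> perp es (T x).
Proof.
move=> [_ _ Tes] px e ees; have [l Tl] := Tes e ees.
by rewrite Tsym Tl (ipZr hs) px// mulr0.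
Qed.

Lemma perp_cv es (u : nat -> V) x : (forall n, perp es (u n)) -> cv u x -> perp es x.
Proof. by move=> pu ux e ees; apply: (cv_ip_eq0 hs ux) => n; exact: pu. Qed.

(** [nsqT_le] bounds [T x] by the form. *)
Lemma Tpos_def x : rip (T x) x = 0 -> x = 0.
Proof.
move=> Tx; apply: Tinj; apply: (nsq_eq0 hs); apply/eqP.
rewrite eq_le nsq_ge0 // andbT.
have := @nsqT_le _ _ _ hs T (fun=> True) M Tsym Tpos (fun _ _ => I) M_gt0 (fun x _ => TM x) x I.
by rewrite Tx mulr0.
Qed.

Definition proj_perp es x := x - \sum_(e <- es) ip x e *: e.

Lemma proj_perpP es x : orthonormal_eigenvectors es -> perp es (proj_perp es x).
Proof.
move=> [ues oes _] e ees; rewrite /proj_perp (ipBl hs) (ip_suml hs).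
rewrite (bigD1_seq e)//= (ipZl hs) (oes e e ees ees) eqxx mulr1.
rewrite big_seq_cond big1 ?addr0 ?subrr//.
by move=> f /andP[fes fe]; rewrite (ipZl hs) (oes f e fes ees) (negbTE fe) mulr0.
Qed.

Lemma ip_proj_perp es x y : perp es x -> ip x (proj_perp es y) = ip x y.
Proof.
move=> px; rewrite /proj_perp (ipBr hs) (ip_sumr hs) big_seq big1 ?subr0// => e ees.
by rewrite (ipZr hs) px// mulr0.
Qed.

(** The second clause makes [s] the exact supremum on the unit sphere, through
    almost maximizing vectors; [top_attained] asks for a maximizing one. *)
Definition top_of es (s : R) :=
  (forall x, perp es x -> rip (T x) x <= s * nsq x) /\
  (forall c, 0 < c -> exists x, [/\ perp es x, nsq x = 1 &
     rip (s%:C%C *: x - T x) x < c]).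

Definition top_attained := forall es s, orthonormal_eigenvectors es -> 0 < s ->
  top_of es s -> exists y, [/\ perp es y, y <> 0 & T y = s%:C%C *: y].

(** Injectivity makes the form of [T] strictly positive, hence [0 < s]. *)
Lemma top_exists es : (exists2 x, perp es x & x <> 0) ->
  exists2 s, 0 < s & top_of es s.
Proof.
move=> ex; have [x0 px0 x0n] := ex.
have [|||k [lek kT kc]] := @form_infimum _ _ _ hs (perp es) (fun x => - rip (T x) x) (- M) _ _ _ ex.
- by move=> t x; exact: perpZ.
- by move=> t x; rewrite linearZ/= (ripZl hs) (ripZr hs); ring.
- by move=> x _; rewrite mulNr lerN2.
exists (- k).
  have Tx0 : 0 < rip (T x0) x0.
    by rewrite lt_neqAle eq_sym Tpos andbT; apply/eqP => /Tpos_def.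
  have := kT _ px0; have := nsq_gt0 hs x0n; nra.
split=> [x px|c c0]; first by rewrite mulNr; have := kT x px; lra.
have [x [px x1 xk]] := kc _ c0; exists x; split => //.
by rewrite (ripBl hs) (ripZl hs) -/(nsq x) x1; lra.
Qed.

(** A weak form of compactness, which is what lower bounds on the form of the
    inverse of [T] provide directly. *)
Definition quasi_compact := forall e : R, 0 < e -> exists (vs : seq V) (C : R),
  0 <= C /\ forall x, rip (T x) x <= e * nsq x + C * \sum_(v <- vs) rip x v ^+ 2.

Lemma quasi_compact_top_attained : quasi_compact -> top_attained.
Proof.
move=> qc es s oes s0 [Ts cs].
have [vs [C [C0 hC]]] := qc (s / 2) (divr_gt0 s0 (ltr0n _ 2)).
apply: (@top_attained_of_compact _ _ _ hs T (perp es) s Tsym Tpos _ _ _ _ s0 Ts cs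
   (map (proj_perp es) vs) C C0).
- by move=> x y; exact: perpD.
- by move=> a x; exact: perpZ.
- by move=> x; exact: perpT.
- by move=> u x; exact: perp_cv.
- by move=> _ /mapP[v _ ->]; exact: proj_perpP.
move=> x px; rewrite big_map; apply: le_trans (hC x) _; rewrite lerD2l.
apply: ler_wpM2l => //; rewrite le_eqVlt; apply/orP; left; apply/eqP.
by apply: eq_bigr => v _; rewrite /rip ip_proj_perp.
Qed.

Definition bounded_inverse (t : R) := exists (G : V -> V) (C : R),
  forall g, t%:C%C *: G g - T (G g) = g /\ nsq (G g) <= C * nsq g.

(** What purely discrete spectrum of [H] leaves for a positive, bounded inverse [T]
    of a shift of [H]. An eigenspace of infinite dimension is excluded in the
    form of an orthonormal sequence. *)
Definition discrete_positive_spectrum := forall t : R, 0 < t ->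
  bounded_inverse t \/
  (exists2 e : R, 0 < e & forall t' : R, 0 < t' -> t' != t -> `|t' - t| < e ->
     bounded_inverse t') /\
  ~ exists2 v : nat -> V, orthonormal_seq ip v & forall n, T (v n) = t%:C%C *: v n.

Lemma bounded_inverse_eigen t y : bounded_inverse t -> T y = t%:C%C *: y -> y = 0.
Proof.
move=> [G [C hG]] Ty; apply: (nsq_eq0 hs); have [E _] := hG y.
rewrite /nsq -{2}E (ripBr hs) (ripZr hs) -(rT_sym Tsym) Ty.
by rewrite (ripZl hs) subrr.
Qed.

(** For an eigenvector [e] with eigenvalue [l], pairing [(t - T) G g = g] with [e]
    gives [(t - l) <G g, e> = <g, e>]; so [G] preserves the complement. *)
Lemma bounded_inverse_perp es t : orthonormal_eigenvectors es -> bounded_inverse t ->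
  exists (G : V -> V) (C : R), forall g,
    [/\ t%:C%C *: G g - T (G g) = g, nsq (G g) <= C * nsq g &
        perp es g -> perp es (G g)].
Proof.
move=> [ues oes Tes] inv; have [G [C hG]] := inv.
exists G, C => g; have [E N] := hG g; split => // pg e ees.
have [l Tl] := Tes e ees.
have [lt|lt] := eqVneq l t.
  have := @bounded_inverse_eigen t e inv; rewrite -lt => /(_ Tl) e0.
  by have := oes e e ees ees; rewrite eqxx e0 !(ip0r hs).
have : (t - l)%:C%C * ip (G g) e = 0.
  have := pg e ees; rewrite -{1}E (ipBl hs) (ipZl hs) Tsym Tl (ipZr hs) conjc_real.
  by move=> <-; rewrite rmorphB/= mulrBl.
move/eqP; rewrite mulf_eq0 => /orP[|/eqP//].
by rewrite eq_complex/= eqxx andbT subr_eq0 eq_sym (negbTE lt).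
Qed.

(** The top is no regular value by [top_not_invertible]. Hence it is isolated, the
    values slightly below it are regular, and [top_attained_of_gap] applies. *)
Lemma discrete_top_attained : discrete_positive_spectrum -> top_attained.
Proof.
move=> ds es s oes s0 [Ts cs].
have [inv|[[e e0 he] _]] := ds s s0.
  have [G [C hG]] := bounded_inverse_perp oes inv.
  by have := top_not_invertible hs Tsym (@perpD es) (@perpZ es) Ts cs hG.
apply: (@top_attained_of_gap _ _ _ hs T (perp es) s Tsym Tpos _ _ _ _ s0 Ts cs (Num.min e s)).
- by move=> x y; exact: perpD.
- by move=> a x; exact: perpZ.
- by move=> x; exact: perpT.
- by move=> u x; exact: perp_cv.
- by rewrite lt_min e0.
move=> t st ts; apply: bounded_inverse_perp => //.
have [me ms] : Num.min e s <= e /\ Num.min e s <= s by rewrite !ge_min !lexx orbT.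
by apply: he; [lra|rewrite lt_eqF|rewrite ltr_norml; apply/andP; split; lra].
Qed.

(** The last clause says that the eigenvectors have been chosen greedily: [s n] is
    the top of [T] on the complement of the first [n] of them. *)
Definition spectral_sequence (v : nat -> V) (s : nat -> R) :=
  [/\ orthonormal_seq ip v, forall n, T (v n) = (s n)%:C%C *: v n,
      forall n, 0 < s n &
      forall n x, (forall i, (i < n)%N -> ip x (v i) = 0) ->
        rip (T x) x <= s n * nsq x].

Lemma spectral_sequence_exists :
  (forall es, orthonormal_eigenvectors es -> exists2 x, perp es x & x <> 0) ->
  top_attained -> exists v s, spectral_sequence v s.
Proof.
move=> infdim att.
have step es : exists p : V * R, orthonormal_eigenvectors es ->
    [/\ perp es p.1, nsq p.1 = 1, 0 < p.2, T p.1 = p.2%:C%C *: p.1 &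
        forall x, perp es x -> rip (T x) x <= p.2 * nsq x].
  have [oes|] := pselect (orthonormal_eigenvectors es); last by exists (0, 0).
  have [s s0 st] := top_exists (infdim es oes).
  have [y [py y0 Ty]] := att es s oes s0 st.
  have n0 := nsq_gt0 hs y0.
  exists ((Num.sqrt (nsq y)^-1)%:C%C *: y, s) => _; split => //=.
  - exact: perpZ.
  - by rewrite (nsqZ hs) sqr_sqrtr ?invr_ge0 ?ltW// mulVf// gt_eqF.
  - by rewrite linearZ/= Ty !scalerA mulrC.
  - exact: st.1.
have [F hF] := choice step.
pose L n := iter n (fun es => rcons es (F es).1) [::].
have Lsub n k : (n <= k)%N -> {subset L n <= L k}.
  move=> nk; rewrite -(subnKC nk); elim: (k - n)%N => [|j IH]; first by rewrite addn0.
  by move=> e /IH h; rewrite addnS /= mem_rcons inE h orbT.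
have oL n : orthonormal_eigenvectors (L n).
  elim: n => [|n [uL oL eL]]; first by split.
  have [pF F1 s0 TF _] := hF (L n) (And3 uL oL eL).
  have FF : ip (F (L n)).1 (F (L n)).1 = 1 by rewrite (ip_nsq hs) F1.
  have FL : (F (L n)).1 \notin L n.
    by apply/negP => /pF; rewrite FF => /eqP; rewrite oner_eq0.
  split=> /=.
  - by rewrite rcons_uniq FL.
  - move=> e e'; rewrite !mem_rcons !inE => /orP[/eqP ->|eL0] /orP[/eqP ->|eL'0].
    + by rewrite eqxx FF.
    + by rewrite pF//; case: eqP eL'0 => // <-; rewrite (negbTE FL).
    + by rewrite (ipC hs) pF// conjc0; case: eqP eL0 => // ->; rewrite (negbTE FL).
    + exact: oL.
  - move=> e; rewrite mem_rcons inE => /orP[/eqP ->|]; last exact: eL.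
    by exists (F (L n)).2.
pose v n := (F (L n)).1; pose s n := (F (L n)).2.
have hv n := hF _ (oL n).
have vL i n : (i < n)%N -> v i \in L n.
  by move=> iltn; apply: (Lsub i.+1 n iltn); rewrite /= mem_rcons mem_head.
have Lv n e : e \in L n -> exists2 i, (i < n)%N & e = v i.
  elim: n => // n IH; rewrite /= mem_rcons inE => /orP[/eqP ->|/IH[i ni ->]].
    by exists n.
  by exists i => //; rewrite ltnS ltnW.
exists v, s; split.
- move=> i j; have [pi i1 _ _ _] := hv i; have [pj _ _ _ _] := hv j.
  have [ij|ji|->] := ltngtP i j.
  + by rewrite (ipC hs) pj ?conjc0//; exact: vL.
  + by rewrite pi//; exact: vL.
  + by rewrite (ip_nsq hs) /v; have [_ -> _ _ _] := hv j.
- by move=> n; have [] := hv n.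
- by move=> n; have [] := hv n.
- move=> n x px; have [_ _ _ _ ] := hv n; apply => e /Lv[i ni ->].
  exact: px.
Qed.

Section SpectralSequence.
Variables (v : nat -> V) (s : nat -> R).
Hypothesis vs : spectral_sequence v s.

Let ov : orthonormal_seq ip v. Proof. by case: vs. Qed.

Let nsqv n : nsq (v n) = 1.
Proof. by have := ov n n; rewrite (ip_nsq hs) eqxx => /eqP; rewrite eq_complex/= => /andP[/eqP]. Qed.

Let ripTv n : rip (T (v n)) (v n) = s n.
Proof. by case: vs => _ -> _ _; rewrite (ripZl hs) -/(nsq _) nsqv mulr1. Qed.

Lemma spectral_noninc : {homo s : n k / (n <= k)%N >-> k <= n}.
Proof.
apply/nonincreasing_seqP => n; case: vs => _ _ _ h; rewrite -ripTv.
have := h n (v n.+1); rewrite nsqv mulr1; apply => i ni.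
by rewrite ov gtn_eqF// ltnS ltnW.
Qed.

Let s_ge0 n : 0 <= s n. Proof. by case: vs => _ _ h _; exact: ltW. Qed.

Lemma spectral_limit : exists l : R, [/\ 0 <= l, s @ \oo --> l & forall n, l <= s n].
Proof.
have scv : cvgn s.
  by apply: nonincreasing_is_cvgn; [exact: spectral_noninc|exists 0 => _ [n _ <-]].
exists (limn s); split => //; last exact: nonincreasing_cvgn_ge spectral_noninc scv.
by apply: limr_ge => //; apply: nearW.
Qed.

(** Along the eigenvectors the finitely many functionals tend to zero by Bessel,
    so a positive limit [l] would satisfy [l <= l / 2]. *)
Lemma quasi_compact_spectral0 : quasi_compact -> s @ \oo --> 0.
Proof.
move=> qc; have [l [l0 sl ls]] := spectral_limit.
have [l00|ln0] := eqVneq l 0; first by move: sl; rewrite l00.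
have {}l0 : 0 < l by rewrite lt_neqAle eq_sym ln0.
have [us [C [C0 hC]]] := qc (l / 2) (divr_gt0 l0 (ltr0n _ 2)).
have su : (fun n => \sum_(u <- us) rip (v n) u ^+ 2) @ \oo --> 0.
  elim: us {hC} => [|u us IH].
    by under eq_fun do rewrite big_nil; exact: cvg_cst.
  have u0 : (fun n => rip (v n) u ^+ 2) @ \oo --> 0.
    apply: (@squeeze_cvgr _ _ _ _ (fun=> 0) _) (cvg_cst _) (bessel_cvg hs ov u).
    by apply: nearW => n; rewrite sqr_ge0 (ripC hs) rip2_le.
  have -> : (fun n => \sum_(w <- u :: us) rip (v n) w ^+ 2) =
      (fun n => rip (v n) u ^+ 2) \+ (fun n => \sum_(w <- us) rip (v n) w ^+ 2).
    by apply/funext => n; rewrite big_cons.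
  by have := cvgD u0 IH; rewrite addr0; apply.
have h : l <= l / 2 + C * 0.
  apply: (@ler_lim_seq _ (fun=> l) (fun n => l / 2 + C * \sum_(u <- us) rip (v n) u ^+ 2)).
  - exact: cvg_cst.
  - by apply: cvgD; [exact: cvg_cst|apply: cvgMl_tmp].
  - move=> n; apply: le_trans (ls n) _; rewrite -ripTv.
    by have := hC (v n); rewrite nsqv mulr1.
by lra.
Qed.

(** A positive limit [l] of the [s n] would be an accumulation point of
    eigenvalues unless [s n = l] for large [n], and then its eigenspace would
    have infinite dimension. *)
Lemma discrete_spectral0 : discrete_positive_spectrum -> s @ \oo --> 0.
Proof.
move=> ds; have [l [l0 sl ls]] := spectral_limit.
have [l00|ln0] := eqVneq l 0; first by move: sl; rewrite l00.
have {}l0 : 0 < l by rewrite lt_neqAle eq_sym ln0.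
have [_ Tv s0 _] := vs; exfalso.
have near e : 0 < e -> exists N, forall n, (N <= n)%N -> `|s n - l| < e.
  move=> e0; have /cvgrPdist_lt/(_ e e0) := sl.
  by case=> N _ hN; exists N => n /hN /=; rewrite distrC.
have vn0 n : v n <> 0 by move=> v0; have := nsqv n; rewrite v0 (nsq0 hs); lra.
have [inv|[[e e0 he] ninf]] := ds l l0.
  have [G [C hG]] := inv.
  have [|N /(_ N (leqnn N)) hN] := near (1 / (`|C| + 1)); first by rewrite divr_gt0.
  pose g := (l - s N)%:C%C *: v N; have [/eqP + ] := hG g.
  rewrite subr_eq => /eqP E; have GE : G g = v N.
    apply/eqP; rewrite -subr_eq0; apply/eqP/(bounded_inverse_eigen inv).
    rewrite linearB/= Tv scalerBr E {2}/g rmorphB/= scalerBl.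
    by rewrite addrAC [X in _ = X + _]addrAC subrr add0r addrC.
  rewrite GE (nsqZ hs) nsqv.
  rewrite mulr1 => h1; have h2 : (l - s N) ^+ 2 <= (1 / (`|C| + 1)) ^+ 2.
    by rewrite -(real_normK (num_real (l - s N))) ler_pXn2r ?nnegrE// 1?distrC ltW.
  have C1 : 0 < `|C| + 1 by have := normr_ge0 C; lra.
  have : `|C| * (1 / (`|C| + 1)) ^+ 2 < 1.
    rewrite expr_div_n expr1n mulrA mulr1 ltr_pdivrMr ?exprn_gt0//.
    by have := normr_ge0 C; nra.
  have := ler_wpM2l (normr_ge0 C) h2; have := ler_wpM2r (sqr_ge0 (l - s N)) (ler_norm C).
  lra.
have [N hN] := near e e0.
have sl' n : (N <= n)%N -> s n = l.
  move=> Nn; apply: contrapT => /eqP sn.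
  exact: (vn0 n (bounded_inverse_eigen (he _ (s0 n) sn (hN _ Nn)) (Tv n))).
apply: ninf; exists (fun n => v (N + n)%N) => [i j|n].
  by rewrite ov eqn_add2l.
by rewrite Tv sl'// leq_addr.
Qed.

End SpectralSequence.

End Peeling.

(** * Expansion in eigenvectors *)

Lemma exists_left_kernel (F : fieldType) (n : nat) (A : 'M[F]_(n.+1, n)) :
  exists2 c : 'rV[F]_n.+1, c != 0 & c *m A = 0.
Proof.
exists (nz_row (kermx A)); last by apply/sub_kermxP/nz_row_sub.
rewrite nz_row_eq0 kermx_eq0 /row_free neq_ltn; apply/orP; left.
by rewrite ltnS rank_leq_col.
Qed.

Lemma positive_lower_bound (R : realType) (u : nat -> R) (N : nat) (e : R) :
  0 < e -> (forall n, 0 < u n) -> (forall n, (N <= n)%N -> e <= u n) ->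
  exists2 c, 0 < c & forall n, c <= u n.
Proof.
elim: N e => [|N IH] e e0 u0 ue; first by exists e => // n; exact: ue.
apply: (IH (Num.min e (u N))) => // [|n]; first by rewrite lt_min e0 u0.
by rewrite leq_eqVlt ge_min => /orP[/eqP <-|/ue ->//]; rewrite lexx orbT.
Qed.

Section SpectralExpansion.
Variables (R : realType) (V : lmodType R[i]) (ip : V -> V -> R[i]).
Hypothesis hs : hilbert_space ip.
Implicit Types (x y : V).
Local Notation rip := (rip ip).
Local Notation nsq := (nsq ip).
Local Notation normc := Normc.normc.

Variables (T : {linear V -> V}) (M : R).
Hypotheses (Tsym : forall x y, ip (T x) y = ip x (T y))
  (Tpos : forall x, 0 <= rip (T x) x) (M_gt0 : 0 < M)
  (TM : forall x, rip (T x) x <= M * nsq x)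
  (Tinj : forall x, T x = 0 -> x = 0).

Variables (v : nat -> V) (s : nat -> R).
Hypotheses (vs : spectral_sequence ip T v s) (s0 : s @ \oo --> 0).

Let ov : orthonormal_seq ip v. Proof. by case: vs. Qed.

(** The form of [T] at [x] is at most [s n |x|^2] for all [n], and [s n -> 0]. *)
Lemma spectral_complete x : (forall i, ip x (v i) = 0) -> x = 0.
Proof.
move=> xv; apply: (Tpos_def hs Tsym Tpos M_gt0 TM Tinj); apply/eqP.
rewrite eq_le Tpos andbT -(mul0r (nsq x)).
apply: (@ler_lim_seq _ (fun=> rip (T x) x) (fun n => s n * nsq x)).
- exact: cvg_cst.
- exact: cvgMr_tmp.
- by move=> n; case: vs => _ _ _; apply.
Qed.

Lemma ip_T_spectral x n : ip (T x) (v n) = (s n)%:C%C * ip x (v n).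
Proof. by case: vs => _ Tv _ _; rewrite Tsym Tv (ipZr hs) conjc_real. Qed.

Lemma resolvent_unique (z : R[i]) f : (forall n, 1 - z * (s n)%:C%C != 0) ->
  f - z *: T f = 0 -> f = 0.
Proof.
move=> z1 fz; apply: spectral_complete => i.
have : ip (f - z *: T f) (v i) = 0 by rewrite fz (ip0l hs).
rewrite (ipBl hs) (ipZl hs) ip_T_spectral mulrA -{1}[ip f _]mul1r -mulrBl.
by move/eqP; rewrite mulf_eq0 (negbTE (z1 i)) => /eqP.
Qed.

(** The coefficients of [f] are those of [g] times [s i / (1 - z s i)]. The
    denominators stay away from zero because [s i] tends to zero. *)
Lemma resolvent_exists (z : R[i]) : (forall n, 1 - z * (s n)%:C%C != 0) ->
  exists C : R, forall g, exists f, f - z *: T f = T g /\ nsq f <= C * nsq g.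
Proof.
move=> z1.
have normc_gt0 (w : R[i]) : w != 0 -> 0 < normc w.
  by move=> w0; rewrite lt_neqAle eq_sym normc_ge0 andbT; apply: contra w0 => /eqP/Normc.eq0_normc ->.
have normcR (a : R) : 0 <= a -> normc a%:C%C = a.
  by move=> a0; rewrite /= expr0n addr0 sqrtr_sqr ger0_norm.
have [_ _ sp _] := vs.
have [c c0 hc] : exists2 c, 0 < c & forall n, c <= normc (1 - z * (s n)%:C%C).
  have zs : (fun n => normc z * s n) @ \oo --> 0.
    by rewrite -(mulr0 (normc z)); exact: cvgMl_tmp.
  have /cvgr0Pnorm_lt/(_ (2^-1)) := zs.
  move=> /(_ _)[|N _ hN]; first by rewrite invr_gt0.
  apply: (@positive_lower_bound _ _ N 2^-1) => [|n|n Nn].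
  - by rewrite invr_gt0.
  - exact: normc_gt0.
  - have h := hN _ Nn; rewrite /= ger0_norm ?mulr_ge0 ?normc_ge0 ?(ltW (sp n))// in h.
    have : normc 1 <= normc (1 - z * (s n)%:C%C) + normc (z * (s n)%:C%C).
      by rewrite -{1}(subrK (z * (s n)%:C%C) 1); exact: le_normcD.
    rewrite Normc.normc1 Normc.normcM normcR ?(ltW (sp n))//; lra.
pose C := (s 0%N / c) ^+ 2; exists C => g.
pose d i := (s i)%:C%C / (1 - z * (s i)%:C%C) * ip g (v i).
have dle i : normc (d i) ^+ 2 <= C * normc (ip g (v i)) ^+ 2.
  rewrite /d Normc.normcM exprMn ler_wpM2r ?sqr_ge0//.
  rewrite ler_pXn2r ?nnegrE ?normc_ge0 ?divr_ge0 ?(ltW c0) ?(ltW (sp _))//.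
  rewrite Normc.normcM Normc.normcV normcR ?(ltW (sp _))//; apply: ler_pM.
  - exact: ltW.
  - by rewrite invr_ge0 normc_ge0.
  - exact: (spectral_noninc hs vs).
  - by rewrite lef_pV2 ?posrE ?normc_gt0.
have [|f [_ fd fC]] := @comb_cvg _ _ _ hs v ov d (C * nsq g).
  move=> n; apply: le_trans (_ : \sum_(i < n) C * normc (ip g (v i)) ^+ 2 <= _).
    by apply: ler_sum => i _; exact: dle.
  rewrite -mulr_sumr ler_wpM2l ?sqr_ge0//; exact: bessel.
exists f; split => //; apply/eqP; rewrite -subr_eq0; apply/eqP/spectral_complete => i.
rewrite !(ipBl hs) (ipZl hs) !ip_T_spectral fd /d.
by field; exact: z1.
Qed.

(** The upper half of the min-max principle: [n] linear conditions cannot kill the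
    span of [n + 1] eigenvectors. On that span, [x = T y] has
    [<y, x> = sum |c i|^2 / s i]. *)
Lemma spectral_min_max (w : nat -> V) (n : nat) : exists x y,
  [/\ x <> 0, T y = x, rip y x <= nsq x / s n &
      forall j, (j < n)%N -> ip x (w j) = 0].
Proof.
pose A : 'M[R[i]]_(n.+1, n) := \matrix_(i, j) ip (v i) (w j).
have [c c0 cA] := exists_left_kernel A.
have [_ Tv sp _] := vs.
pose d i := c 0 (inord i); pose d' i := (s i)^-1%:C%C * d i.
exists (comb v d n.+1), (comb v d' n.+1); split.
- move=> x0; move/eqP: c0; apply; apply/rowP => i; rewrite mxE.
  have := ip_comb hs ov d n.+1 i; rewrite x0 (ip0l hs) ltn_ord /d.
  by rewrite inord_val.
- rewrite /comb linear_sum; apply: eq_bigr => i _.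
  rewrite linearZ/= Tv scalerA /d' mulrAC -rmorphM/= mulVf ?gt_eqF//.
  by rewrite mul1r.
- rewrite (nsq_comb hs ov) mulr_suml /rip /comb (ip_sumr hs).
  rewrite (_ : \sum_(i < n.+1) _ = \sum_(i < n.+1) ((s i)^-1 * normc (d i) ^+ 2)%:C%C); last first.
    apply: eq_bigr => i _; rewrite (ipZr hs) -/(comb v d' n.+1) (ip_comb hs ov).
    by rewrite ltn_ord /d' mulrCA [(d i)^*%C * _]mulrC mulconjc -rmorphM.
  rewrite -(rmorph_sum (@real_complex R))/=; apply: ler_sum => i _.
  rewrite mulrC ler_wpM2l ?sqr_ge0// lef_pV2 ?posrE//.
  by apply: (spectral_noninc hs vs); rewrite -ltnS.
- move=> j jn; rewrite /comb (ip_suml hs).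
  transitivity ((c *m A) 0 (Ordinal jn)); last by rewrite cA mxE.
  by rewrite mxE; apply: eq_bigr => i _; rewrite (ipZl hs) [A _ _]mxE /d inord_val.
Qed.

Lemma sum_bessel_cvg0 (e : nat -> V) (I : Type) (r : seq I) (y : I -> V) :
  orthonormal_seq ip e ->
  (fun n => \sum_(i <- r) normc (ip (e n) (y i)) ^+ 2) @ \oo --> 0.
Proof.
move=> oe; elim: r => [|i r IH].
  by under eq_fun do rewrite big_nil; exact: cvg_cst.
have -> : (fun n => \sum_(j <- i :: r) normc (ip (e n) (y j)) ^+ 2) =
    (fun n => normc (ip (y i) (e n)) ^+ 2) \+
    (fun n => \sum_(j <- r) normc (ip (e n) (y j)) ^+ 2).
  apply/funext => n; rewrite big_cons /= (ipC hs (e n)) !normc2E.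
  by congr (_ + _); case: (ip (e n) _) => a b /=; rewrite sqrrN.
by have := cvgD (bessel_cvg hs oe (y i)) IH; rewrite addr0; apply.
Qed.

(** [T] does not mix the span of the first [N] eigenvectors with its complement,
    where the top is [s N]. *)
Lemma spectral_form_le x N :
  rip (T x) x <= s N * nsq x + s 0%N * \sum_(i < N) normc (ip x (v i)) ^+ 2.
Proof.
have [_ Tv sp _] := vs; pose c i := ip x (v i); pose y := x - comb v c N.
have yv i : (i < N)%N -> ip y (v i) = 0.
  by move=> iN; rewrite /y (ipBl hs) (ip_comb hs ov) iN subrr.
have Tcomb d : T (comb v d N) = comb v (fun i => (s i)%:C%C * d i) N.
  rewrite /comb linear_sum; apply: eq_bigr => i _.
  by rewrite linearZ/= Tv scalerA mulrC.
have ycomb d : rip y (comb v d N) = 0.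
  rewrite /rip /comb (ip_sumr hs) big1// => i _.
  by rewrite (ipZr hs) yv// mulr0.
have Tyc d : rip (T y) (comb v d N) = 0 by rewrite (rT_sym Tsym) Tcomb ycomb.
have xE : x = y + comb v c N by rewrite /y subrK.
clearbody y.
have nx : nsq x = nsq y + nsq (comb v c N).
  by rewrite {1}xE {1}/nsq !(ripE hs) (ripC hs _ y) ycomb /nsq; ring.
have Tx : rip (T x) x = rip (T y) y + rip (T (comb v c N)) (comb v c N).
  rewrite {1 2}xE linearD !(ripE hs) (rT_formC hs Tsym (comb v c N) y) Tyc; ring.
rewrite Tx; apply: lerD.
  apply: le_trans (_ : s N * nsq y <= _); first by case: vs => _ _ _; apply.
  by rewrite nx ler_wpM2l ?(ltW (sp _))// lerDl nsq_ge0.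
rewrite mulr_sumr /rip {2}/comb (ip_sumr hs).
rewrite (_ : \sum_(i < N) _ = \sum_(i < N) (s i * normc (c i) ^+ 2)%:C%C); last first.
  apply: eq_bigr => i _; rewrite (ipZr hs) Tcomb (ip_comb hs ov) ltn_ord.
  by rewrite mulrCA [(c i)^*%C * _]mulrC mulconjc -rmorphM.
rewrite -(rmorph_sum (@real_complex R))/=; apply: ler_sum => i _.
by rewrite ler_wpM2r ?sqr_ge0//; exact: (spectral_noninc hs vs).
Qed.

(** [s N] is small for large [N], and for fixed [N] the remaining finite sum in
    [spectral_form_le] tends to zero by Bessel. *)
Lemma spectral_form_small (e : nat -> V) (d : R) : orthonormal_seq ip e -> 0 < d ->
  exists n, rip (T (e n)) (e n) < d.
Proof.
move=> oe d0; have /cvgr0Pnorm_lt/(_ (d / 2) (divr_gt0 d0 (ltr0n _ 2))) := s0.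
have [_ _ sp _] := vs; case=> N _ /(_ N (leqnn N)) /=.
rewrite gtr0_norm// => sN.
have h0 := @sum_bessel_cvg0 e _ (index_enum 'I_N) (fun i => v i) oe.
have h1 : (fun n => s 0%N * \sum_(i < N) normc (ip (e n) (v i)) ^+ 2) @ \oo --> 0.
  by rewrite -[X in _ --> X](mulr0 (s 0%N)); apply: cvgMl_tmp; exact: h0.
have /cvgr0Pnorm_lt/(_ (d / 2) (divr_gt0 d0 (ltr0n _ 2))) := h1.
case=> k _ /(_ k (leqnn k)) /= /(le_lt_trans (ler_norm _)) h; exists k.
have := spectral_form_le (e k) N.
have -> : nsq (e k) = 1 by rewrite /nsq /rip oe eqxx.
lra.
Qed.

(** If [es] spanned the space, [1 = |e n|^2] would be the sum of the
    [|<e n, f>|^2] for [f] in [es], which tends to zero. *)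
Lemma infinite_dimensional (e : nat -> V) : orthonormal_seq ip e ->
  forall es, orthonormal_eigenvectors ip T es -> exists2 x, perp ip es x & x <> 0.
Proof.
move=> oe es oes; apply: contrapT => h.
have e0 n : proj_perp ip es (e n) = 0.
  by apply: contrapT => n0; apply: h; exists (proj_perp ip es (e n)) => //; exact: (proj_perpP hs (e n) oes).
have : (fun n => \sum_(f <- es) normc (ip (e n) f) ^+ 2) @ \oo --> 0.
  exact: sum_bessel_cvg0.
have -> : (fun n => \sum_(f <- es) normc (ip (e n) f) ^+ 2) = fun=> 1.
  apply/funext => n; have := congr1 (fun x => Re (ip (e n) x)) (e0 n).
  rewrite /= (ip0r hs) /proj_perp (ipBr hs) (ip_sumr hs) oe eqxx raddfB/= => /eqP.
  rewrite subr_eq0 => /eqP ->.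
  rewrite (_ : \sum_(f <- es) _ = \sum_(f <- es) (normc (ip (e n) f) ^+ 2)%:C%C).
    by rewrite -(rmorph_sum (@real_complex R)).
  by apply: eq_bigr => f _; rewrite (ipZr hs) mulrC mulconjc.
move=> h0; have : 1 = 0 :> R by apply: seq_lim_unique h0; exact: cvg_cst.
by move/eqP; rewrite oner_eq0.
Qed.

End SpectralExpansion.

(** * Sums of real families *)

Section RealSums.
Variables (R : realType) (Y : choiceType).
Implicit Types (u w : Y -> R) (r : seq Y).

Local Notation esumT u := (\esum_(y in [set: Y]) (u y)%:E)%E.

Lemma sum_le_esum u r : uniq r -> ((\sum_(y <- r) u y)%:E <= esumT u)%E.
Proof.
move=> ur; apply: esum_ge; exists [set` r].
  by split => //; exact: finite_seq.
by rewrite -fsbig_seq// sumEFin.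
Qed.

Lemma esum_leP u (c : R) :
  (esumT u <= c%:E)%E <-> forall r, uniq r -> \sum_(y <- r) u y <= c.
Proof.
split=> [h r ur|h].
  by rewrite -lee_fin; apply: le_trans (sum_le_esum u ur) h.
apply: ge_ereal_sup => _ [A [finA _] <-].
by rewrite fsbig_finite//= sumEFin lee_fin; apply: h; exact: finmap.fset_uniq.
Qed.

(** The families on which [rsum] is additive. *)
Definition summ u := (esumT (fun y => `|u y|%R) < +oo)%E.

Lemma summP u : summ u <-> exists c, forall r, uniq r -> \sum_(y <- r) `|u y| <= c.
Proof.
split=> [su|[c /esum_leP h]]; last exact: le_lt_trans h (ltry c).
exists (fine (esumT (fun y => `|u y|%R))); apply/esum_leP.
by rewrite fineK// ge0_fin_numE// esum_ge0// => y _; rewrite lee_fin.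
Qed.

Lemma summ_le u w : (forall y, `|u y| <= w y) -> summ w -> summ u.
Proof.
move=> uw /summP[c hc]; apply/summP; exists c => r ur.
apply: le_trans (hc r ur); apply: ler_sum => y _.
exact: le_trans (uw y) (ler_norm _).
Qed.

Lemma summD u w : summ u -> summ w -> summ (fun y => u y + w y).
Proof.
move=> /summP[c hc] /summP[d hd]; apply/summP; exists (c + d) => r ur.
apply: le_trans (lerD (hc r ur) (hd r ur)); rewrite -big_split.
by apply: ler_sum => y _; exact: ler_normD.
Qed.

Lemma summZ (a : R) u : summ u -> summ (fun y => a * u y).
Proof.
move=> /summP[c hc]; apply/summP; exists (`|a| * c) => r ur.
under eq_bigr do rewrite normrM.
by rewrite -mulr_sumr ler_wpM2l//; exact: hc.
Qed.

Lemma esum_fin u : (forall y, 0 <= u y) -> summ u -> esumT u = (fine (esumT u))%:E.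
Proof.
move=> u0 su; rewrite fineK// ge0_fin_numE; last first.
  by rewrite esum_ge0// => y _; rewrite lee_fin.
by rewrite (eq_esum (b := fun y => `|u y|%:E))// => y _; rewrite ger0_norm.
Qed.

Lemma summ_ge0 u : (forall y, 0 <= u y) -> summ u <-> (esumT u < +oo)%E.
Proof.
by move=> u0; rewrite /summ (eq_esum (b := fun y => (u y)%:E))// => y _; rewrite ger0_norm.
Qed.

Lemma summ_pos u : summ u -> summ u^\+.
Proof.
move=> su; apply: (@summ_le _ (fun y => `|u y|)).
  by move=> y; rewrite /funrpos ger0_norm ?le_max ?lexx ?orbT// ge_max normr_ge0 ler_norm.
by move: su; rewrite /summ; under [in X in _ -> X]eq_esum do rewrite normr_id.
Qed.

Lemma summ_neg u : summ u -> summ u^\-.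
Proof.
move=> su; apply: (@summ_le _ (fun y => `|u y|)).
  by move=> y; rewrite /funrneg ger0_norm ?le_max ?lexx ?orbT// ge_max normr_ge0 -normrN ler_norm.
by move: su; rewrite /summ; under [in X in _ -> X]eq_esum do rewrite normr_id.
Qed.

(** [rsum] is computed from the positive and the negative part, but any
    decomposition into summable nonnegative families gives the same value. *)
Lemma rsumB (p n : Y -> R) : (forall y, 0 <= p y) -> (forall y, 0 <= n y) ->
  summ p -> summ n ->
  rsum (fun y => p y - n y) = fine (esumT p) - fine (esumT n).
Proof.
move=> p0 n0 sp sn; rewrite /rsum; set u := fun y => p y - n y.
have su : summ u.
  apply: (@summ_le _ (fun y => p y + n y)); last exact: summD.
  by move=> y; rewrite (le_trans (ler_normB _ _))// !ger0_norm.
have up := funrpos_ge0 u; have un := funrneg_ge0 u.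
have : esumT (fun y => u^\+ y + n y) = esumT (fun y => p y + u^\- y).
  apply: eq_esum => y _; congr EFin; rewrite /funrpos /funrneg /u.
  by case: (leP (p y - n y) 0) => h; [rewrite max_l|rewrite max_r]; lra.
under eq_esum do rewrite EFinD; under [in X in _ = X]eq_esum do rewrite EFinD.
rewrite !esumD; try by move=> y _; rewrite lee_fin.
rewrite (esum_fin up (summ_pos su)) (esum_fin un (summ_neg su)).
rewrite (esum_fin p0 sp) (esum_fin n0 sn).
by rewrite -!EFinD => -[] h; rewrite /=; lra.
Qed.

Lemma rsumE u : rsum u = fine (esumT u^\+) - fine (esumT u^\-).
Proof. by []. Qed.

Lemma rsum_ge0E u : (forall y, 0 <= u y) -> rsum u = fine (esumT u).
Proof.
move=> u0; rewrite /rsum [X in _ - fine X](_ : _ = 0%E) ?subr0.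
  by congr fine; apply: eq_esum => y _; rewrite /funrpos max_l.
by apply: esum1 => y _; rewrite /funrneg max_r// oppr_le0.
Qed.

Lemma rsumD u w : summ u -> summ w ->
  rsum (fun y => u y + w y) = rsum u + rsum w.
Proof.
move=> su sw; have := funrpos_ge0 u; have := funrneg_ge0 u.
have := funrpos_ge0 w; have := funrneg_ge0 w => wn wp un up.
have su1 := summ_pos su; have su2 := summ_neg su.
have sw1 := summ_pos sw; have sw2 := summ_neg sw.
have E z : z = z^\+ - z^\- :> (Y -> R).
  apply/funext => y; rewrite /funrpos /funrneg !fctE.
  by case: (leP (z y) 0) => h; [rewrite max_l|rewrite max_r]; lra.
rewrite (_ : (fun y => _) = fun y => (u^\+ y + w^\+ y) - (u^\- y + w^\- y)).
  rewrite rsumB; [|by move=> y; apply: addr_ge0|by move=> y; apply: addr_ge0|exact: summD|exact: summD].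
  have fD p n : (forall y, 0 <= p y) -> (forall y, 0 <= n y) -> summ p -> summ n ->
      fine (esumT (fun y => p y + n y)) = fine (esumT p) + fine (esumT n).
    move=> p0 n0 sp sn; under eq_esum do rewrite EFinD.
    rewrite esumD; try by move=> y _; rewrite lee_fin.
    by rewrite (esum_fin p0 sp) (esum_fin n0 sn).
  by rewrite (fD u^\+ w^\+)// (fD u^\- w^\-)// !rsumE opprD addrACA.
by apply/funext => y; rewrite {1}(E u) {1}(E w) !fctE; lra.
Qed.

Lemma rsumN u : rsum (fun y => - u y) = - rsum u.
Proof.
rewrite !rsumE opprB; congr (_ - _); congr fine; apply: eq_esum => y _ //.
by rewrite /funrneg opprK.
Qed.

Lemma rsum_ge0 u : (forall y, 0 <= u y) -> 0 <= rsum u.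
Proof.
by move=> u0; rewrite rsum_ge0E// fine_ge0// esum_ge0// => y _; rewrite lee_fin.
Qed.

Lemma rsumZ (a : R) u : summ u -> rsum (fun y => a * u y) = a * rsum u.
Proof.
wlog a0 : a / 0 <= a.
  move=> h su; have [/h->//|a0] := leP 0 a.
  rewrite -[in LHS](opprK a); under [X in rsum X]eq_fun do rewrite mulNr.
  by rewrite rsumN h ?oppr_ge0 1?ltW// mulNr opprK.
have h p : (forall y, 0 <= p y) -> summ p ->
    fine (esumT (fun y => a * p y)) = a * fine (esumT p).
  move=> p0 sp; have sap := summZ a sp.
  have ap0 y : 0 <= a * p y by exact: mulr_ge0.
  have [->|an0] := eqVneq a 0.
    by rewrite mul0r; under eq_esum do rewrite mul0r; rewrite esum1.
  have {}an0 : 0 < a by rewrite lt_neqAle eq_sym an0.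
  apply/eqP; rewrite eq_le; apply/andP; split.
    rewrite -lee_fin -(esum_fin ap0)//; apply/esum_leP => r ur.
    rewrite -mulr_sumr ler_wpM2l//.
    by rewrite -lee_fin -(esum_fin p0)//; exact: sum_le_esum.
  rewrite -ler_pdivlMl// -lee_fin -(esum_fin p0)//; apply/esum_leP => r ur.
  rewrite ler_pdivlMl// mulr_sumr -lee_fin -(esum_fin ap0)//.
  exact: sum_le_esum.
move=> su; have hp := h _ (funrpos_ge0 u) (summ_pos su).
have hn := h _ (funrneg_ge0 u) (summ_neg su).
by rewrite !rsumE ge0_funrposM// ge0_funrnegM// hp hn mulrBr.
Qed.

Lemma ler_rsum u w : summ u -> summ w -> (forall y, u y <= w y) -> rsum u <= rsum w.
Proof.
move=> su sw uw; rewrite -subr_ge0 -rsumN -rsumD//; last first.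
  by rewrite (_ : (fun y => - u y) = fun y => -1 * u y) ?summZ//; apply/funext => y; rewrite mulN1r.
by apply: rsum_ge0 => y; rewrite subr_ge0.
Qed.

Lemma esum_pred1 y0 : esumT (fun y => (y == y0)%:R : R) = 1%:E.
Proof.
rewrite -[RHS](@esum_set1 R Y y0 (fun=> 1%:E))//.
rewrite [RHS]esum_mkcond; apply: eq_esum => y _.
by have [->|/eqP yy0] := eqVneq y y0; [rewrite mem_set|rewrite memNset].
Qed.

Lemma summ_pred1 y0 : summ (fun y : Y => (y == y0)%:R : R).
Proof. by apply/summ_ge0 => [y|]; rewrite ?ler0n// esum_pred1 ltry. Qed.

Lemma rsum_pred1 y0 : rsum (fun y : Y => (y == y0)%:R : R) = 1.
Proof. by rewrite rsum_ge0E ?esum_pred1// => y; rewrite ler0n. Qed.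

Lemma summ_rsum_seq u r : uniq r -> (forall y, y \notin r -> u y = 0) ->
  summ u /\ rsum u = \sum_(y <- r) u y.
Proof.
elim: r u => [|y0 r IH] u.
  move=> _ u0; have -> : u = fun=> 0 by apply/funext => y; rewrite u0.
  split; first by rewrite /summ; under eq_esum do rewrite normr0; rewrite esum1// ltry.
  by rewrite big_nil rsum_ge0E// esum1.
move=> /= /andP[y0r ur] u0; pose w y := if y == y0 then 0 else u y.
have [sw rw] : summ w /\ rsum w = \sum_(y <- r) w y.
  apply: IH => // y yr; rewrite /w; case: eqVneq => // yy0; apply: u0.
  by rewrite inE negb_or yy0.
have uE : u = fun y => u y0 * (y == y0)%:R + w y.
  apply/funext => y; rewrite /w; case: eqVneq => [->|_]; first by rewrite mulr1 addr0.
  by rewrite mulr0 add0r.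
have s1 := summZ (u y0) (summ_pred1 y0).
split; first by rewrite uE; exact: summD.
rewrite [in LHS]uE rsumD// rsumZ; last exact: summ_pred1.
rewrite rsum_pred1 mulr1 big_cons rw; congr (_ + _).
rewrite !big_seq; apply: eq_bigr => y yr; rewrite /w ifF//; apply/eqP => yy0.
by move: y0r; rewrite -yy0 yr.
Qed.

(** Fatou's lemma for counting measure with weights absorbed in [u]. *)
Lemma esum_limit_le (u : nat -> Y -> R) (w : Y -> R) (c : R) N :
  (forall y, (fun n => u n y) @ \oo --> w y) ->
  (forall n, (N <= n)%N -> esumT (u n) <= c%:E)%E -> (esumT w <= c%:E)%E.
Proof.
move=> uw uc; apply/esum_leP => r ur.
have h : (fun n => \sum_(y <- r) u (n + N)%N y) @ \oo --> \sum_(y <- r) w y.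
  elim: r {ur} => [|y r IH].
    by under eq_fun do rewrite big_nil; rewrite big_nil; exact: cvg_cst.
  have -> : (fun n => \sum_(y <- y :: r) u (n + N)%N y) =
      (fun n => u (n + N)%N y) \+ (fun n => \sum_(y <- r) u (n + N)%N y).
    by apply/funext => n; rewrite big_cons.
  rewrite big_cons; apply: cvgD => //.
  by have := uw y; rewrite -(cvg_shiftn N).
apply: (ler_lim_seq h (cvg_cst c)) => n.
by apply: (esum_leP _ c).1 => //; apply: uc; exact: leq_addl.
Qed.

End RealSums.

(** * Weighted square summable functions *)

Section WeightedL2.
Variables (R : realType) (Y : choiceType) (w : Y -> R).
Hypothesis w0 : forall y, 0 <= w y.
Implicit Types (f g h : Y -> R[i]).
Local Notation normc := Normc.normc.

Definition sqw f (y : Y) : R := normc (f y) ^+ 2 * w y.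

Lemma sqw_ge0 f y : 0 <= sqw f y.
Proof. by rewrite mulr_ge0 ?sqr_ge0. Qed.

Lemma ell2E f : ell2 w f <-> summ (sqw f).
Proof. by rewrite summ_ge0//; exact: sqw_ge0. Qed.

Lemma normsqE f : ell2 w f -> normsq w f = (rsum (sqw f))%:E.
Proof.
move=> /ell2E sf; have f0 := sqw_ge0 f.
by rewrite rsum_ge0E// -(esum_fin f0 sf).
Qed.

Lemma normc2D_le (z z' : R[i]) :
  normc (z + z') ^+ 2 <= 2 * normc z ^+ 2 + 2 * normc z' ^+ 2.
Proof.
rewrite !normc2E; case: z z' => a b [c d] /=.
by have := sqr_ge0 (a - c); have := sqr_ge0 (b - d); nra.
Qed.

Lemma ell2D f g : ell2 w f -> ell2 w g -> ell2 w (f + g).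
Proof.
move=> /ell2E sf /ell2E sg; apply/ell2E.
apply: (@summ_le _ _ _ (fun y => 2 * sqw f y + 2 * sqw g y)).
  move=> y; rewrite ger0_norm ?sqw_ge0//.
  rewrite [leRHS](_ : _ = (2 * normc (f y) ^+ 2 + 2 * normc (g y) ^+ 2) * w y).
    by apply: ler_wpM2r => //; exact: (normc2D_le (f y) (g y)).
  rewrite /sqw; ring.
by apply: summD; exact: summZ.
Qed.

Lemma ell2Z (a : R[i]) f : ell2 w f -> ell2 w (fun y => a * f y).
Proof.
move=> /ell2E sf; apply/ell2E.
rewrite (_ : sqw _ = fun y => normc a ^+ 2 * sqw f y); first exact: summZ.
by apply/funext => y; rewrite /sqw Normc.normcM exprMn -mulrA.
Qed.

Lemma ell2N f : ell2 w f -> ell2 w (- f).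
Proof.
move=> /(ell2Z (-1)); congr ell2; apply/funext => y.
by rewrite mulN1r.
Qed.

Lemma ell2B f g : ell2 w f -> ell2 w g -> ell2 w (f - g).
Proof. by move=> hf hg; apply: ell2D => //; exact: ell2N. Qed.

Lemma ell2_0 : ell2 w (fun=> 0).
Proof.
apply/ell2E; rewrite (_ : sqw _ = fun=> 0).
  by rewrite /summ; under eq_esum do rewrite normr0; rewrite esum1// ltry.
by apply/funext => y; rewrite /sqw Normc.normc0 expr0n mul0r.
Qed.

Definition iterm f g (y : Y) : R[i] := f y * (g y)^*%C * (w y)%:C%C.

Lemma iterm_bound f g y :
  `|Re (iterm f g y)| <= sqw f y + sqw g y /\
  `|Im (iterm f g y)| <= sqw f y + sqw g y.
Proof.
rewrite /iterm /sqw !normc2E; case: (f y) (g y) => a b [c d] /=.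
rewrite !mulr0 subr0 add0r !normrM !(ger0_norm (w0 y)) -!mulrDl.
split; apply: ler_wpM2r => //.
  have := sqr_ge0 (a - c); have := sqr_ge0 (b - d); have := sqr_ge0 (a + c).
  by have := sqr_ge0 (b + d); rewrite ler_norml => *; apply/andP; split; nra.
have := sqr_ge0 (a - d); have := sqr_ge0 (b - c); have := sqr_ge0 (a + d).
by have := sqr_ge0 (b + c); rewrite ler_norml => *; apply/andP; split; nra.
Qed.

Lemma summ_iterm f g : ell2 w f -> ell2 w g ->
  summ (fun y => Re (iterm f g y)) /\ summ (fun y => Im (iterm f g y)).
Proof.
move=> /ell2E sf /ell2E sg; have sfg := summD sf sg.
by split; apply: summ_le sfg => y; have [] := iterm_bound f g y.
Qed.

Lemma innerDl f g h : ell2 w f -> ell2 w g -> ell2 w h ->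
  inner w (f + g) h = inner w f h + inner w g h.
Proof.
move=> hf hg hh; have [fr fi] := summ_iterm hf hh; have [gr gi] := summ_iterm hg hh.
rewrite /inner /csum -/(iterm f h) -/(iterm g h).
have E y : (f + g) y * (h y)^*%C * (w y)%:C%C = iterm f h y + iterm g h y.
  by rewrite /iterm -!mulrDl.
rewrite (_ : (fun y => Re _) = fun y => Re (iterm f h y) + Re (iterm g h y)).
  rewrite (_ : (fun y => Im _) = fun y => Im (iterm f h y) + Im (iterm g h y)).
    by rewrite !rsumD.
  by apply/funext => y; rewrite E raddfD.
by apply/funext => y; rewrite E raddfD.
Qed.

Lemma innerZl (a : R[i]) f h : ell2 w f -> ell2 w h ->
  inner w (fun y => a * f y) h = a * inner w f h.
Proof.
move=> hf hh; have [fr fi] := summ_iterm hf hh.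
rewrite /inner /csum -/(iterm f h).
have E y : a * f y * (h y)^*%C * (w y)%:C%C = a * iterm f h y.
  by rewrite /iterm !mulrA.
have rZ (c d : R) u v : summ u -> summ v ->
    rsum (fun y => c * u y + d * v y) = c * rsum u + d * rsum v.
  by move=> su sv; rewrite rsumD ?rsumZ//; exact: summZ.
case: a E => p q E.
rewrite (_ : (fun y => Re _) = fun y => p * Re (iterm f h y) + (- q) * Im (iterm f h y)).
  rewrite (_ : (fun y => Im _) = fun y => p * Im (iterm f h y) + q * Re (iterm f h y)).
    by rewrite !rZ//; simpc; congr (_ +i* _)%C; rewrite ?mulNr.
  by apply/funext => y; rewrite E; case: (iterm f h y) => r s /=; ring.
by apply/funext => y; rewrite E; case: (iterm f h y) => r s /=; ring.
Qed.

Lemma innerC f g : inner w g f = (inner w f g)^*%C.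
Proof.
rewrite /inner /csum /=; congr (_ +i* _)%C; last rewrite -rsumN; congr rsum;
  by apply/funext => y; case: (f y) (g y) => a b [c d] /=; ring.
Qed.

Lemma Re_inner f : Re (inner w f f) = rsum (sqw f).
Proof.
rewrite /inner /csum /=; congr rsum; apply/funext => y.
by rewrite /sqw normc2E; case: (f y) => a b /=; ring.
Qed.

Lemma sqw_le_rsum f y : ell2 w f -> sqw f y <= rsum (sqw f).
Proof.
move=> hf; rewrite -lee_fin -normsqE//.
have := @sum_le_esum R Y (sqw f) [:: y] isT; rewrite big_seq1; exact.
Qed.

(** Stated with real sequences, so that no topology on [R[i]] is involved. *)
Definition pointwise (u : nat -> Y -> R[i]) f :=
  forall y, (fun n => normc (u n y - f y)) @ \oo --> (0 : R).

Lemma normc_sqr_cvg (z : nat -> R[i]) (c : R[i]) :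
  (fun n => normc (z n - c)) @ \oo --> (0 : R) ->
  (fun n => normc (z n) ^+ 2) @ \oo --> normc c ^+ 2.
Proof.
move=> zc; have h : (fun n => normc (z n)) @ \oo --> normc c.
  apply/cvgrPdist_le => e e0; have /cvgr0Pnorm_le/(_ e e0) := zc.
  apply: filterS => n; rewrite ger0_norm ?normc_ge0// => ze.
  have h1 : normc c <= normc (z n) + normc (z n - c).
    by rewrite -(normcN (z n - c)) opprB -{1}(subrK (z n) c) addrC; exact: le_normcD.
  have h2 : normc (z n) <= normc c + normc (z n - c).
    by rewrite -{1}(subrK c (z n)) addrC; exact: le_normcD.
  by rewrite ler_norml; apply/andP; split; lra.
by rewrite expr2; under eq_fun do rewrite expr2; apply: cvgM.
Qed.

(** Fatou's lemma for the weighted squares. *)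
Lemma normsq_limit_le u f (c : R) N : pointwise u f ->
  (forall n, (N <= n)%N -> (normsq w (u n) <= c%:E)%E) -> (normsq w f <= c%:E)%E.
Proof.
move=> uf uc; apply: (@esum_limit_le R Y (fun n => sqw (u n)) (sqw f) c N) => //.
by move=> y; apply: cvgMr_tmp; exact: normc_sqr_cvg.
Qed.

Lemma normsq_cvg0P (u : nat -> Y -> R[i]) :
  (normsq w (u n) @[n --> \oo] --> 0)%E <->
  forall e : R, 0 < e -> exists N, forall n, (N <= n)%N -> (normsq w (u n) <= e%:E)%E.
Proof.
have n0 n : (0 <= normsq w (u n))%E.
  by apply: esum_ge0 => y _; rewrite lee_fin; exact: sqw_ge0.
split=> [/fine_cvgP[[N _ hN] /cvgr0Pnorm_le h] e e0|h].
  have [M _ hM] := h e e0; exists (maxn N M) => n; rewrite geq_max => /andP[/hN/= hn /hM/=].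
  by rewrite ger0_norm ?fine_ge0// -lee_fin fineK.
apply/fine_cvgP; split.
  have [N hN] := h 1 ltr01; exists N => // n /hN hn.
  by rewrite /= ge0_fin_numE// (le_lt_trans hn) ?ltry.
apply/cvgr0Pnorm_le => e /h[N hN]; exists N => // n /hN hn /=.
rewrite ger0_norm ?fine_ge0// -lee_fin fineK//.
by rewrite ge0_fin_numE// (le_lt_trans hn) ?ltry.
Qed.

End WeightedL2.

Section L2Space.
Variables (R : realType) (Y : choiceType) (w : Y -> R).
Hypothesis wp : forall y, 0 < w y.
Let w0 y : 0 <= w y. Proof. exact: ltW. Qed.
Local Notation normc := Normc.normc.

Lemma real_cauchy_cvg (u : nat -> R) :
  (forall e, 0 < e -> exists N, forall n k, (N <= n)%N -> (N <= k)%N ->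
     `|u n - u k| < e) -> exists l : R, u @ \oo --> l.
Proof.
move=> h; exists (limn u); apply/cauchy_cvgP/cauchy_ballP => e e0.
have [N hN] := h e e0; exists (u @` [set n | (N <= n)%N], u @` [set n | (N <= n)%N]) => /=.
  by split; exists N => // n Nn; exists n.
by move=> [_ _] [/= [n Nn <-] [k Nk <-]]; exact: hN.
Qed.

Lemma normsq_pointwise (u : nat -> Y -> R[i]) (f : Y -> R[i]) :
  (forall e : R, 0 < e -> exists N, forall n, (N <= n)%N ->
     (normsq w (u n - f)%R <= e%:E)%E) -> pointwise u f.
Proof.
move=> h y; apply/cvgr0Pnorm_le => e e0.
have [N hN] := h (e ^+ 2 * w y) (mulr_gt0 (exprn_gt0 2 e0) (wp y)).
exists N => // n /hN /= hn; rewrite ger0_norm ?normc_ge0//.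
rewrite -(@ler_pXn2r _ 2) ?nnegrE ?normc_ge0 ?(ltW e0)//.
rewrite -(ler_pM2r (wp y)) -lee_fin; apply: le_trans hn.
have := @sum_le_esum R Y (sqw w (u n - f)) [:: y] isT; rewrite big_seq1; exact.
Qed.

(** A Cauchy sequence converges pointwise because every weight is positive, and
    Fatou's lemma shows that the pointwise limit is the limit in norm. *)
Lemma ell2_complete (u : nat -> Y -> R[i]) : (forall n, ell2 w (u n)) ->
  (forall e : R, 0 < e -> exists N, forall n k, (N <= n)%N -> (N <= k)%N ->
     (normsq w (u n - u k)%R <= e%:E)%E) ->
  exists2 f, ell2 w f & forall e : R, 0 < e -> exists N, forall n, (N <= n)%N ->
     (normsq w (u n - f)%R <= e%:E)%E.
Proof.
move=> hu uC.
have pC y e : 0 < e -> exists N, forall n k, (N <= n)%N -> (N <= k)%N ->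
    normc (u n y - u k y) < e.
  move=> e0; have e2 : 0 < e ^+ 2 * w y / 2 by rewrite divr_gt0// mulr_gt0// exprn_gt0.
  have [N hN] := uC _ e2; exists N => n k Nn Nk.
  rewrite -(@ltr_pXn2r _ 2) ?nnegrE ?normc_ge0 ?(ltW e0)//.
  rewrite -(ltr_pM2r (wp y)); apply: le_lt_trans (_ : e ^+ 2 * w y / 2 < _); last by lra.
  rewrite -lee_fin; apply: le_trans (hN n k Nn Nk).
  have := @sum_le_esum R Y (sqw w (u n - u k)) [:: y] isT; rewrite big_seq1; exact.
have part (p : R[i] -> R) (y : Y) : (forall z z', `|p z - p z'| <= normc (z - z')) ->
    exists l : R, (fun n => p (u n y)) @ \oo --> l.
  move=> hp; apply: real_cauchy_cvg => e /(pC y)[N hN]; exists N => n k Nn Nk.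
  exact: le_lt_trans (hp _ _) (hN n k Nn Nk).
have nle (z : R[i]) (t : R) : t ^+ 2 <= normc z ^+ 2 -> `|t| <= normc z.
  by move=> h; rewrite -(@ler_pXn2r _ 2) ?nnegrE ?normc_ge0// real_normK ?num_real.
have [fr hfr] := choice (fun y => @part (fun z => Re z) y (fun z z' =>
   ltac:(rewrite -raddfB/=; apply: nle; rewrite normc2E lerDl sqr_ge0//))).
have [fi hfi] := choice (fun y => @part (fun z => Im z) y (fun z z' =>
   ltac:(rewrite -raddfB/=; apply: nle; rewrite normc2E lerDr sqr_ge0//))).
pose f y := (fr y +i* fi y)%C.
have sq0 (a : nat -> R) (l : R) : a @ \oo --> l ->
    (fun n => (a n - l) ^+ 2) @ \oo --> (0 : R).
  move=> /subr_cvg0 h.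
  have -> : (fun n => (a n - l) ^+ 2) = fun n => (a n - l) * (a n - l).
    by apply/funext => n; rewrite expr2.
  by rewrite -[X in _ --> X](mulr0 (0 : R)); exact: cvgM.
have uf : pointwise u f.
  move=> y; apply: (@sqr_cvg0 _ _ (fun n => (Re (u n y) - fr y) ^+ 2 + (Im (u n y) - fi y) ^+ 2) 1).
    move=> n; rewrite mul1r normc2E /f; case: (u n y) => a b //=.
  by rewrite -[X in _ --> X](addr0 (0 : R)); apply: cvgD; apply: sq0.
have lim e : 0 < e -> exists N, forall n, (N <= n)%N -> (normsq w (u n - f)%R <= e%:E)%E.
  move=> /uC[N hN]; exists N => n Nn.
  apply: (@normsq_limit_le R Y w (fun k => u n - u k) (u n - f) e N) => // [y|k Nk].
    have := uf y; rewrite /pointwise (_ : (fun k => _) = fun k => normc (u k y - f y))//.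
    by apply/funext => k; rewrite !fctE -(normcN (u k y - f y)); congr normc; ring.
  exact: hN.
exists f => //; have [N /(_ N (leqnn N)) hN] := lim 1 ltr01.
rewrite (_ : f = u N - (u N - f)); last by rewrite opprB addrC subrK.
by apply: ell2B => //; rewrite /ell2 (le_lt_trans hN)// ltry.
Qed.

End L2Space.

(** * The Hilbert space of square summable functions *)

Section EllTwoType.
Variables (R : realType) (X : choiceType) (m : X -> R).
Hypothesis mp : forall x, 0 < m x.
Let m0 x : 0 <= m x. Proof. exact: ltW. Qed.

(** Carrying the proof [mp] in the type allows attaching to it the vector space
    structure, whose operations rest on the positivity of the weights. *)
Record ell2_space (_mp : forall x, 0 < m x) := Ell2 {
  ell2_fun :> X -> R[i];
  ell2_funP : ell2 m ell2_fun }.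

Local Notation V := (ell2_space mp).

Lemma ell2_space_eq (f g : V) : ell2_fun f = ell2_fun g -> f = g.
Proof.
case: f g => f hf [g hg] /= fg; subst g; congr Ell2; exact: Prop_irrelevance.
Qed.

HB.instance Definition _ := gen_eqMixin V.
HB.instance Definition _ := gen_choiceMixin V.

Definition ell2_add (f g : V) : V := Ell2 mp (ell2D m0 (ell2_funP f) (ell2_funP g)).
Definition ell2_opp (f : V) : V := Ell2 mp (ell2N m0 (ell2_funP f)).
Definition ell2_zero : V := Ell2 mp (ell2_0 m0).
Definition ell2_scale (a : R[i]) (f : V) : V := Ell2 mp (ell2Z m0 a (ell2_funP f)).

Lemma ell2_addA : associative ell2_add.
Proof. by move=> f g h; apply: ell2_space_eq; exact: addrA. Qed.

Lemma ell2_addC : commutative ell2_add.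
Proof. by move=> f g; apply: ell2_space_eq; exact: addrC. Qed.

Lemma ell2_add0 : left_id ell2_zero ell2_add.
Proof. by move=> f; apply: ell2_space_eq; exact: add0r. Qed.

Lemma ell2_addN : left_inverse ell2_zero ell2_opp ell2_add.
Proof. by move=> f; apply: ell2_space_eq; exact: addNr. Qed.

HB.instance Definition _ :=
  GRing.isZmodule.Build V ell2_addA ell2_addC ell2_add0 ell2_addN.

Lemma ell2_scaleA a b (f : V) : ell2_scale a (ell2_scale b f) = ell2_scale (a * b) f.
Proof. by apply: ell2_space_eq; apply/funext => x; exact: mulrA. Qed.

Lemma ell2_scale1 : left_id 1 ell2_scale.
Proof. by move=> f; apply: ell2_space_eq; apply/funext => x; exact: mul1r. Qed.

Lemma ell2_scaleDr : right_distributive ell2_scale +%R.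
Proof. by move=> a f g; apply: ell2_space_eq; apply/funext => x; exact: mulrDr. Qed.

Lemma ell2_scaleDl (f : V) : {morph ell2_scale^~ f : a b / a + b}.
Proof. by move=> a b; apply: ell2_space_eq; apply/funext => x; exact: mulrDl. Qed.

HB.instance Definition _ := GRing.Zmodule_isLmodule.Build R[i] V
  ell2_scaleA ell2_scale1 ell2_scaleDr ell2_scaleDl.

Definition ell2_ip (f g : V) : R[i] := inner m f g.

Lemma ell2_nsqE (f : V) : normsq m f = (nsq ell2_ip f)%:E.
Proof. by rewrite /nsq /rip /ell2_ip (Re_inner m) normsqE//; exact: ell2_funP. Qed.

Lemma ell2_hilbert : hilbert_space ell2_ip.
Proof.
have n0 (g : V) : 0 <= Re (ell2_ip g g).
  by rewrite /ell2_ip Re_inner rsum_ge0// => x; exact: sqw_ge0.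
split.
- by move=> f g h; apply: innerDl => //; exact: ell2_funP.
- by move=> a f g; apply: innerZl => //; exact: ell2_funP.
- by move=> f g; exact: innerC.
- exact: n0.
- move=> f f0; apply: ell2_space_eq; apply/funext => x.
  have := sqw_le_rsum m0 x (ell2_funP f); rewrite -Re_inner f0 /sqw.
  rewrite pmulr_lle0//; have := sqr_ge0 (Normc.normc (ell2_fun f x)) => h1 h2.
  have /eqP : Normc.normc (ell2_fun f x) ^+ 2 = 0 by apply/eqP; rewrite eq_le h1 h2.
  by rewrite sqrf_eq0 => /eqP/Normc.eq0_normc.
- move=> u uC; have [||f hf uf] := @ell2_complete R X m mp (fun n => ell2_fun (u n)).
  + by move=> n; exact: ell2_funP.
  + move=> e /uC[N hN]; exists N => n k Nn Nk.
    have -> : (ell2_fun (u n) - ell2_fun (u k)) = ell2_fun (u n - u k) by [].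
    by rewrite ell2_nsqE lee_fin ltW//; exact: hN.
  exists (Ell2 mp hf); apply/cvgr0Pnorm_le => e /uf[N hN]; exists N => // n /hN.
  have -> : (ell2_fun (u n) - f) = ell2_fun (u n - Ell2 mp hf) by [].
  by rewrite ell2_nsqE lee_fin => h; rewrite (ger0_norm (n0 _)).
Qed.

End EllTwoType.

(** * The real inner product of a weight *)

Section SemiInner.
Variables (R : realType) (Y : choiceType) (w : Y -> R).
Hypothesis w0 : forall y, 0 <= w y.
Implicit Types (f g h : Y -> R[i]) (u : nat -> Y -> R[i]).

(** The real value of [normsq]; it serves the measure on the vertices, the weight
    of the edges and both parts of the potential. *)
Definition nq f : R := rsum (sqw w f).
Definition rinner f g : R := Re (inner w f g).

Lemma nq_ge0 f : 0 <= nq f.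
Proof. by apply: rsum_ge0 => y; exact: sqw_ge0. Qed.

Lemma nqE f : nq f = rinner f f.
Proof. by rewrite /rinner Re_inner. Qed.

Lemma rinnerC f g : rinner f g = rinner g f.
Proof. by rewrite /rinner innerC; case: (inner w g f). Qed.

Lemma rinnerDl f g h : ell2 w f -> ell2 w g -> ell2 w h ->
  rinner (f + g) h = rinner f h + rinner g h.
Proof. by move=> hf hg hh; rewrite /rinner innerDl// raddfD. Qed.

Lemma rinnerZl (t : R) f h : ell2 w f -> ell2 w h ->
  rinner (fun y => t%:C%C * f y) h = t * rinner f h.
Proof.
by move=> hf hh; rewrite /rinner innerZl//; case: (inner w f h) => a b /=; ring.
Qed.

Lemma innerNl f h : ell2 w f -> ell2 w h -> inner w (- f) h = - inner w f h.
Proof.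
move=> hf hh; have := innerZl w0 (-1) hf hh; rewrite mulN1r => <-.
suff -> : - f = fun y => -1 * f y by [].
by apply/funext => y; rewrite mulN1r.
Qed.

Lemma rinnerNl f h : ell2 w f -> ell2 w h -> rinner (- f) h = - rinner f h.
Proof. by move=> hf hh; rewrite /rinner innerNl// raddfN. Qed.

Lemma rinnerBl f g h : ell2 w f -> ell2 w g -> ell2 w h ->
  rinner (f - g) h = rinner f h - rinner g h.
Proof.
move=> hf hg hh; rewrite rinnerDl//; last exact: ell2N.
by rewrite rinnerNl.
Qed.

Lemma nqD f g : ell2 w f -> ell2 w g -> nq (f + g) = nq f + 2 * rinner f g + nq g.
Proof.
move=> hf hg; have hfg := ell2D w0 hf hg.
rewrite !nqE rinnerDl// (rinnerC f) (rinnerC g (f + g)) !rinnerDl// (rinnerC g f).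
ring.
Qed.

Lemma nqZ (a : R[i]) f : ell2 w f -> nq (fun y => a * f y) = Normc.normc a ^+ 2 * nq f.
Proof.
move=> /(ell2E w0) hf; rewrite /nq -rsumZ//; congr rsum; apply/funext => y.
by rewrite /sqw Normc.normcM exprMn -mulrA.
Qed.

Lemma nqN f : ell2 w f -> nq (- f) = nq f.
Proof.
move=> hf; rewrite -[in RHS](mul1r (nq f)) -(expr1n _ 2) -(Normc.normc1 R) -(normcN 1).
rewrite -nqZ//; suff -> : - f = fun y => -1 * f y by [].
by apply/funext => y; rewrite mulN1r.
Qed.

Lemma rinner_cauchy_schwarz f g : ell2 w f -> ell2 w g ->
  rinner f g ^+ 2 <= nq f * nq g.
Proof.
move=> hf hg; apply: discriminant => [|t]; first exact: nq_ge0.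
have htg : ell2 w (fun y => t%:C%C * g y) by exact: ell2Z.
have := nq_ge0 (f + (fun y => t%:C%C * g y)).
rewrite nqD// (rinnerC f) rinnerZl// (rinnerC g) nqZ// normc2E /= expr0n addr0.
by congr (_ <= _); ring.
Qed.

Lemma nqD_le f g : ell2 w f -> ell2 w g -> nq (f + g) <= 2 * nq f + 2 * nq g.
Proof.
move=> hf hg; have := nq_ge0 (f - g).
have hng : ell2 w (- g) by exact: ell2N.
have -> : nq (f - g) = nq f - 2 * rinner f g + nq g.
  by rewrite nqD// nqN// (rinnerC f (- g)) rinnerNl// (rinnerC g f); ring.
by rewrite nqD//; lra.
Qed.

Lemma rinner_cvg u f h : (forall n, ell2 w (u n)) -> ell2 w f -> ell2 w h ->
  (fun n => nq (u n - f)) @ \oo --> (0 : R) ->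
  (fun n => rinner (u n) h) @ \oo --> rinner f h.
Proof.
move=> hu hf hh uf; apply/subr_cvg0/(@sqr_cvg0 _ _ _ (nq h)); last exact: uf.
move=> n; rewrite -rinnerBl// mulrC; apply: rinner_cauchy_schwarz => //.
exact: ell2B.
Qed.

Lemma nq_cvg u f : (forall n, ell2 w (u n)) -> ell2 w f ->
  (fun n => nq (u n - f)) @ \oo --> (0 : R) ->
  (fun n => nq (u n)) @ \oo --> nq f.
Proof.
move=> hu hf uf.
have -> : (fun n => nq (u n)) = fun n => nq (u n - f) + 2 * rinner (u n) f - nq f.
  apply/funext => n; have huf := ell2B w0 (hu n) hf.
  have -> : nq (u n) = nq ((u n - f) + f) by rewrite subrK.
  by rewrite nqD// rinnerBl// -nqE; ring.
have {2}-> : nq f = 0 + 2 * rinner f f - nq f by rewrite -nqE; ring.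
by apply: cvgB; [apply: cvgD; [exact: uf|apply: cvgMl_tmp; exact: rinner_cvg]|exact: cvg_cst].
Qed.

Lemma ell2_seq f (r : seq Y) : (forall y, y \notin r -> f y = 0) -> ell2 w f.
Proof.
move=> fr; apply/(ell2E w0).
have [|//] := @summ_rsum_seq _ _ (sqw w f) (undup r) (undup_uniq r) _.
by move=> y; rewrite mem_undup => /fr fy; rewrite /sqw fy Normc.normc0 expr0n mul0r.
Qed.

End SemiInner.

(** * Sums over edges and finitely supported functions *)

Section PairSums.
Variables (R : realType) (X : choiceType) (b : X -> X -> R).
Hypotheses (b0 : forall x y, 0 <= b x y) (bsym : forall x y, b x y = b y x)
  (bsum : forall x, summ (b x)).

Definition wdeg x : R := rsum (b x).

Lemma wdegE x : wdeg x = fine (\esum_(y in [set: X]) (b x y)%:E)%E.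
Proof. exact: rsum_ge0E. Qed.

Lemma wdeg_ge0 x : 0 <= wdeg x.
Proof. exact: rsum_ge0. Qed.

(** The only infinite sum over edges that has to be evaluated: the edges leaving
    one vertex. Functions with finite support follow by linearity. *)
Lemma rsum_row x0 :
  summ (fun p : X * X => b p.1 p.2 * (p.1 == x0)%:R) /\
  rsum (fun p : X * X => b p.1 p.2 * (p.1 == x0)%:R) = wdeg x0.
Proof.
set u := fun p : X * X => _.
have u0 p : 0 <= u p by rewrite /u mulr_ge0// ler0n.
have uE : (\esum_(p in [set: X * X]) (u p)%:E)%E = (wdeg x0)%:E.
  transitivity (\esum_(x in [set: X]) \esum_(y in [set: X]) (u (x, y))%:E)%E.
    rewrite esum_esum; last by move=> x y; rewrite lee_fin.
    rewrite (_ : setT `*`` _ = setT); last by apply/seteqP; split.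
    by apply: eq_esum => -[x y].
  transitivity (\esum_(x in [set: X]) (if x \in [set x0] then (wdeg x0)%:E else 0))%E.
    apply: eq_esum => x _; rewrite /u /=.
    have [->|/eqP xx0] := eqVneq x x0.
      rewrite mem_set// wdegE -(esum_fin (b0 x0) (bsum x0)).
      by apply: eq_esum => y _; rewrite mulr1.
    by rewrite memNset// esum1// => y _; rewrite mulr0.
  by rewrite -esum_mkcond esum_set1// lee_fin wdeg_ge0.
split; first by apply/summ_ge0 => //; rewrite uE ltry.
by rewrite rsum_ge0E// uE.
Qed.

Lemma rsum_pair1 (g : X -> R) (r : seq X) : uniq r -> (forall x, x \notin r -> g x = 0) ->
  summ (fun p : X * X => b p.1 p.2 * g p.1) /\
  rsum (fun p : X * X => b p.1 p.2 * g p.1) = \sum_(x <- r) wdeg x * g x.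
Proof.
elim: r g => [|x0 r IH] g.
  move=> _ g0; have -> : (fun p : X * X => b p.1 p.2 * g p.1) = fun=> 0.
    by apply/funext => p; rewrite g0// mulr0.
  have [//|//|s0 r0] := @summ_rsum_seq R (X * X)%type (fun=> 0) [::].
  by split=> //; rewrite r0 !big_nil.
move=> /= /andP[x0r ur] g0; pose g' y := if y == x0 then 0 else g y.
have [s1 r1] := rsum_row x0.
have [s2 r2] : summ (fun p : X * X => b p.1 p.2 * g' p.1) /\
    rsum (fun p : X * X => b p.1 p.2 * g' p.1) = \sum_(x <- r) wdeg x * g' x.
  apply: IH => // y yr; rewrite /g'; case: eqVneq => // yx0; apply: g0.
  by rewrite inE negb_or yx0.
have E : (fun p : X * X => b p.1 p.2 * g p.1) =
    fun p => g x0 * (b p.1 p.2 * (p.1 == x0)%:R) + b p.1 p.2 * g' p.1.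
  apply/funext => -[x y] /=; rewrite /g'; case: eqVneq => [->|_].
    by rewrite mulr1 mulr0 addr0 mulrC.
  by rewrite !mulr0 add0r.
have s3 := summZ (g x0) s1.
rewrite E; split; first exact: summD.
rewrite rsumD// rsumZ// r1 r2 big_cons mulrC; congr (_ + _).
rewrite !big_seq; apply: eq_bigr => y yr; rewrite /g' ifF//; apply/eqP => yx0.
by move: x0r; rewrite -yx0 yr.
Qed.

Lemma esum_swap (u : X * X -> R) : (forall p, 0 <= u p) ->
  (\esum_(p in [set: X * X]) (u (p.2, p.1))%:E = \esum_(p in [set: X * X]) (u p)%:E)%E.
Proof.
move=> u0; rewrite (@reindex_esum R _ _ setT setT (fun p : X * X => (p.2, p.1)) (fun p => (u p)%:E))//.
split=> // [[x y] [x' y'] _ _ [-> ->]//|[x y] _].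
by exists (y, x).
Qed.

Lemma rsum_pair2 (g : X -> R) (r : seq X) : (forall x, 0 <= g x) ->
  uniq r -> (forall x, x \notin r -> g x = 0) ->
  summ (fun p : X * X => b p.1 p.2 * g p.2) /\
  rsum (fun p : X * X => b p.1 p.2 * g p.2) = \sum_(x <- r) wdeg x * g x.
Proof.
move=> g0 ur gr; have [s1 r1] := rsum_pair1 ur gr.
pose u (p : X * X) := b p.1 p.2 * g p.1.
have u0 p : 0 <= u p by rewrite mulr_ge0.
have v0 (p : X * X) : 0 <= b p.1 p.2 * g p.2 by rewrite mulr_ge0.
have E : (\esum_(p in [set: X * X]) (b p.1 p.2 * g p.2)%:E)%E =
    (\esum_(p in [set: X * X]) (u p)%:E)%E.
  by rewrite -(esum_swap u0); apply: eq_esum => -[x y] _; rewrite /u/= bsym.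
split; first by apply/(summ_ge0 v0); rewrite E; apply/(summ_ge0 u0).
by rewrite -r1 (rsum_ge0E v0) (rsum_ge0E u0) E.
Qed.

(** Only edges that meet the finite support contribute, and each vertex carries
    finite total edge weight. *)
Lemma summ_pair (phi : X * X -> R) (g : X -> R) (r : seq X) :
  (forall x, 0 <= g x) -> (forall x, x \notin r -> g x = 0) ->
  (forall p, `|phi p| <= g p.1 + g p.2) -> summ (fun p => b p.1 p.2 * phi p).
Proof.
move=> g0 gr pg; have gr' x : x \notin undup r -> g x = 0.
  by rewrite mem_undup; exact: gr.
have [s1 _] := rsum_pair1 (undup_uniq r) gr'.
have [s2 _] := rsum_pair2 g0 (undup_uniq r) gr'.
apply: summ_le (summD s1 s2) => p.
by rewrite -mulrDr normrM (ger0_norm (b0 _ _)) ler_wpM2l.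
Qed.

End PairSums.

Lemma fsbig_sum_seq (R : realType) (X : choiceType) (u : X -> R) (r : seq X) :
  uniq r -> (forall x, x \notin r -> u x = 0) ->
  \sum_(x \in [set: X]) u x = \sum_(x <- r) u x.
Proof.
move=> ur u0; rewrite (fsbig_seq _ u ur); apply/esym/fsbig_widen => //.
by move=> x [_ /= /negP xr]; exact: u0.
Qed.

Lemma Cc_seq (R : realType) (X : choiceType) (f : X -> R[i]) : Cc f ->
  exists2 r : seq X, uniq r & forall x, x \notin r -> f x = 0.
Proof.
move=> ff; exists (finmap.enum_fset (fset_set [set x | f x != 0])).
  exact: finmap.fset_uniq.
move=> x xr; apply/eqP; apply: contraNT xr => fx.
by rewrite in_fset_set// mem_set.
Qed.

Lemma seq_Cc (R : realType) (X : choiceType) (f : X -> R[i]) (r : seq X) :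
  (forall x, x \notin r -> f x = 0) -> Cc f.
Proof.
move=> fr; apply: (@sub_finite_set _ _ [set` r]); last exact: finite_seq.
by move=> x /= fx; apply: contraNT fx => /fr ->.
Qed.

Section CcSpace.
Variables (R : realType) (X : choiceType).
Implicit Types f g : X -> R[i].

Lemma CcD f g : Cc f -> Cc g -> Cc (f + g).
Proof.
move=> /Cc_seq[r _ fr] /Cc_seq[r' _ gr]; apply: (@seq_Cc _ _ _ (r ++ r')) => x.
by rewrite mem_cat negb_or => /andP[/fr fx /gr gx]; rewrite !fctE fx gx addr0.
Qed.

Lemma CcZ (a : R[i]) f : Cc f -> Cc (fun x => a * f x).
Proof. by move=> /Cc_seq[r _ fr]; apply: (@seq_Cc _ _ _ r) => x /fr ->; rewrite mulr0. Qed.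

Lemma CcN f : Cc f -> Cc (- f).
Proof. by move=> /Cc_seq[r _ fr]; apply: (@seq_Cc _ _ _ r) => x /fr fx; rewrite !fctE fx oppr0. Qed.

Lemma CcB f g : Cc f -> Cc g -> Cc (f - g).
Proof. by move=> hf hg; apply: CcD => //; exact: CcN. Qed.

End CcSpace.

(** * The magnetic form on functions of finite energy *)

Lemma normc_expi (R : realType) (t : R) : Normc.normc (expi t) = 1.
Proof. by rewrite /= cos2Dsin2 sqrtr1. Qed.

Section FormDefinitions.
Variables (R : realType) (X : choiceType).
Variables (b theta : X -> X -> R) (q m : X -> R).
Hypothesis hG : magnetic_graph b theta m.
Implicit Types (f g h : X -> R[i]) (u : nat -> X -> R[i]).
Local Notation normc := Normc.normc.

Lemma graph_b0 x y : 0 <= b x y. Proof. by case: hG. Qed.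

Lemma graph_bsym x y : b x y = b y x. Proof. by case: hG. Qed.

Lemma graph_bsum x : summ (b x).
Proof. by apply/(summ_ge0 (graph_b0 x)); case: hG. Qed.

Lemma graph_m_gt0 x : 0 < m x. Proof. by case: hG => _ _ _ _ []. Qed.

Definition edge_diff f (p : X * X) : R[i] := f p.1 - expi (theta p.1 p.2) * f p.2.
Definition edge_weight (p : X * X) : R := 2^-1 * b p.1 p.2.
Definition pot_pos (x : X) : R := q^\+ x * m x.
Definition pot_neg (x : X) : R := q^\- x * m x.

Lemma m_ge0 x : 0 <= m x. Proof. exact/ltW/graph_m_gt0. Qed.

Lemma edge_weight_ge0 p : 0 <= edge_weight p.
Proof. by rewrite mulr_ge0 ?invr_ge0// graph_b0. Qed.

Lemma pot_pos_ge0 x : 0 <= pot_pos x.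
Proof. by rewrite mulr_ge0 ?funrpos_ge0 ?m_ge0. Qed.

Lemma pot_neg_ge0 x : 0 <= pot_neg x.
Proof. by rewrite mulr_ge0 ?funrneg_ge0 ?m_ge0. Qed.

Local Notation w1 := edge_weight_ge0.
Local Notation w2 := pot_pos_ge0.
Local Notation w3 := pot_neg_ge0.
Local Notation w4 := m_ge0.

Lemma edge_diffD f g : edge_diff (f + g) = edge_diff f + edge_diff g.
Proof. by apply/funext => p; rewrite /edge_diff !fctE; ring. Qed.

Lemma edge_diffZ (a : R[i]) f : edge_diff (fun x => a * f x) = fun p => a * edge_diff f p.
Proof. by apply/funext => p; rewrite /edge_diff; ring. Qed.

Lemma edge_diffN f : edge_diff (- f) = - edge_diff f.
Proof. by apply/funext => p; rewrite /edge_diff !fctE; ring. Qed.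

Lemma edge_diffB f g : edge_diff (f - g) = edge_diff f - edge_diff g.
Proof. by rewrite edge_diffD edge_diffN. Qed.

(** The functions for which each term of the form converges. This space contains
    the domain of the closed form, and the form is sesquilinear on it. *)
Definition finite_energy f := [/\ ell2 m f, ell2 edge_weight (edge_diff f),
  ell2 pot_pos f & ell2 pot_neg f].

Lemma finite_energyD f g : finite_energy f -> finite_energy g -> finite_energy (f + g).
Proof.
move=> [a1 a2 a3 a4] [c1 c2 c3 c4]; split; rewrite ?edge_diffD.
- exact: (ell2D w4).
- exact: (ell2D w1).
- exact: (ell2D w2).
- exact: (ell2D w3).
Qed.

Lemma finite_energyZ (a : R[i]) f : finite_energy f -> finite_energy (fun x => a * f x).
Proof.
move=> [a1 a2 a3 a4]; split; rewrite ?edge_diffZ.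
- exact: (ell2Z w4).
- exact: (ell2Z w1).
- exact: (ell2Z w2).
- exact: (ell2Z w3).
Qed.

Lemma finite_energyN f : finite_energy f -> finite_energy (- f).
Proof.
move=> [a1 a2 a3 a4]; split; rewrite ?edge_diffN.
- exact: (ell2N w4).
- exact: (ell2N w1).
- exact: (ell2N w2).
- exact: (ell2N w3).
Qed.

Lemma finite_energyB f g : finite_energy f -> finite_energy g -> finite_energy (f - g).
Proof. by move=> hf hg; apply: finite_energyD => //; exact: finite_energyN. Qed.

Lemma Cc_finite_energy f : Cc f -> finite_energy f.
Proof.
move=> /Cc_seq[r _ fr]; split; [exact: (ell2_seq w4 fr)| |exact: (ell2_seq w2 fr)|
  exact: (ell2_seq w3 fr)].
apply/(ell2E w1).
have := @summ_pair R X b graph_b0 graph_bsym graph_bsum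
  (fun p => 2^-1 * normc (edge_diff f p) ^+ 2) (fun x => normc (f x) ^+ 2) r.
have -> : (fun p => b p.1 p.2 * (2^-1 * normc (edge_diff f p) ^+ 2)) =
    sqw edge_weight (edge_diff f).
  by apply/funext => p; rewrite /sqw /edge_weight mulrC -mulrA mulrCA mulrA.
apply=> [x|x /fr ->|p]; first exact: sqr_ge0.
  by rewrite Normc.normc0 expr0n.
rewrite ger0_norm; last by apply: mulr_ge0; [rewrite invr_ge0|exact: sqr_ge0].
have := normc2D_le (f p.1) (- (expi (theta p.1 p.2) * f p.2)).
rewrite normcN Normc.normcM normc_expi mul1r -/(edge_diff f p); lra.
Qed.

(** Each term is a weighted inner product, so sesquilinearity, Cauchy-Schwarz and
    continuity are those of weighted square summable functions. *)
Definition sform f g : R[i] :=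
  inner edge_weight (edge_diff f) (edge_diff g) + inner pot_pos f g - inner pot_neg f g.

Definition rform f g : R := Re (sform f g).

Lemma rformE f g : rform f g = rinner edge_weight (edge_diff f) (edge_diff g) +
  rinner pot_pos f g - rinner pot_neg f g.
Proof. by rewrite /rform /sform raddfB/= raddfD. Qed.

Lemma sformDl f g h : finite_energy f -> finite_energy g -> finite_energy h ->
  sform (f + g) h = sform f h + sform g h.
Proof.
move=> [_ a2 a3 a4] [_ c2 c3 c4] [_ d2 d3 d4].
rewrite /sform edge_diffD (innerDl w1)// (innerDl w2)// (innerDl w3)//; ring.
Qed.

Lemma sformZl (a : R[i]) f h : finite_energy f -> finite_energy h ->
  sform (fun x => a * f x) h = a * sform f h.
Proof.
move=> [_ a2 a3 a4] [_ d2 d3 d4].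
rewrite /sform edge_diffZ (innerZl w1)// (innerZl w2)// (innerZl w3)//; ring.
Qed.

Lemma sformC f g : sform g f = (sform f g)^*%C.
Proof.
by rewrite /sform [inner _ (edge_diff g) _]innerC [inner pot_pos g f]innerC
  [inner pot_neg g f]innerC !conjcD conjcN.
Qed.

Lemma rformC f g : rform f g = rform g f.
Proof. by rewrite /rform sformC; case: (sform g f). Qed.

Lemma rformDl f g h : finite_energy f -> finite_energy g -> finite_energy h ->
  rform (f + g) h = rform f h + rform g h.
Proof. by move=> hf hg hh; rewrite /rform sformDl// raddfD. Qed.

Lemma sformNl f h : finite_energy f -> finite_energy h -> sform (- f) h = - sform f h.
Proof.
move=> hf hh; have E : - f = (fun x => -1 * f x).
  by apply/funext => x; rewrite mulN1r.
by rewrite E sformZl// mulN1r.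
Qed.

Lemma rformNl f h : finite_energy f -> finite_energy h -> rform (- f) h = - rform f h.
Proof. by move=> hf hh; rewrite /rform sformNl// raddfN. Qed.

Lemma rform_sqrD f h : finite_energy f -> finite_energy h ->
  rform (f + h) (f + h) = rform f f + 2 * rform f h + rform h h.
Proof.
move=> hf hh; have hfh := finite_energyD hf hh.
rewrite rformDl// (rformC f (f + h)) (rformC h (f + h)) !rformDl// (rformC h f); ring.
Qed.

Lemma rform_sqrB f h : finite_energy f -> finite_energy h ->
  rform (f - h) (f - h) = rform f f - 2 * rform f h + rform h h.
Proof.
move=> hf hh; have hnh := finite_energyN hh; rewrite rform_sqrD//.
by rewrite (rformC f (- h)) !rformNl// (rformC h (- h)) rformNl// (rformC h f); ring.
Qed.

(** A squared graph norm in which every term of the form is continuous. *)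
Definition energy f : R :=
  nq m f + nq edge_weight (edge_diff f) + nq pot_pos f + nq pot_neg f.

Lemma energy_ge0 f : 0 <= energy f.
Proof.
have := nq_ge0 w4 f; have := nq_ge0 w1 (edge_diff f); have := nq_ge0 w2 f.
by have := nq_ge0 w3 f; rewrite /energy; lra.
Qed.

Lemma energyD_le f g : finite_energy f -> finite_energy g ->
  energy (f + g) <= 2 * energy f + 2 * energy g.
Proof.
move=> [a1 a2 a3 a4] [c1 c2 c3 c4]; rewrite /energy edge_diffD.
have := nqD_le w4 a1 c1; have := nqD_le w1 a2 c2; have := nqD_le w2 a3 c3.
have := nqD_le w3 a4 c4; lra.
Qed.

Lemma energyN f : finite_energy f -> energy (- f) = energy f.
Proof.
move=> [a1 a2 a3 a4]; rewrite /energy edge_diffN.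
by rewrite (nqN w1)// (nqN w2)// (nqN w3)// (nqN w4).
Qed.

Lemma energyZ (a : R[i]) f : finite_energy f ->
  energy (fun x => a * f x) = normc a ^+ 2 * energy f.
Proof.
move=> [a1 a2 a3 a4]; rewrite /energy edge_diffZ.
rewrite (nqZ w1)// (nqZ w2)// (nqZ w3)// (nqZ w4)//; ring.
Qed.

Lemma rform_energy_le f : `|rform f f| <= energy f.
Proof.
rewrite rformE -!nqE /energy.
have := nq_ge0 w4 f; have := nq_ge0 w1 (edge_diff f); have := nq_ge0 w2 f.
have := nq_ge0 w3 f => h1 h2 h3 h4; rewrite ler_norml; apply/andP; split; lra.
Qed.

Lemma energy_pieces f : [/\ nq m f <= energy f, nq edge_weight (edge_diff f) <= energy f,
  nq pot_pos f <= energy f & nq pot_neg f <= energy f].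
Proof.
have := nq_ge0 w4 f; have := nq_ge0 w1 (edge_diff f); have := nq_ge0 w2 f.
have := nq_ge0 w3 f => h1 h2 h3 h4; rewrite /energy; split; lra.
Qed.

Lemma Qform_Cc f : Cc f -> Qform b theta q m f = rform f f.
Proof.
move=> Cf; have [_ e2 _ _] := Cc_finite_energy Cf; have [r ur fr] := Cc_seq Cf.
rewrite /Qform rformE -!nqE -addrA; congr (_ + _).
  rewrite /nq (_ : sqw _ _ = fun p => 2^-1 *
     (b p.1 p.2 * normc (edge_diff f p) ^+ 2)); last first.
    by apply/funext => p; rewrite /sqw /edge_weight; field.
  rewrite rsumZ ?rsum_ge0E//.
    by move=> p; apply: mulr_ge0; [exact: graph_b0|exact: sqr_ge0].
  move/(ell2E w1): e2 => /(summZ 2); congr summ; apply/funext => p.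
  by rewrite /sqw /edge_weight; field.
have f0 x : x \notin r -> normc (f x) ^+ 2 = 0.
  by move=> /fr ->; rewrite Normc.normc0 expr0n.
rewrite (fsbig_sum_seq ur); last by move=> x /f0 ->; rewrite mulr0 mul0r.
rewrite /nq; have [|_ ->] := @summ_rsum_seq R X (sqw pot_pos f) r ur.
  by move=> x /f0 fx; rewrite /sqw fx mul0r.
have [|_ ->] := @summ_rsum_seq R X (sqw pot_neg f) r ur.
  by move=> x /f0 fx; rewrite /sqw fx mul0r.
rewrite -sumrB; apply: eq_bigr => x _; rewrite /sqw /pot_pos /pot_neg.
have -> : q x = q^\+ x - q^\- x.
  by rewrite /funrpos /funrneg; case: (leP (q x) 0) => h;
    [rewrite max_l|rewrite max_r]; lra.
ring.
Qed.

End FormDefinitions.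

(** * The closure of the magnetic form *)

Section FormClosure.
Variables (R : realType) (X : choiceType).
Variables (b theta : X -> X -> R) (q m : X -> R).
Hypothesis hG : magnetic_graph b theta m.
Implicit Types (f g h : X -> R[i]) (u : nat -> X -> R[i]).
Local Notation normc := Normc.normc.
Local Notation w1 := (edge_weight_ge0 hG).
Local Notation w2 := (pot_pos_ge0 q hG).
Local Notation w3 := (pot_neg_ge0 q hG).
Local Notation w4 := (m_ge0 hG).
Local Notation D := (edge_diff theta).
Local Notation bw := (edge_weight b).
Local Notation qp := (pot_pos q m).
Local Notation qn := (pot_neg q m).
Local Notation fe := (finite_energy b theta q m).
Local Notation energy := (energy b theta q m).
Local Notation rform := (rform b theta q m).
Local Notation sform := (sform b theta q m).
Local Notation Q := (Qform b theta q m).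

Lemma Kclass_nq alpha : Kclass b theta q m alpha -> exists2 C, 0 <= C &
  forall f, Cc f -> nq qn f <= alpha * (nq bw (D f) + nq qp f) + C * nq m f.
Proof.
move=> [C C0 hC]; exists C => // f Cf; have := hC f Cf.
have [e1 _ _ _] := Cc_finite_energy q hG Cf.
rewrite (normsqE w4 e1) (Qform_Cc _ hG Cf) rformE -!nqE.
have -> : nq (pot_pos q^\+ m) f = nq qp f.
  congr (nq _ f); apply/funext => x; rewrite /pot_pos /funrpos.
  by congr (_ * _); rewrite max_l// le_max lexx orbT.
have -> : nq (pot_neg q^\+ m) f = 0.
  rewrite /nq (_ : sqw _ _ = fun=> 0); first by rewrite rsum_ge0E// esum1.
  apply/funext => x; rewrite /sqw /pot_neg /funrneg max_r ?mul0r ?mulr0//.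
  by rewrite oppr_le0 funrpos_ge0.
have [r ur fr] := Cc_seq Cf.
have f0 x : x \notin r -> normc (f x) ^+ 2 = 0.
  by move=> /fr ->; rewrite Normc.normc0 expr0n.
rewrite (fsbig_sum_seq ur); last by move=> x /f0 ->; rewrite mulr0 mul0r.
rewrite subr0 [X in X <= _](_ : _ = nq qn f)//.
rewrite /nq; have [|_ ->] := @summ_rsum_seq R X (sqw qn f) r ur.
  by move=> x /f0 fx; rewrite /sqw fx mul0r.
by apply: eq_bigr => x _; rewrite /sqw /pot_neg; ring.
Qed.

(** Convergence in each term of the form separately. That [form_approx] implies it
    is the closability of the form ([form_approx_strong]). *)
Definition strong_approx u f := [/\ forall n, Cc (u n), fe f &
  (fun n => energy (u n - f)) @ \oo --> (0 : R)].

Lemma strong_approx_fe u f : strong_approx u f -> forall n, fe (u n - f).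
Proof.
by move=> [Cu ff _] n; apply: finite_energyB => //; exact: Cc_finite_energy.
Qed.

Lemma strong_approx_pieces u f : strong_approx u f ->
  [/\ (fun n => nq m (u n - f)) @ \oo --> (0 : R),
      (fun n => nq bw (D (u n) - D f)) @ \oo --> (0 : R),
      (fun n => nq qp (u n - f)) @ \oo --> (0 : R) &
      (fun n => nq qn (u n - f)) @ \oo --> (0 : R)].
Proof.
move=> [_ _ uf]; have E n : D (u n) - D f = D (u n - f) by rewrite edge_diffB.
have sq (a : nat -> R) : (forall n, 0 <= a n <= energy (u n - f)) -> a @ \oo --> (0 : R).
  move=> ha; apply: (@squeeze_cvgr _ _ _ _ (fun=> 0) (fun n => energy (u n - f))).
  - by apply: nearW.
  - exact: cvg_cst.
  - exact: uf.
by split; apply: sq => n; rewrite ?E; have [h4 h1 h2 h3] := energy_pieces q hG (u n - f);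
  apply/andP; split => //; apply: nq_ge0; [exact: w4|exact: w1|exact: w2|exact: w3].
Qed.

Lemma strong_approx_form_cvg u f h : strong_approx u f -> fe h ->
  (fun n => rform (u n) h) @ \oo --> rform f h.
Proof.
move=> uf [h4 h1 h2 h3]; have [p4 p1 p2 p3] := strong_approx_pieces uf.
have [Cu [f4 f1 f2 f3] _] := uf; rewrite rformE.
have feu n := Cc_finite_energy q hG (Cu n).
rewrite (_ : (fun n => _) = (fun n => rinner bw (D (u n)) (D h) + rinner qp (u n) h -
   rinner qn (u n) h)); last by apply/funext => n; rewrite rformE.
apply: cvgB; first apply: cvgD.
- by apply: (rinner_cvg w1) => // n; have [] := feu n.
- by apply: (rinner_cvg w2) => // n; have [] := feu n.
- by apply: (rinner_cvg w3) => // n; have [] := feu n.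
Qed.

Lemma strong_approx_form2_cvg u f : strong_approx u f ->
  (fun n => rform (u n) (u n)) @ \oo --> rform f f.
Proof.
move=> uf; have [p4 p1 p2 p3] := strong_approx_pieces uf.
have [Cu [f4 f1 f2 f3] _] := uf; rewrite rformE -!nqE.
have feu n := Cc_finite_energy q hG (Cu n).
rewrite (_ : (fun n => _) = (fun n => nq bw (D (u n)) + nq qp (u n) -
   nq qn (u n))); last by apply/funext => n; rewrite rformE -!nqE.
apply: cvgB; first apply: cvgD.
- by apply: (nq_cvg w1) => // n; have [] := feu n.
- by apply: (nq_cvg w2) => // n; have [] := feu n.
- by apply: (nq_cvg w3) => // n; have [] := feu n.
Qed.

Lemma strong_approx_nq_cvg u f : strong_approx u f ->
  (fun n => nq m (u n)) @ \oo --> nq m f.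
Proof.
move=> uf; have [p4 _ _ _] := strong_approx_pieces uf.
have [Cu [f4 _ _ _] _] := uf; apply: (nq_cvg w4) => // n.
by have [] := Cc_finite_energy q hG (Cu n).
Qed.

Lemma strong_approx_inner_cvg u f h : strong_approx u f -> ell2 m h ->
  (fun n => rinner m (u n) h) @ \oo --> rinner m f h.
Proof.
move=> uf hh; have [p4 _ _ _] := strong_approx_pieces uf.
have [Cu [f4 _ _ _] _] := uf; apply: (rinner_cvg w4) => // n.
by have [] := Cc_finite_energy q hG (Cu n).
Qed.

Lemma strong_approx_pointwise u f : strong_approx u f -> pointwise u f.
Proof.
move=> uf; apply: (normsq_pointwise (graph_m_gt0 hG)) => e e0.
have [p4 _ _ _] := strong_approx_pieces uf; have feu := strong_approx_fe uf.
have /cvgr0Pnorm_le/(_ e e0)[N _ hN] := p4; exists N => n /hN /= h.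
have [e4 _ _ _] := feu n; rewrite (normsqE w4 e4) lee_fin.
exact: le_trans (ler_norm _) h.
Qed.

Lemma strong_approx_comb (a c : R[i]) u u' f f' :
  strong_approx u f -> strong_approx u' f' ->
  strong_approx (fun n => (fun x => a * u n x) + (fun x => c * u' n x))
                ((fun x => a * f x) + (fun x => c * f' x)).
Proof.
move=> uf uf'; have [Cu ff lf] := uf; have [Cu' ff' lf'] := uf'; split.
- by move=> n; apply: CcD; exact: CcZ.
- by apply: (finite_energyD hG); exact: finite_energyZ.
pose A := 2 * normc a ^+ 2; pose C := 2 * normc c ^+ 2.
apply: (@squeeze_cvgr _ _ _ _ (fun=> 0)
  (fun n => A * energy (u n - f) + C * energy (u' n - f'))).
- apply: nearW => n; rewrite energy_ge0//=.
  have fn := strong_approx_fe uf n; have fn' := strong_approx_fe uf' n.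
  have := energyD_le hG (finite_energyZ hG a fn) (finite_energyZ hG c fn').
  rewrite !energyZ// /A /C !mulrA; apply: le_trans; rewrite le_eqVlt; apply/orP; left.
  by apply/eqP; congr energy; apply/funext => x; rewrite !fctE; ring.
- exact: cvg_cst.
- rewrite -[X in _ --> X](_ : A * 0 + C * 0 = 0 :> R); last by rewrite !mulr0 addr0.
  by apply: cvgD; exact: cvgMl_tmp.
Qed.

Lemma strong_approx_cst f : Cc f -> strong_approx (fun=> f) f.
Proof.
move=> Cf; have ff := Cc_finite_energy q hG Cf; split => //.
have -> : (fun=> energy (f - f)) = (fun=> 0) :> (nat -> R); last exact: cvg_cst.
apply/funext => _; have := energyZ hG 0 ff; rewrite Normc.normc0 expr0n mul0r => <-.
by congr energy; apply/funext => x; rewrite !fctE; ring.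
Qed.

Lemma strong_form_approx u f : strong_approx u f -> form_approx m Q u f.
Proof.
move=> uf; have [Cu ff lf] := uf; have feu := strong_approx_fe uf; split => //.
  apply/(normsq_cvg0P w4) => e e0.
  have [p4 _ _ _] := strong_approx_pieces uf.
  have /cvgr0Pnorm_le/(_ e e0)[N _ hN] := p4; exists N => n /hN /= h.
  have [e4 _ _ _] := feu n; rewrite (normsqE w4 e4) lee_fin.
  exact: le_trans (ler_norm _) h.
move=> e e0; have /cvgr0Pnorm_lt/(_ (e / 4)) := lf.
move=> /(_ _)[|N _ hN]; first by rewrite divr_gt0.
exists N => n k /hN /= hn /hN /= hk.
rewrite (Qform_Cc q hG); last exact: CcB.
apply: le_lt_trans (rform_energy_le q hG _) _.
have -> : u n - u k = (u n - f) + (- (u k - f)) by rewrite opprB addrA subrK.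
apply: le_lt_trans (energyD_le hG (feu n) (finite_energyN hG (feu k))) _.
rewrite energyN//; move: (ler_norm (energy (u n - f))) (ler_norm (energy (u k - f))).
move: hn hk; move: (energy (u n - f)) (energy (u k - f)) => x y; lra.
Qed.

Section Coercive.
Variables (alpha C : R).
Hypotheses (halpha0 : 0 < alpha) (halpha1 : alpha < 1) (C0 : 0 <= C).
Hypothesis hC : forall f, Cc f ->
  nq qn f <= alpha * (nq bw (D f) + nq qp f) + C * nq m f.

(** As [alpha < 1], the negative part of the potential can be absorbed. *)
Lemma energy_form_bound f : Cc f ->
  nq bw (D f) <= (rform f f + C * nq m f) / (1 - alpha) /\
  nq qp f <= (rform f f + C * nq m f) / (1 - alpha) /\
  nq qn f <= (rform f f + C * nq m f) / (1 - alpha) + C * nq m f.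
Proof.
move=> Cf; have a1 : 0 < 1 - alpha by rewrite subr_gt0.
have := hC Cf; rewrite rformE -!nqE => h.
have h1 := nq_ge0 w1 (D f); have h2 := nq_ge0 w2 f; have h3 := nq_ge0 w3 f.
have h4 := nq_ge0 w4 f; have h5 := mulr_ge0 C0 h4.
have al0 := halpha0.
have E : (nq bw (D f) + nq qp f) * (1 - alpha) <=
    nq bw (D f) + nq qp f - nq qn f + C * nq m f by lra.
have {}E : nq bw (D f) + nq qp f <=
    (nq bw (D f) + nq qp f - nq qn f + C * nq m f) / (1 - alpha).
  by rewrite ler_pdivlMr.
split; first by lra.
split; first by lra.
apply: le_trans h _; rewrite lerD2r; apply: le_trans E.
by apply: ler_piMl; [exact: addr_ge0|exact: ltW].
Qed.

(** By [energy_form_bound] a sequence that is Cauchy for the form is Cauchy for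
    each of its terms. It converges pointwise, and Fatou's lemma transfers the
    Cauchy estimate of each term to the limit. *)
Lemma form_approx_strong u f : form_approx m Q u f -> strong_approx u f.
Proof.
move=> [Cu uf Qu]; have a1 : 0 < 1 - alpha by rewrite subr_gt0.
have feu n := Cc_finite_energy q hG (Cu n).
have feB n k : fe (u n - u k) by exact: finite_energyB.
have ufe := (normsq_cvg0P w4 (fun n => u n - f)).1 uf.
have pw := normsq_pointwise (graph_m_gt0 hG) ufe.
have pwB n : pointwise (fun k => u n - u k) (u n - f).
  move=> x; rewrite (_ : (fun k => _) = fun k => normc (u k x - f x)); first exact: pw.
  by apply/funext => k; rewrite !fctE -(normcN (u k x - f x)); congr normc; ring.
have pwD n : pointwise (fun k => D (u n - u k)) (D (u n - f)).
  move=> [x y]; apply: (@squeeze_cvgr _ _ _ _ (fun=> 0)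
     (fun k => normc (u k x - f x) + normc (u k y - f y))).
  - apply: nearW => k; rewrite normc_ge0/=.
    have -> : D (u n - u k) (x, y) - D (u n - f) (x, y) =
        - (u k x - f x) + expi (theta x y) * (u k y - f y).
      by rewrite /edge_diff/= !fctE; ring.
    apply: le_trans (le_normcD _ _) _.
    by rewrite normcN Normc.normcM normc_expi mul1r.
  - exact: cvg_cst.
  - by rewrite -[X in _ --> X](addr0 (0 : R)); apply: cvgD; exact: pw.
have ell2m : ell2 m f.
  have [N /(_ N (leqnn N)) hN] := ufe 1 ltr01.
  rewrite (_ : f = u N - (u N - f)); last by rewrite opprB addrC subrK.
  apply: (ell2B w4); first by have [] := feu N.
  by rewrite /ell2 (le_lt_trans hN)// ltry.
have cauchy e : 0 < e -> exists N, forall n k, (N <= n)%N -> (N <= k)%N ->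
    [/\ nq m (u n - u k) <= e, nq bw (D (u n - u k)) <= e,
        nq qp (u n - u k) <= e & nq qn (u n - u k) <= e].
  (* If the form and the squared norm are at most [d], all the bounds in
     [energy_form_bound] are at most [e]. *)
  move=> e0; pose d := Num.min e (e / 2 * (1 - alpha) / (1 + C)).
  have C1 : 0 < 1 + C by rewrite ltr_wpDr.
  have d0 : 0 < d by rewrite lt_min e0/=; do ?[apply: divr_gt0 => //|apply: mulr_gt0 => //].
  have [N1 hN1] := ufe (d / 4) (divr_gt0 d0 (ltr0n _ 4)).
  have [N2 hN2] := Qu d d0.
  exists (maxn N1 N2) => n k; rewrite !geq_max => /andP[n1 n2] /andP[k1 k2].
  have mB : nq m (u n - u k) <= d.
    have -> : u n - u k = (u n - f) + (- (u k - f)) by rewrite opprB addrA subrK.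
    have [e4n _ _ _] := feu n; have [e4k _ _ _] := feu k.
    have eBn := ell2B w4 e4n ell2m; have eBk := ell2B w4 e4k ell2m.
    have := nqD_le w4 eBn (ell2N w4 eBk); rewrite (nqN w4)//.
    have := hN1 n n1; have := hN1 k k1.
    by rewrite (normsqE w4 eBn) (normsqE w4 eBk) !lee_fin -!/(nq _ _); lra.
  have QB : rform (u n - u k) (u n - u k) <= d.
    have CB : Cc (u n - u k) by exact: CcB.
    by rewrite -(Qform_Cc q hG CB); apply: le_trans (ler_norm _) _; exact/ltW/hN2.
  have [d1 d2] : d <= e /\ d <= e / 2 * (1 - alpha) / (1 + C).
    by rewrite /d !ge_min !lexx orbT.
  move: d2; rewrite ler_pdivlMr// => d2; have CmB := ler_wpM2l C0 mB.
  have h1 : (rform (u n - u k) (u n - u k) + C * nq m (u n - u k)) / (1 - alpha) <= e / 2.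
    by rewrite ler_pdivrMr//; lra.
  have h2 : C * nq m (u n - u k) <= e / 2.
    have : e / 2 * (1 - alpha) <= e / 2.
      by rewrite ler_piMr ?divr_ge0 ?(ltW e0)// lerBlDr lerDl ltW.
    lra.
  have [E1 [E2 E3]] := energy_form_bound (CcB (Cu n) (Cu k)).
  by split; lra.
have limit e : 0 < e -> exists N, forall n, (N <= n)%N ->
    [/\ (normsq m (u n - f)%R <= e%:E)%E, (normsq bw (D (u n - f)%R) <= e%:E)%E,
        (normsq qp (u n - f)%R <= e%:E)%E & (normsq qn (u n - f)%R <= e%:E)%E].
  move=> /cauchy[N hN]; exists N => n Nn.
  have hk k (Nk : (N <= k)%N) := hN n k Nn Nk.
  split.
  - apply: (normsq_limit_le (N := N) (pwB n)) => k /hk[h _ _ _].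
    by have [e4 _ _ _] := feB n k; rewrite (normsqE w4 e4) lee_fin.
  - apply: (normsq_limit_le (N := N) (pwD n)) => k /hk[_ h _ _].
    by have [_ e1 _ _] := feB n k; rewrite (normsqE w1 e1) lee_fin.
  - apply: (normsq_limit_le (N := N) (pwB n)) => k /hk[_ _ h _].
    by have [_ _ e2 _] := feB n k; rewrite (normsqE w2 e2) lee_fin.
  - apply: (normsq_limit_le (N := N) (pwB n)) => k /hk[_ _ _ h].
    by have [_ _ _ e3] := feB n k; rewrite (normsqE w3 e3) lee_fin.
have limfe e n : [/\ (normsq m (u n - f)%R <= e%:E)%E, (normsq bw (D (u n - f)%R) <= e%:E)%E,
    (normsq qp (u n - f)%R <= e%:E)%E & (normsq qn (u n - f)%R <= e%:E)%E] ->
    fe (u n - f).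
  by move=> [l4 l1 l2 l3]; split; apply: le_lt_trans (ltry e).
have ff : fe f.
  have [N /(_ N (leqnn N)) /limfe hN] := limit 1 ltr01.
  rewrite (_ : f = u N - (u N - f)); last by rewrite opprB addrC subrK.
  exact: finite_energyB.
split => //; apply/cvgr0Pnorm_le => e e0.
have [N hN] := limit (e / 4) (divr_gt0 e0 (ltr0n _ 4)); exists N => // n /hN h /=.
have [e4 e1 e2 e3] := limfe _ _ h; case: h.
rewrite (normsqE w4 e4) (normsqE w1 e1) (normsqE w2 e2) (normsqE w3 e3) !lee_fin.
by rewrite ger0_norm ?energy_ge0// /energy -!/(nq _ _); lra.
Qed.

Local Notation dom := (closure_dom m Q).

Lemma closure_domP f : dom f <-> exists u, strong_approx u f.
Proof.
split=> [[_ [u hu]]|[u uf]]; first by exists u; exact: form_approx_strong.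
split; first by have [_ [] ] := uf.
by exists u; exact: strong_form_approx.
Qed.

Lemma dom_fe f : dom f -> fe f.
Proof. by move=> /closure_domP[u []]. Qed.

Lemma dom_comb (a c : R[i]) f g : dom f -> dom g ->
  dom ((fun x => a * f x) + (fun x => c * g x)).
Proof.
move=> /closure_domP[u uf] /closure_domP[v vg]; apply/closure_domP.
by eexists; exact: strong_approx_comb uf vg.
Qed.

Lemma domD f g : dom f -> dom g -> dom (f + g).
Proof.
move=> df dg; have := dom_comb 1 1 df dg.
have E (h : X -> R[i]) : (fun x => 1 * h x) = h by apply/funext => x; rewrite mul1r.
by rewrite (E f) (E g).
Qed.

Lemma domZ (a : R[i]) f : dom f -> dom (fun x => a * f x).
Proof.
move=> df; have := dom_comb a 0 df df.
have E : (fun x => 0 * f x) = 0 by apply/funext => x; rewrite mul0r.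
by rewrite E addr0.
Qed.

Lemma domB f g : dom f -> dom g -> dom (f - g).
Proof.
move=> df dg; apply: domD => //; have := domZ (-1) dg.
have E : (fun x => -1 * g x) = - g by apply/funext => x; rewrite mulN1r.
by rewrite E.
Qed.

Lemma Cc_dom f : Cc f -> dom f.
Proof. by move=> Cf; apply/closure_domP; exists (fun=> f); exact: strong_approx_cst. Qed.

(** In particular the value does not depend on the approximating sequence. *)
Lemma form_closureE f : dom f -> form_closure m Q f = rform f f.
Proof.
move=> [_ hf]; rewrite /form_closure; set u := xget _ _.
have uf : strong_approx u f by apply: form_approx_strong; apply: xgetPex hf.
have [Cu _ _] := uf; apply: cvg_lim => //.
rewrite (_ : (fun n => _) = fun n => rform (u n) (u n)).
  exact: strong_approx_form2_cvg.
by apply/funext => n; rewrite (Qform_Cc q hG (Cu n)).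
Qed.

(** Polarization recovers the sesquilinear form from its diagonal. *)
Lemma polar_form_closure f g : dom f -> dom g ->
  polar (form_closure m Q) f g = sform f g.
Proof.
move=> df dg; have ff := dom_fe df; have fg := dom_fe dg.
have dig := domZ 'i%C dg; have fig := dom_fe dig.
have Ei : rform f (fun x => 'i%C * g x) = Im (sform f g).
  rewrite /rform sformC (sformZl hG)// [sform g f]sformC.
  by case: (sform f g) => a c /=; ring.
rewrite /polar !form_closureE; [|exact: domB|exact: domD|exact: domB|exact: domD].
rewrite !(rform_sqrB hG)// !(rform_sqrD hG)// Ei.
have combine (x1 x2 x3 x4 : R) :
    4^-1 * (x1%:C%C - x2%:C%C + 'i%C * x3%:C%C - 'i%C * x4%:C%C) =
    ((x1 - x2) / 4 +i* ((x3 - x4) / 4))%C.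
  have -> : (4 : R[i]) = (4 : R)%:C%C by rewrite rmorph_nat.
  by rewrite -fmorphV /=; simpc; rewrite ![4^-1 * _]mulrC.
rewrite combine /rform; case: (sform f g) => a c /=.
by congr (_ +i* _)%C; field.
Qed.

End Coercive.

End FormClosure.

(** * The inverse of the shifted operator *)

Section ShiftedInverse.
Variables (R : realType) (X : choiceType).
Variables (b theta : X -> X -> R) (q m : X -> R).
Hypothesis hG : magnetic_graph b theta m.
Implicit Types (f g h : X -> R[i]) (u : nat -> X -> R[i]).
Local Notation normc := Normc.normc.
Local Notation w1 := (edge_weight_ge0 hG).
Local Notation w4 := (m_ge0 hG).
Local Notation D := (edge_diff theta).
Local Notation bw := (edge_weight b).
Local Notation qp := (pot_pos q m).
Local Notation qn := (pot_neg q m).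
Local Notation fe := (finite_energy b theta q m).
Local Notation rform := (rform b theta q m).
Local Notation sform := (sform b theta q m).
Local Notation Q := (Qform b theta q m).

Variables (alpha C : R).
Hypotheses (halpha0 : 0 < alpha) (halpha1 : alpha < 1) (C0 : 0 <= C).
Hypothesis hC : forall f, Cc f ->
  nq qn f <= alpha * (nq bw (D f) + nq qp f) + C * nq m f.
Local Notation dom := (closure_dom m Q).

(** The form of [H + C + 1]; the shift makes it dominate the squared norm. *)
Definition shifted f h : R[i] := sform f h + (C + 1)%:C%C * inner m f h.
Definition rshifted f h : R := rform f h + (C + 1) * rinner m f h.

Lemma rshiftedE f h : rshifted f h = Re (shifted f h).
Proof.
rewrite /rshifted /shifted /rform /rinner raddfD/=.
by case: (inner m f h) => a c /=; ring.
Qed.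

Lemma shiftedC f h : shifted h f = (shifted f h)^*%C.
Proof. by rewrite /shifted sformC innerC conjcD conjcM conjc_real. Qed.

Lemma rshiftedC f h : rshifted f h = rshifted h f.
Proof. by rewrite !rshiftedE shiftedC; case: (shifted h f). Qed.

Lemma shiftedDl f g h : fe f -> fe g -> fe h ->
  shifted (f + g) h = shifted f h + shifted g h.
Proof.
move=> ff fg fh; have [f4 _ _ _] := ff; have [g4 _ _ _] := fg; have [h4 _ _ _] := fh.
by rewrite /shifted (sformDl hG)// (innerDl w4)//; ring.
Qed.

Lemma shiftedZl (a : R[i]) f h : fe f -> fe h ->
  shifted (fun x => a * f x) h = a * shifted f h.
Proof.
move=> ff fh; have [f4 _ _ _] := ff; have [h4 _ _ _] := fh.
by rewrite /shifted (sformZl hG)// (innerZl w4)//; ring.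
Qed.

Lemma rshiftedDl f g h : fe f -> fe g -> fe h ->
  rshifted (f + g) h = rshifted f h + rshifted g h.
Proof. by move=> ff fg fh; rewrite !rshiftedE shiftedDl// raddfD. Qed.

Lemma rshiftedBl f g h : fe f -> fe g -> fe h ->
  rshifted (f - g) h = rshifted f h - rshifted g h.
Proof.
move=> ff fg fh; rewrite rshiftedDl//; last exact: finite_energyN.
have [g4 _ _ _] := fg; have [h4 _ _ _] := fh.
by congr (_ + _); rewrite /rshifted (rformNl hG)// (rinnerNl w4)//; ring.
Qed.

Lemma rshiftedZl (t : R) f h : fe f -> fe h ->
  rshifted (fun x => t%:C%C * f x) h = t * rshifted f h.
Proof.
move=> ff fh; rewrite !rshiftedE shiftedZl//.
by case: (shifted f h) => a c /=; ring.
Qed.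

Lemma rshifted_sqrD f h : fe f -> fe h ->
  rshifted (f + h) (f + h) = rshifted f f + 2 * rshifted f h + rshifted h h.
Proof.
move=> ff fh; have ffh := finite_energyD hG ff fh; rewrite rshiftedDl//.
by rewrite (rshiftedC f (f + h)) (rshiftedC h (f + h)) !rshiftedDl// (rshiftedC h f); ring.
Qed.

Lemma Cc_coercive f : Cc f -> nq m f <= rshifted f f.
Proof.
move=> Cf; have [E _] := energy_form_bound hG halpha0 halpha1 C0 hC Cf.
have a1 : 0 < 1 - alpha by rewrite subr_gt0.
have := le_trans (nq_ge0 w1 (D f)) E; rewrite pmulr_lge0 ?invr_gt0//.
by rewrite /rshifted -nqE; lra.
Qed.

Lemma dom_approx f : dom f -> exists u, strong_approx b theta q m u f.
Proof. by move/(closure_domP hG halpha0 halpha1 C0 hC). Qed.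

Lemma approx_dom u f : strong_approx b theta q m u f -> dom f.
Proof. by move=> uf; apply/(closure_domP hG halpha0 halpha1 C0 hC); exists u. Qed.

Lemma dom_finite_energy f : dom f -> fe f.
Proof. exact: (dom_fe hG halpha0 halpha1 C0 hC). Qed.

(** Inherited from finitely supported functions by approximation. *)
Lemma dom_coercive f : dom f -> nq m f <= rshifted f f.
Proof.
move=> /dom_approx[u uf]; have [Cu _ _] := uf.
apply: (ler_lim_seq (strong_approx_nq_cvg hG uf)).
  apply: cvgD; first exact: strong_approx_form2_cvg uf.
  have E : (fun n => rinner m (u n) (u n)) = fun n => nq m (u n).
    by apply/funext => n; rewrite nqE.
  have L : (fun n => rinner m (u n) (u n)) @ \oo --> rinner m f f.
    by rewrite E -nqE; exact: strong_approx_nq_cvg uf.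
  by apply: cvgMl_tmp; exact: L.
by move=> n; exact: Cc_coercive.
Qed.

Lemma rshifted_cvg u f h : strong_approx b theta q m u f -> fe h ->
  (fun n => rshifted (u n) h) @ \oo --> rshifted f h.
Proof.
move=> uf fh; have [h4 _ _ _] := fh.
apply: cvgD; first exact: strong_approx_form_cvg uf fh.
by apply: cvgMl_tmp; exact: strong_approx_inner_cvg uf h4.
Qed.

Lemma nq_eq0 f : ell2 m f -> nq m f = 0 -> f = 0.
Proof.
move=> hf f0; apply/funext => x; have := sqw_le_rsum w4 x hf.
rewrite -/(nq m f) f0 /sqw pmulr_lle0 ?(graph_m_gt0 hG)// => h1.
have /eqP : normc (f x) ^+ 2 = 0 by apply/eqP; rewrite eq_le h1 sqr_ge0.
by rewrite sqrf_eq0 => /eqP/Normc.eq0_normc.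
Qed.

(** Riesz representation for the shifted form. A minimizing sequence of
    [|u|^2_form - 2 Re <g, u>] is taken among finitely supported functions, so
    that it exhibits its limit as an element of the form domain. *)
Lemma shifted_riesz g : ell2 m g ->
  exists2 f, dom f & forall h, dom h -> shifted f h = inner m g h.
Proof.
move=> g4.
pose Phi v := rshifted v v - 2 * rinner m g v.
have m4 (v : X -> R[i]) : Cc v -> ell2 m v by move=> /(Cc_finite_energy q hG)[].
have Philow (v : X -> R[i]) : Cc v -> - nq m g <= Phi v.
  move=> Cv; have v4 := m4 v Cv; have := Cc_coercive Cv.
  have := nq_ge0 w4 (g - v); rewrite (nqD w4) ?(nqN w4)//; last exact: (ell2N w4).
  by rewrite (rinnerC m g (- v)) (rinnerNl w4)// (rinnerC m v g) /Phi; lra.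
pose S := [set r | exists2 v : X -> R[i], Cc v & r = Phi v].
have S0 : has_inf S.
  split; last by exists (- nq m g) => _ [u Cu ->]; exact: Philow.
  by exists (Phi 0); exists 0 => //; apply: (@seq_Cc _ _ _ [::]).
pose I := inf S.
have hI (v : X -> R[i]) : Cc v -> I <= Phi v.
  by move=> Cv; apply: ge_inf; [exact: S0.2|exists v].
have ex n : exists v : X -> R[i], Cc v /\ Phi v < I + n.+1%:R^-1.
  have n0 : 0 < n.+1%:R^-1 :> R by rewrite invr_gt0 ltr0n.
  by have [_ [v Cv ->] h] := inf_adherent n0 S0; exists v.
have [u hu] := choice ex.
have Cu n : Cc (u n) by have [] := hu n.
have feu n := Cc_finite_energy q hG (Cu n).
(* Minimality up to [n.+1^-1] bounds the first variation of [Phi] at [u n]. *)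
have EL n h : Cc h ->
    (rshifted (u n) h - rinner m g h) ^+ 2 <= n.+1%:R^-1 * rshifted h h.
  move=> Ch; have fh := Cc_finite_energy q hG Ch; have h4 := m4 h Ch.
  have hh0 : 0 <= rshifted h h by apply: le_trans (nq_ge0 w4 h) (Cc_coercive Ch).
  apply: le_trans (_ : (Phi (u n) - I) * rshifted h h <= _); last first.
    by rewrite ler_wpM2r// lerBlDl; exact/ltW/(hu n).2.
  apply: discriminant => // t.
  have Cth : Cc (fun x => t%:C%C * h x) by exact: CcZ.
  have fth := Cc_finite_energy q hG Cth; have th4 := m4 _ Cth; have u4 := m4 _ (Cu n).
  have := hI _ (CcD (Cu n) Cth); rewrite /Phi.
  have fuh := finite_energyD hG (feu n) fth.
  have -> : rshifted (u n + (fun x => t%:C%C * h x)) (u n + (fun x => t%:C%C * h x)) =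
      rshifted (u n) (u n) + 2 * t * rshifted (u n) h + t ^+ 2 * rshifted h h.
    rewrite rshifted_sqrD// (rshiftedC (u n) (fun x => t%:C%C * h x)) !rshiftedZl//.
    rewrite (rshiftedC h (fun x => t%:C%C * h x)) rshiftedZl// (rshiftedC h (u n)).
    ring.
  have -> : rinner m g (u n + (fun x => t%:C%C * h x)) = rinner m g (u n) + t * rinner m g h.
    by rewrite rinnerC (rinnerDl w4)// (rinnerZl w4)// !(rinnerC m g).
  lra.
have cauchy n k : rshifted (u n - u k) (u n - u k) <= 2 * (n.+1%:R^-1 + k.+1%:R^-1).
  have Ch := CcB (Cu n) (Cu k); have fh := Cc_finite_energy q hG Ch.
  have h1 := EL n _ Ch; have h2 := EL k _ Ch; move: h1 h2.
  have := Cc_coercive Ch; have := nq_ge0 w4 (u n - u k).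
  have := rshiftedBl (feu n) (feu k) fh.
  set d := rshifted (u n - u k) (u n - u k); set r1 := rshifted (u n) _.
  set r2 := rshifted (u k) _; set r3 := rinner m g _ => e h0 h0' h1 h2.
  have [d0|d0] := eqVneq d 0; first by rewrite d0 mulr_ge0 ?addr_ge0 ?invr_ge0 ?ler0n.
  have {}d0 : 0 < d by rewrite lt_neqAle eq_sym d0 (le_trans h0).
  have E2 : d * d = ((r1 - r3) - (r2 - r3)) ^+ 2 by rewrite e; ring.
  rewrite -(ler_pM2l d0) E2; have := sqr_ge0 ((r1 - r3) + (r2 - r3)).
  by move: h1 h2; move: (n.+1%:R^-1) (k.+1%:R^-1) => x y; lra.
have cauchy' e : 0 < e -> exists N, forall n k, (N <= n)%N -> (N <= k)%N ->
    rshifted (u n - u k) (u n - u k) <= e.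
  move=> e0; have [N hN] : exists N, N.+1%:R^-1 < e / 4.
    have [N _ hN] := near_infty_natSinv_lt (PosNum (divr_gt0 e0 (ltr0n _ 4))).
    by exists N; exact: (hN N (leqnn N)).
  exists N => n k Nn Nk; apply: le_trans (cauchy n k) _.
  have le j : (N <= j)%N -> j.+1%:R^-1 <= N.+1%:R^-1 :> R.
    by move=> Nj; rewrite lef_pV2 ?posrE ?ltr0n// ler_nat ltnS.
  move: (le n Nn) (le k Nk) hN.
  by move: (N.+1%:R^-1) (n.+1%:R^-1) (k.+1%:R^-1) => x y z; lra.
have [|f f4 uf] := @ell2_complete R X m (graph_m_gt0 hG) u (fun n => m4 _ (Cu n)).
  move=> e /cauchy'[N hN]; exists N => n k Nn Nk; have Ch := CcB (Cu n) (Cu k).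
  rewrite (normsqE w4 (m4 _ Ch)) lee_fin.
  exact: le_trans (Cc_coercive Ch) (hN n k Nn Nk).
have ufs : strong_approx b theta q m u f.
  apply: (form_approx_strong hG halpha0 halpha1 C0 hC); split => //.
    by apply/(normsq_cvg0P w4).
  move=> e e0; have C2 : 0 < 2 * (C + 2) by have := C0; lra.
  have [N hN] := cauchy' (e / (2 * (C + 2))) (divr_gt0 e0 C2).
  exists N => n k Nn Nk; have Ch := CcB (Cu n) (Cu k).
  rewrite (Qform_Cc q hG Ch); have := hN n k Nn Nk; have := Cc_coercive Ch.
  have := nq_ge0 w4 (u n - u k); rewrite /rshifted -nqE.
  set x := rform _ _; set y := nq m _ => y0 h1; rewrite ler_pdivlMr// => h2.
  have c0 := C0; have h3 := mulr_ge0 C0 y0.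
  by rewrite ltr_norml; apply/andP; split; nra.
have df := approx_dom ufs.
have ELlim h : Cc h -> rshifted f h = rinner m g h.
  move=> Ch; have fh := Cc_finite_energy q hG Ch.
  apply: (@seq_lim_unique _ (fun n => rshifted (u n) h)); first exact: rshifted_cvg.
  apply/subr_cvg0; apply: (@sqr_cvg0 _ _ (fun n => n.+1%:R^-1) (rshifted h h)).
    by move=> n; rewrite mulrC; exact: EL.
  exact: cvg_harmonic.
have ELdom h : dom h -> rshifted f h = rinner m g h.
  move=> /dom_approx[v vh]; have [Cv _ _] := vh.
  rewrite rshiftedC rinnerC.
  apply: (@seq_lim_unique _ (fun n => rshifted (v n) f)).
    exact: rshifted_cvg (dom_finite_energy df).
  rewrite (_ : (fun n => _) = fun n => rinner m (v n) g).
    exact: strong_approx_inner_cvg vh g4.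
  by apply/funext => n; rewrite rshiftedC rinnerC ELlim.
exists f => // h dh.
have dih := domZ hG halpha0 halpha1 C0 hC 'i%C dh.
have fh := dom_finite_energy dh; have ff := dom_finite_energy df.
have [h4 _ _ _] := fh.
(* Testing with [i h] recovers the imaginary part. *)
have E1 := ELdom _ dh; have := ELdom _ dih.
rewrite rshiftedE shiftedC shiftedZl// /rinner innerC (innerZl w4)//.
rewrite rshiftedE in E1; move: E1; rewrite /rinner [shifted f h]shiftedC.
rewrite [inner m g h]innerC.
case: (shifted h f) (inner m h g) => [a c] [a' c'] /= -> h1.
by congr (_ +i* _)%C; lra.
Qed.

Local Notation V := (ell2_space (graph_m_gt0 hG)).
Local Notation ip := (@ell2_ip R X m (graph_m_gt0 hG)).

(** The weak formulation of [T = (H + C + 1)^-1]. *)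
Definition shifted_inverse (T : V -> V) := forall g : V,
  dom (T g) /\ forall h, dom h -> shifted (T g) h = inner m g h.

Lemma shifted_eq0 f : dom f -> (forall h, dom h -> shifted f h = 0) -> f = 0.
Proof.
move=> df h0; have [f4 _ _ _] := dom_finite_energy df; apply: nq_eq0 => //.
apply/eqP; rewrite eq_le (nq_ge0 w4) andbT.
by have := dom_coercive df; rewrite rshiftedE h0.
Qed.

Lemma shifted_inj f f' : dom f -> dom f' ->
  (forall h, dom h -> shifted f h = shifted f' h) -> f = f'.
Proof.
move=> df df' h; apply/eqP; rewrite -subr_eq0; apply/eqP/shifted_eq0.
  exact: (domB hG halpha0 halpha1 C0 hC).
move=> k dk; have ff := dom_finite_energy df; have ff' := dom_finite_energy df'.
have fk := dom_finite_energy dk.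
have E : f - f' = f + (fun x => -1 * f' x).
  by congr (_ + _); apply/funext => x; rewrite mulN1r.
by rewrite E shiftedDl// ?shiftedZl// ?h// ?mulN1r ?subrr//; exact: finite_energyZ.
Qed.

Lemma shifted_inverse_exists : exists T : {linear V -> V}, shifted_inverse T.
Proof.
have ex (g : V) : exists F : V, dom F /\ forall h, dom h -> shifted F h = inner m g h.
  have [f df hf] := shifted_riesz (ell2_funP g).
  have [f4 _ _ _] := dom_finite_energy df.
  by exists (Ell2 (graph_m_gt0 hG) f4).
have [T hT] := choice ex.
have lin : linear T.
  move=> a g g'; apply: ell2_space_eq.
  have [d1 e1] := hT (a *: g + g'); have [d2 e2] := hT g; have [d3 e3] := hT g'.
  have dad : dom ((fun x => a * T g x) + T g').
    by apply: (domD hG halpha0 halpha1 C0 hC) => //; exact: (domZ hG halpha0 halpha1 C0 hC).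
  apply: shifted_inj => // h dh; rewrite e1//.
  have f2 := dom_finite_energy d2; have f3 := dom_finite_energy d3.
  have fh := dom_finite_energy dh; have fa := finite_energyZ hG a f2.
  have [h4 _ _ _] := fh.
  transitivity (shifted ((fun x => a * T g x) + T g') h); last by [].
  rewrite shiftedDl// shiftedZl// e2// e3//.
  have g4 := ell2_funP g; have g4' := ell2_funP g'.
  transitivity (inner m ((fun x => a * g x) + g') h); first by [].
  by rewrite (innerDl w4)// ?(innerZl w4)//; exact: (ell2Z w4).
pose L := HB.pack_for {linear V -> V} T (GRing.isLinear.Build _ _ _ _ T lin).
by exists L.
Qed.

Section Properties.
Variable T : {linear V -> V}.
Hypothesis hT : shifted_inverse T.

Let hs := ell2_hilbert (graph_m_gt0 hG).

Lemma inverse_sym (x y : V) : ip (T x) y = ip x (T y).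
Proof.
have [dx ex] := hT x; have [dy ey] := hT y.
by rewrite (ipC hs) /ell2_ip -(ey _ dx) -(ex _ dy) -shiftedC.
Qed.

Lemma inverse_coercive (x : V) : nsq ip (T x) <= rip ip (T x) x.
Proof.
have [dx ex] := hT x; have := dom_coercive dx.
by rewrite nqE rshiftedE ex// => h; rewrite (ripC hs).
Qed.

Lemma inverse_pos (x : V) : 0 <= rip ip (T x) x.
Proof. exact: le_trans (nsq_ge0 hs (T x)) (inverse_coercive x). Qed.

Lemma inverse_le1 (x : V) : rip ip (T x) x <= 1 * nsq ip x.
Proof.
rewrite mul1r; have h1 := inverse_coercive x; have h2 := cauchy_schwarz hs (T x) x.
have h3 := inverse_pos x; have h4 := nsq_ge0 hs x.
have [->//|n0] := eqVneq (rip ip (T x) x) 0.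
have {}n0 : 0 < rip ip (T x) x by rewrite lt_neqAle eq_sym n0.
rewrite -(ler_pM2l n0) -expr2; apply: le_trans h2 _.
exact: ler_wpM2r.
Qed.

Definition delta (x0 : X) (x : X) : R[i] := (x == x0)%:R.

Lemma Cc_delta x0 : Cc (delta x0).
Proof.
by apply: (@seq_Cc _ _ _ [:: x0]) => x; rewrite inE /delta => /negbTE ->.
Qed.

Lemma inner_delta f x0 : inner m f (delta x0) = f x0 * (m x0)%:C%C.
Proof.
rewrite /inner /csum.
have E (p : R[i] -> R) : p 0 = 0 ->
    rsum (fun x => p (f x * (delta x0 x)^*%C * (m x)%:C%C)) = p (f x0 * (m x0)%:C%C).
  move=> p0; have [//|x xx0|_ ->] := @summ_rsum_seq R X
     (fun x => p (f x * (delta x0 x)^*%C * (m x)%:C%C)) [:: x0].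
    by move: xx0; rewrite inE /delta => /negbTE ->; rewrite conjc0 mulr0 mul0r.
  by rewrite big_seq1 /delta eqxx conjc1 mulr1.
rewrite (E (fun z => Re z))// (E (fun z => Im z))//.
by case: (_ * _).
Qed.

(** If [T x = 0] then [x] is orthogonal to the indicators of all vertices. *)
Lemma inverse_inj (x : V) : T x = 0 -> x = 0.
Proof.
move=> Tx; have [_ ex] := hT x; apply: ell2_space_eq; apply/funext => y.
have e := ex _ (Cc_dom hG halpha0 halpha1 C0 hC (Cc_delta y)).
have E : ell2_fun (0 : V) = (fun z => 0 * delta y z) by apply/funext => z; rewrite mul0r.
have fd := Cc_finite_energy q hG (Cc_delta y).
rewrite Tx E shiftedZl// mul0r inner_delta in e; move/esym/eqP: e.
rewrite mulf_eq0 => /orP[/eqP //|]; rewrite eq_complex/= eqxx andbT gt_eqF//.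
exact: (graph_m_gt0 hG).
Qed.

(** [H f = g] means that [f] solves the weak equation
    [(H + C + 1) f = g + (C + 1) f], which [T] inverts. *)
Lemma operatorP f g : magnetic_operator b theta q m f g <->
  exists F G : V, [/\ f = F, g = G & T (G + (C + 1)%:C%C *: F) = F].
Proof.
split=> [[df g4 Hf]|[F [G [-> -> TF]]]].
  have ff := dom_finite_energy df; have [f4 _ _ _] := ff.
  exists (Ell2 (graph_m_gt0 hG) f4), (Ell2 (graph_m_gt0 hG) g4); split => //.
  set F := Ell2 _ f4; set G := Ell2 _ g4.
  have [d1 e1] := hT (G + (C + 1)%:C%C *: F); apply: ell2_space_eq.
  apply: shifted_inj => // h dh; rewrite e1//.
  have [h4 _ _ _] := dom_finite_energy dh.
  rewrite /shifted -(polar_form_closure hG halpha0 halpha1 C0 hC)// Hf//.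
  transitivity (inner m (g + (fun x => (C + 1)%:C%C * f x)) h); first by [].
  by rewrite (innerDl w4)// ?(innerZl w4)//; exact: (ell2Z w4).
have [d1 e1] := hT (G + (C + 1)%:C%C *: F); rewrite TF in d1 e1.
split; [exact: d1|exact: ell2_funP|] => h dh.
rewrite (polar_form_closure hG halpha0 halpha1 C0 hC)//.
have := e1 h dh; rewrite /shifted.
have [h4 _ _ _] := dom_finite_energy dh.
have F4 := ell2_funP F; have G4 := ell2_funP G.
have -> : inner m (G + (C + 1)%:C%C *: F) h =
    inner m G h + (C + 1)%:C%C * inner m F h.
  transitivity (inner m ((G : X -> R[i]) + (fun x => (C + 1)%:C%C * F x)) h); first by [].
  by rewrite (innerDl w4)// ?(innerZl w4)//; exact: (ell2Z w4).
exact: addIr.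
Qed.

End Properties.

End ShiftedInverse.

(** * Sparseness and the degrees *)

Lemma seq_argmin (R : realType) (X : choiceType) (g : X -> R) (s : seq X) x0 : x0 \in s ->
  exists2 x, x \in s & forall y, y \in s -> g x <= g y.
Proof.
elim: s x0 => // y s IHs x0 _.
case: s IHs => [_|z s IHs]; first by exists y; rewrite ?mem_head// => z; rewrite inE => /eqP ->.
have [x xs xmin] := IHs z (mem_head _ _).
have [yx|xy] := leP (g y) (g x).
  exists y; first exact: mem_head.
  move=> w; rewrite inE => /orP[/eqP ->//|/xmin]; exact: le_trans.
exists x; first by rewrite inE xs orbT.
by move=> w; rewrite inE => /orP[/eqP ->|/xmin//]; exact: ltW.
Qed.

Section SparseInequality.
Variables (R : realType) (X : choiceType).
Variables (b theta : X -> X -> R) (q m : X -> R) (a k : R).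
Hypothesis hG : magnetic_graph b theta m.
Hypotheses (ha : 0 <= a) (hsparse : magnetic_sparse b theta q m a k).
Local Notation normc := Normc.normc.
Local Notation qp := (pot_pos q m).
Implicit Types (g : X -> R) (r : seq X) (tau : X -> R[i]).

Definition edge_sum (phi : X * X -> R) : R := rsum (fun p => b p.1 p.2 * phi p).

Definition finitely_supported g := exists r, forall x, x \notin r -> g x = 0.

Let b0 := graph_b0 hG.

(** A sufficient condition for summability against [b] that is easy to check for
    the functions of edges built from a finitely supported vertex function. *)
Definition dominated (phi : X * X -> R) := exists g, [/\ forall x, 0 <= g x,
  finitely_supported g & forall p, `|phi p| <= g p.1 + g p.2].

Lemma dominated_summ phi : dominated phi -> summ (fun p => b p.1 p.2 * phi p).
Proof.
move=> [g [g0 [r gr] h]].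
exact: (summ_pair (graph_b0 hG) (graph_bsym hG) (graph_bsum hG) g0 gr h).
Qed.

Lemma dominatedD phi psi : dominated phi -> dominated psi ->
  dominated (fun p => phi p + psi p).
Proof.
move=> [g [g0 [r gr] h]] [g' [g'0 [r' gr'] h']]; exists (fun x => g x + g' x); split.
- by move=> x; exact: addr_ge0.
- exists (r ++ r') => x; rewrite mem_cat negb_or => /andP[/gr -> /gr' ->].
  by rewrite addr0.
- move=> p; apply: le_trans (ler_normD _ _) _.
  by have := h p; have := h' p; lra.
Qed.

Lemma dominatedZ t phi : dominated phi -> dominated (fun p => t * phi p).
Proof.
move=> [g [g0 [r gr] h]]; exists (fun x => `|t| * g x); split.
- by move=> x; exact: mulr_ge0.
- by exists r => x /gr ->; rewrite mulr0.
- by move=> p; rewrite normrM -mulrDr ler_wpM2l.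
Qed.

Lemma edge_sumD phi psi : dominated phi -> dominated psi ->
  edge_sum (fun p => phi p + psi p) = edge_sum phi + edge_sum psi.
Proof.
move=> dphi dpsi; rewrite /edge_sum -rsumD; [|exact: dominated_summ|exact: dominated_summ].
by congr rsum; apply/funext => p; rewrite mulrDr.
Qed.

Lemma edge_sumZ t phi : dominated phi ->
  edge_sum (fun p => t * phi p) = t * edge_sum phi.
Proof.
move=> dphi; rewrite /edge_sum -rsumZ; last exact: dominated_summ.
by congr rsum; apply/funext => p; rewrite mulrCA.
Qed.

Lemma ler_edge_sum phi psi : dominated phi -> dominated psi ->
  (forall p, phi p <= psi p) -> edge_sum phi <= edge_sum psi.
Proof.
move=> dphi dpsi h; apply: ler_rsum; [exact: dominated_summ|exact: dominated_summ|].
by move=> p; rewrite ler_wpM2l.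
Qed.

Lemma edge_sum_ends g r : (forall x, 0 <= g x) -> uniq r ->
  (forall x, x \notin r -> g x = 0) ->
  edge_sum (fun p => g p.1 + g p.2) = 2 * \sum_(x <- r) wdeg b x * g x.
Proof.
move=> g0 ur gr; rewrite /edge_sum.
have [s1 r1] := rsum_pair1 (graph_b0 hG) (graph_bsum hG) ur gr.
have [s2 r2] := rsum_pair2 (graph_b0 hG) (graph_bsym hG) (graph_bsum hG) g0 ur gr.
rewrite (_ : (fun p => _) = fun p => b p.1 p.2 * g p.1 + b p.1 p.2 * g p.2).
  by rewrite rsumD// r1 r2; ring.
by apply/funext => p; rewrite mulrDr.
Qed.

(** For [0 <= g], this is the measure of the levels [t >= 0] for which both ends of
    the edge lie in [{g > t}]; [eabs g] is the measure of the levels which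
    separate the ends. *)
Definition emin g (p : X * X) : R := Num.min (g p.1) (g p.2).
Definition eabs g (p : X * X) : R := `|g p.1 - g p.2|.
Definition phase_defect tau (p : X * X) : R :=
  normc (tau p.1 - expi (theta p.1 p.2) * tau p.2).

Lemma dominated_ends g (c : R) phi : (forall x, 0 <= g x) -> finitely_supported g ->
  0 <= c -> (forall p, `|phi p| <= c * (g p.1 + g p.2)) -> dominated phi.
Proof.
move=> g0 [r gr] c0 h; exists (fun x => c * g x); split.
- by move=> x; exact: mulr_ge0.
- by exists r => x /gr ->; rewrite mulr0.
- by move=> p; rewrite -mulrDr.
Qed.

Lemma phase_defect_le2 tau p : (forall x, normc (tau x) = 1) -> phase_defect tau p <= 2.
Proof.
move=> t1; rewrite /phase_defect; apply: le_trans (le_normcD _ _) _.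
by rewrite normcN Normc.normcM normc_expi !t1 mul1r.
Qed.

Lemma emin_dominated g : (forall x, 0 <= g x) -> finitely_supported g -> dominated (emin g).
Proof.
move=> g0 fg; apply: (dominated_ends g0 fg ler01) => p; rewrite mul1r /emin.
have h1 := g0 p.1; have h2 := g0 p.2; rewrite ger0_norm ?le_min ?g0//.
by rewrite minElt; case: ifP => _; lra.
Qed.

Lemma eabs_dominated g : (forall x, 0 <= g x) -> finitely_supported g -> dominated (eabs g).
Proof.
move=> g0 fg; apply: (dominated_ends g0 fg ler01) => p; rewrite mul1r /eabs normr_id.
by apply: le_trans (ler_normB _ _) _; rewrite !ger0_norm.
Qed.

Lemma edefect_dominated g tau : (forall x, normc (tau x) = 1) ->
  (forall x, 0 <= g x) -> finitely_supported g ->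
  dominated (fun p => emin g p * phase_defect tau p).
Proof.
move=> t1 g0 fg; apply: (dominated_ends g0 fg (ler0n _ 2)) => p.
have h1 := g0 p.1; have h2 := g0 p.2.
have e0 : 0 <= emin g p by rewrite /emin le_min !g0.
have d0 : 0 <= phase_defect tau p by exact: normc_ge0.
rewrite ger0_norm ?mulr_ge0// mulrC; apply: ler_pM => //; first exact: phase_defect_le2.
by rewrite /emin minElt; case: ifP => _; lra.
Qed.

(** The sparseness inequality integrated over the superlevel sets of [g]. *)
Definition coarea_sparse tau g := edge_sum (emin g) <=
  (1 + a) / 2 * edge_sum (fun p => emin g p * phase_defect tau p) +
  a * (edge_sum (eabs g) / 2 + rsum (fun x => qp x * g x)) + k * rsum (fun x => m x * g x).

Definition ind r (x : X) : R := (x \in r)%:R.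

Lemma ind_ge0 r x : 0 <= ind r x. Proof. exact: ler0n. Qed.

Lemma ind_fs r : finitely_supported (ind r).
Proof. by exists r => x /negbTE xr; rewrite /ind xr. Qed.

Lemma mass_ind (S : choiceType) (u : S -> R) (A : set S) (v : S -> R) :
  (forall y, 0 <= u y) -> (forall y, A y -> v y = 1) -> (forall y, ~ A y -> v y = 0) ->
  summ (fun y => u y * v y) -> mass u A = (rsum (fun y => u y * v y))%:E.
Proof.
move=> u0 vA vnA su.
have uv0 y : 0 <= u y * v y.
  by have [Ay|/vnA ->] := pselect (A y); rewrite ?vA// ?mulr1 ?mulr0.
rewrite rsum_ge0E// -(esum_fin uv0 su) /mass esum_mkcond; apply: eq_esum => y _.
case: ifPn => [|]; rewrite ?inE; first by move=> /vA ->; rewrite mulr1.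
by rewrite notin_setE => /vnA ->; rewrite mulr0.
Qed.

(** This is the sparseness of the set, with [tau] as competitor in the
    frustration index. *)
Lemma coarea_sparse_ind tau r : (forall x, normc (tau x) = 1) -> coarea_sparse tau (ind r).
Proof.
move=> t1; rewrite /coarea_sparse; pose W := [set` r].
have finW : finite_set W by exact: finite_seq.
have sv (w : X -> R) : (forall x, 0 <= w x) -> summ (fun x => w x * ind r x).
  move=> w0; have [|//] := @summ_rsum_seq R X (fun x => w x * ind r x) (undup r) (undup_uniq r) _.
  by move=> x; rewrite mem_undup /ind => /negbTE ->; rewrite mulr0.
have := hsparse finW.
have b0' (p : X * X) : 0 <= b p.1 p.2 by [].
have i0 := @ind_ge0 r; have ifs := ind_fs r.
have dmin := emin_dominated i0 ifs; have dabs := eabs_dominated i0 ifs.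
have ddef := edefect_dominated t1 i0 ifs.
have indW x : W x -> ind r x = 1 by rewrite /W /ind /= => ->.
have indnW x : ~ W x -> ind r x = 0 by rewrite /W /ind /= => /negP/negbTE ->.
rewrite (@mass_ind _ _ _ (emin (ind r)) b0')//; last 3 first.
- by move=> [x y] [/= /indW h1 /indW h2]; rewrite /emin /= h1 h2 minxx.
- move=> [x y] /= /not_andP[/indnW h|/indnW h]; rewrite /emin /= h.
    by rewrite min_l// ind_ge0.
  by rewrite min_r// ind_ge0.
- exact: dominated_summ.
rewrite (@mass_ind _ _ _ (eabs (ind r)) b0')//; last 3 first.
- move=> [x y] [[/= /indW h1 /indnW h2]|[/= /indnW h1 /indW h2]]; rewrite /eabs /= h1 h2.
    by rewrite subr0 normr1.
  by rewrite sub0r normrN1.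
- move=> [x y] /= /not_orP[h1 h2]; rewrite /eabs /=.
  have [Wx|nWx] := pselect (W x); have [Wy|nWy] := pselect (W y).
  + by rewrite !indW// subrr normr0.
  + by exfalso; apply: h1.
  + by exfalso; apply: h2.
  + by rewrite !indnW// subrr normr0.
- exact: dominated_summ.
rewrite (mass_ind (v := ind r) (pot_pos_ge0 q hG))//; last exact: (sv _ (pot_pos_ge0 q hG)).
rewrite (mass_ind (v := ind r) (m_ge0 hG))//; last exact: (sv _ (m_ge0 hG)).
rewrite -?EFinM -?EFinD -?EFinM -?EFinD -?EFinM -?EFinD lee_fin -/(edge_sum _) -/(edge_sum _).
have fr : frustration b theta W <=
    edge_sum (fun p => emin (ind r) p * phase_defect tau p) / 2.
  pose F p := b p.1 p.2 * phase_defect tau p.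
  have F0 p : 0 <= F p by rewrite mulr_ge0// normc_ge0.
  have -> : edge_sum (fun p => emin (ind r) p * phase_defect tau p) / 2 =
      2^-1 * \sum_(p \in W `*` W) F p.
    rewrite mulrC; congr (_ * _); apply: EFin_inj.
    have finWW : finite_set (W `*` W) by exact: finite_setX.
    rewrite -fsumEFin// -esum_fset//; last by move=> p _; rewrite lee_fin.
    rewrite -/(mass F (W `*` W)) (@mass_ind _ F _ (emin (ind r)))//.
    + by congr EFin; congr rsum; apply/funext => p; rewrite /F; ring.
    + by move=> [x y] [/= /indW h1 /indW h2]; rewrite /emin /= h1 h2 minxx.
    + move=> [x y] /= /not_andP[/indnW h|/indnW h]; rewrite /emin /= h.
        by rewrite min_l// ind_ge0.
      by rewrite min_r// ind_ge0.
    + rewrite (_ : (fun y => _) = fun p => b p.1 p.2 * (emin (ind r) p * phase_defect tau p)).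
        exact: dominated_summ.
      by apply/funext => p; rewrite /F; ring.
  apply: ge_inf; last by exists tau.
  exists 0 => _ [t _ ->]; rewrite mulr_ge0 ?invr_ge0//; apply: fsumr_ge0 => p _.
  by rewrite mulr_ge0// normc_ge0.
have a1 : 0 <= 1 + a by have := ha; lra.
have := ler_wpM2l a1 fr; lra.
Qed.

Lemma rsum0 (S : choiceType) (u : S -> R) : (forall y, u y = 0) -> rsum u = 0.
Proof.
move=> u0; rewrite rsum_ge0E => [|y]; last by rewrite u0.
by rewrite esum1// => y _; rewrite u0.
Qed.

(** As [g] vanishes off [r], all terms are additive in this decomposition. *)
Lemma coarea_sparse_step tau r g (t : R) : (forall x, normc (tau x) = 1) ->
  0 <= t -> (forall x, 0 <= g x) -> (forall x, x \notin r -> g x = 0) ->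
  coarea_sparse tau g -> coarea_sparse tau (fun x => t * ind r x + g x).
Proof.
move=> t1 t0 g0 gr; have := coarea_sparse_ind r t1; rewrite /coarea_sparse.
set h := fun x => t * ind r x + g x.
have i0 := @ind_ge0 r; have ifs := ind_fs r.
have gfs : finitely_supported g by exists r.
have hE x : (x \in r /\ h x = t + g x /\ ind r x = 1) \/
            (x \notin r /\ h x = 0 /\ g x = 0 /\ ind r x = 0).
  rewrite /h /ind; case: (boolP (x \in r)) => xr; [left|right].
    by rewrite mulr1.
  by rewrite mulr0 add0r gr.
have minE p : emin h p = t * emin (ind r) p + emin g p.
  rewrite /emin; have := g0 p.1; have := g0 p.2.
  case: (hE p.1) => [[_ [-> ->]]|[_ [-> [-> ->]]]];
  case: (hE p.2) => [[_ [-> ->]]|[_ [-> [-> ->]]]] h1 h2.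
  - by rewrite -addr_minr minxx mulr1.
  - by rewrite (min_r h2) (min_r ler01) mulr0 add0r min_r// addr_ge0.
  - by rewrite (min_l h1) (min_l ler01) mulr0 add0r min_l// addr_ge0.
  - by rewrite !minxx mulr0 add0r.
have absE p : eabs h p = t * eabs (ind r) p + eabs g p.
  rewrite /eabs; have := g0 p.1; have := g0 p.2.
  case: (hE p.1) => [[_ [-> ->]]|[_ [-> [-> ->]]]];
  case: (hE p.2) => [[_ [-> ->]]|[_ [-> [-> ->]]]] h1 h2.
  - by rewrite opprD addrACA subrr add0r subrr normr0 mulr0 add0r.
  - by rewrite !subr0 normr1 mulr1 !ger0_norm// addr_ge0.
  - by rewrite !sub0r !normrN normr1 mulr1 !ger0_norm// addr_ge0.
  - by rewrite !subrr normr0 mulr0 add0r.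
have sv (w f : X -> R) : (forall x, x \notin r -> f x = 0) -> summ (fun x => w x * f x).
  move=> fr; have [|//] := @summ_rsum_seq R X (fun x => w x * f x) (undup r) (undup_uniq r) _.
  by move=> x; rewrite mem_undup => /fr ->; rewrite mulr0.
have ir x : x \notin r -> ind r x = 0 by move=> /negbTE xr; rewrite /ind xr.
have vE (w : X -> R) : rsum (fun x => w x * h x) =
    t * rsum (fun x => w x * ind r x) + rsum (fun x => w x * g x).
  rewrite -rsumZ; last exact: sv.
  rewrite -rsumD; [|by apply: summZ; exact: sv|exact: sv].
  by congr rsum; apply/funext => x; rewrite /h; ring.
have dmin := emin_dominated i0 ifs; have dabs := eabs_dominated i0 ifs.
have ddef := edefect_dominated t1 i0 ifs.
have dmin' := emin_dominated g0 gfs; have dabs' := eabs_dominated g0 gfs.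
have ddef' := edefect_dominated t1 g0 gfs.
have -> : edge_sum (emin h) = t * edge_sum (emin (ind r)) + edge_sum (emin g).
  rewrite -edge_sumZ// -edge_sumD//; last exact: dominatedZ.
  by congr edge_sum; apply/funext => p; rewrite minE.
have -> : edge_sum (eabs h) = t * edge_sum (eabs (ind r)) + edge_sum (eabs g).
  rewrite -edge_sumZ// -edge_sumD//; last exact: dominatedZ.
  by congr edge_sum; apply/funext => p; rewrite absE.
have -> : edge_sum (fun p => emin h p * phase_defect tau p) =
    t * edge_sum (fun p => emin (ind r) p * phase_defect tau p) +
    edge_sum (fun p => emin g p * phase_defect tau p).
  rewrite -edge_sumZ// -edge_sumD//; last exact: dominatedZ.
  by congr edge_sum; apply/funext => p; rewrite minE; ring.
rewrite !vE => h1 h2; have := ler_wpM2l t0 h1.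
move: (edge_sum _) (edge_sum _) (edge_sum _) h2 => A B D.
move: (edge_sum _) (edge_sum _) (edge_sum _) => A' B' D'.
move: (rsum _) (rsum _) (rsum _) (rsum _) => E E' F F'; lra.
Qed.

(** Discrete layer-cake decomposition: the smallest positive value is peeled
    off from [g], which shrinks its support. *)
Lemma coarea_sparse_all tau g : (forall x, normc (tau x) = 1) ->
  (forall x, 0 <= g x) -> finitely_supported g -> coarea_sparse tau g.
Proof.
move=> t1 g0 [r gr]; have [n] := ubnP (size r).
elim: n r g g0 gr => [r g g0 gr r0|n IH r g g0 gr].
  by exfalso; move: r0; rewrite ltn0.
rewrite ltnS => rn.
have [[x0 x0r gx0]|none] := pselect (exists2 x, x \in r & 0 < g x); last first.
  have gz x : g x = 0.
    case: (boolP (x \in r)) => [xr|/gr//]; apply/eqP; rewrite eq_le g0 andbT leNgt.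
    by apply/negP => gx; apply: none; exists x.
  have mz p : emin g p = 0 by rewrite /emin !gz minxx.
  rewrite /coarea_sparse /edge_sum !rsum0 ?mul0r ?mulr0 ?addr0 ?mulr0//.
  - by move=> x; rewrite gz mulr0.
  - by move=> x; rewrite gz mulr0.
  - by move=> p; rewrite /eabs !gz subrr normr0 mulr0.
  - by move=> p; rewrite mz mul0r mulr0.
  - by move=> p; rewrite mz mulr0.
pose s := [seq x <- r | 0 < g x].
have sP x : (x \in s) = (0 < g x).
  rewrite mem_filter; case: (boolP (0 < g x)) => //= gx.
  by apply: contraTT gx => /gr ->; rewrite ltxx.
have [x1 x1s x1min] : exists2 x, x \in s & forall y, y \in s -> g x <= g y.
  by apply: (@seq_argmin _ _ g s x0); rewrite sP.
pose g' x := g x - g x1 * ind s x.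
have g'0 x : 0 <= g' x.
  rewrite /g' /ind; case: (boolP (x \in s)) => xs; last by rewrite mulr0 subr0.
  by rewrite mulr1 subr_ge0 x1min.
pose s' := [seq x <- s | x != x1].
have g's x : x \notin s' -> g' x = 0.
  rewrite mem_filter negb_and negbK => /orP[/eqP ->|xs].
    by rewrite /g' /ind x1s mulr1 subrr.
  rewrite /g' /ind (negbTE xs) mulr0 subr0; apply/eqP.
  by rewrite eq_le g0 andbT leNgt -sP.
have s'n : (size s' < n)%N.
  apply: leq_trans rn; apply: leq_trans (_ : (size s <= size r)%N); last first.
    by rewrite size_filter count_size.
  rewrite size_filter -(count_predC (pred1 x1) s) -[X in (X < _)%N]add0n ltn_add2r.
  by rewrite -has_count has_pred1.
have -> : g = fun x => g x1 * ind s x + g' x.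
  by apply/funext => x; rewrite /g' addrC subrK.
have s'r x : x \notin s -> g' x = 0.
  by move=> xs; apply: g's; rewrite mem_filter negb_and xs orbT.
by apply: coarea_sparse_step => //; exact: IH g'0 g's s'n.
Qed.

(** Pointwise form of the coarea bound: [d^2 = (r-s)^2 + r s t^2], where [t]
    is the defect of the phases, and the factor [5/4 = 1 + 1/4] is the
    squared norm of the functional [p + v/2]. *)
Lemma modulus_phase_bound (y r s t d : R) : 0 <= y -> 0 <= r -> 0 <= s -> 0 <= t ->
  d ^+ 2 = (r - s) ^+ 2 + r * s * t ^+ 2 ->
  y * (Num.min (r ^+ 2) (s ^+ 2) * t + `|r ^+ 2 - s ^+ 2|) <=
  (r + s) ^+ 2 / 4 + 5 / 4 * y ^+ 2 * d ^+ 2.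
Proof.
move=> y0; wlog sr : r s / s <= r.
  move=> h r0 s0 t0 dE; have [sr|/ltW rs] := leP s r; first exact: h.
  rewrite minC distrC [r + s]addrC; apply: h => //; rewrite dE; ring.
move=> r0 s0 t0 dE.
have s2r2 : s ^+ 2 <= r ^+ 2 by rewrite ler_pXn2r ?nnegrE.
rewrite (min_r s2r2) ger0_norm ?subr_ge0// dE.
pose p := r - s; pose v := s * t.
have v2 : v ^+ 2 <= r * s * t ^+ 2.
  by rewrite /v exprMn ler_wpM2r ?sqr_ge0// expr2 ler_wpM2r.
have p0 : 0 <= p by rewrite subr_ge0.
have v0 : 0 <= v by rewrite mulr_ge0.
have h1 : s ^+ 2 * t + (r ^+ 2 - s ^+ 2) <= (r + s) * (p + v / 2).
  rewrite /p /v; have := mulr_ge0 p0 v0; rewrite /p /v; nra.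
apply: le_trans (ler_wpM2l y0 h1) _.
have h2 := sqr_ge0 ((r + s) / 2 - y * (p + v / 2)).
have h3 : (p + v / 2) ^+ 2 <= 5 / 4 * (p ^+ 2 + v ^+ 2).
  have := sqr_ge0 (p / 2 - v); lra.
have h4 := ler_wpM2l (sqr_ge0 y) h3.
have h5 := ler_wpM2l (sqr_ge0 y) v2.
rewrite -/p; nra.
Qed.

(** The value [1] at zeros of [f] keeps the phase on the unit circle everywhere. *)
Definition phase (f : X -> R[i]) (x : X) : R[i] :=
  if f x == 0 then 1 else f x * (normc (f x))^-1%:C%C.

Lemma normc_real (t : R) : 0 <= t -> normc t%:C%C = t.
Proof. by move=> t0; rewrite /= expr0n addr0 sqrtr_sqr ger0_norm. Qed.

Lemma normc_phase f x : normc (phase f x) = 1.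
Proof.
rewrite /phase; case: eqVneq => [_|fx]; first exact: Normc.normc1.
have n0 : normc (f x) != 0 by apply: contra fx => /eqP/Normc.eq0_normc ->.
by rewrite Normc.normcM normc_real ?invr_ge0 ?normc_ge0// divff.
Qed.

Lemma phaseE f x : f x = (normc (f x))%:C%C * phase f x.
Proof.
rewrite /phase; case: eqVneq => [->|fx]; first by rewrite Normc.normc0 mul0r.
have n0 : normc (f x) != 0 by apply: contra fx => /eqP/Normc.eq0_normc ->.
by rewrite mulrCA -rmorphM/= divff// mulr1.
Qed.

(** The law of cosines. *)
Lemma edge_diff_phase f p : normc (edge_diff theta f p) ^+ 2 =
  (normc (f p.1) - normc (f p.2)) ^+ 2 +
  normc (f p.1) * normc (f p.2) * phase_defect (phase f) p ^+ 2.
Proof.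
rewrite /edge_diff {1}(phaseE f p.1) {1}(phaseE f p.2) /phase_defect.
set r := normc (f p.1); set s := normc (f p.2).
rewrite mulrCA; set e := expi _.
have : normc (phase f p.1) ^+ 2 = 1 by rewrite normc_phase expr1n.
have : normc (e * phase f p.2) ^+ 2 = 1.
  by rewrite Normc.normcM normc_expi normc_phase mul1r expr1n.
move: (phase f p.1) (e * phase f p.2) => [c d] [c' d']; rewrite !normc2E /= => h1 h2.
apply/eqP; rewrite -subr_eq0; apply/eqP.
transitivity ((r ^+ 2 - r * s) * (c ^+ 2 + d ^+ 2 - 1) +
   (s ^+ 2 - r * s) * (c' ^+ 2 + d' ^+ 2 - 1)); first by ring.
by rewrite h1 h2 subrr !mulr0 addr0.
Qed.

Definition degree_energy (f : X -> R[i]) : R := rsum (fun x => wdeg b x * normc (f x) ^+ 2).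

(** The degree energy splits into [edge_sum (emin g)], which is bounded by
    [coarea_sparse], and half of [edge_sum (eabs g)]. With [y = 1 + a], the
    coefficients of the phase defect and of [eabs g] that result are both
    [y / 2], and [modulus_phase_bound] absorbs half of the degree energy. *)
Lemma sparse_form_bound f : Cc f ->
  degree_energy f + nq qp f <=
  5 / 2 * (1 + a) ^+ 2 * (nq (edge_weight b) (edge_diff theta f) + nq qp f) + 2 * k * nq m f.
Proof.
move=> Cf; have [r ur fr] := Cc_seq Cf.
pose g x := normc (f x) ^+ 2.
have g0 x : 0 <= g x by exact: sqr_ge0.
have gr x : x \notin r -> g x = 0 by move=> /fr fx; rewrite /g fx Normc.normc0 expr0n.
have gfs : finitely_supported g by exists r.
have t1 := normc_phase f.
have coarea := coarea_sparse_all t1 g0 gfs.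
have dmin := emin_dominated g0 gfs; have dabs := eabs_dominated g0 gfs.
have ddef := edefect_dominated t1 g0 gfs.
have dsum : dominated (fun p => g p.1 + g p.2).
  exists g; split => // p; by rewrite ger0_norm// addr_ge0.
pose dd p := normc (edge_diff theta f p) ^+ 2.
have ddd : dominated dd.
  apply: (dominated_ends g0 gfs (ler0n _ 2)) => p; rewrite ger0_norm ?sqr_ge0//.
  have := normc2D_le (f p.1) (- (expi (theta p.1 p.2) * f p.2)).
  by rewrite normcN Normc.normcM normc_expi mul1r -/(edge_diff theta f p) mulrDr.
have GE : edge_sum (fun p => g p.1 + g p.2) = 2 * degree_energy f.
  rewrite (edge_sum_ends g0 ur gr) /degree_energy; congr (_ * _).
  have [|_ ->//] := @summ_rsum_seq R X (fun x => wdeg b x * normc (f x) ^+ 2) r ur.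
  by move=> x /gr; rewrite /g => ->; rewrite mulr0.
have GE' : degree_energy f = edge_sum (emin g) + edge_sum (eabs g) / 2.
  have : 2 * degree_energy f = 2 * edge_sum (emin g) + edge_sum (eabs g).
    rewrite -GE -edge_sumZ// -edge_sumD//; last exact: dominatedZ.
    congr edge_sum; apply/funext => p; rewrite /emin /eabs.
    by case: (leP (g p.1) (g p.2)) => h;
      [rewrite ler0_norm ?subr_le0|rewrite gtr0_norm ?subr_gt0]; rewrite //; lra.
  by lra.
have EE : nq (edge_weight b) (edge_diff theta f) = edge_sum dd / 2.
  rewrite mulrC -edge_sumZ// /edge_sum /nq; congr rsum; apply/funext => p.
  by rewrite /sqw /edge_weight /dd; ring.
have PE (w : X -> R) : rsum (fun x => w x * g x) = nq w f.
  by rewrite /nq; congr rsum; apply/funext => x; rewrite /sqw mulrC.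
pose y := 1 + a; have y1 : 1 <= y by rewrite lerDl.
have y0 : 0 <= y by exact: le_trans y1.
have ptw : y * (edge_sum (fun p => emin g p * phase_defect (phase f) p) + edge_sum (eabs g)) <=
    degree_energy f + 5 / 4 * y ^+ 2 * edge_sum dd.
  have -> : degree_energy f = 2^-1 * edge_sum (fun p => g p.1 + g p.2).
    by rewrite GE; field.
  rewrite -edge_sumD// -!edge_sumZ//; last exact: dominatedD.
  rewrite -edge_sumD; [|exact: dominatedZ|exact: dominatedZ].
  apply: ler_edge_sum.
  - by apply: dominatedZ; exact: dominatedD.
  - by apply: dominatedD; exact: dominatedZ.
  - move=> p; have nn x := normc_ge0 (f x).
    apply: le_trans (modulus_phase_bound y0 (nn p.1) (nn p.2) _ (edge_diff_phase f p)) _.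
      exact: normc_ge0.
    rewrite lerD2r /g; have := sqr_ge0 (normc (f p.1) - normc (f p.2)); lra.
move: coarea; rewrite /coarea_sparse !PE EE GE' in ptw *; rewrite -/y => coarea.
have P0 := nq_ge0 (pot_pos_ge0 q hG) f.
(* The coefficient of [nq qp f] is [1 + 2 a = 2 y - 1 <= 5 / 2 y^2]. *)
have yP : y * nq qp f <= nq qp f / 2 + 5 / 4 * y ^+ 2 * nq qp f.
  have h : y <= 1 / 2 + 5 / 4 * y ^+ 2 by have := sqr_ge0 (y * 5 / 2 - 1); lra.
  by have := ler_wpM2r P0 h; lra.
have aE : a = y - 1 by rewrite /y addrC addKr.
move: coarea ptw yP; rewrite aE.
move: (edge_sum _) (edge_sum _) (edge_sum _) (edge_sum _) => A B D' E'.
move: (nq _ _) (nq _ _) => P M; lra.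
Qed.

End SparseInequality.

(** * Lower bound of the form by the degrees *)

Section LowerBound.
Variables (R : realType) (X : choiceType).
Variables (b theta : X -> X -> R) (q m : X -> R) (alpha a k C : R).
Hypothesis hG : magnetic_graph b theta m.
Hypotheses (halpha0 : 0 < alpha) (halpha1 : alpha < 1).
Hypotheses (ha : 0 <= a) (hsparse : magnetic_sparse b theta q m a k).
Hypothesis C0 : 0 <= C.
Local Notation normc := Normc.normc.
Local Notation D := (edge_diff theta).
Local Notation bw := (edge_weight b).
Local Notation qp := (pot_pos q m).
Local Notation qn := (pot_neg q m).
Local Notation rform := (rform b theta q m).
Local Notation Q := (Qform b theta q m).
Hypothesis hC : forall f, Cc f ->
  nq qn f <= alpha * (nq bw (D f) + nq qp f) + C * nq m f.
Local Notation dom := (closure_dom m Q).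

Definition sparse_constant : R := 2 * (1 - alpha) / (5 * (1 + a) ^+ 2 - alpha).

(** [form_lower_bound] is [G] times [sparse_form_bound] plus [1 - G] times the
    relative bound on the negative part, [G] being [sparse_constant]; this is
    the multiple of the squared norm that the two leave behind. *)
Definition sparse_shift : R := sparse_constant * (2 * k) + (1 - sparse_constant) * C.

Let den_gt0 : 0 < 5 * (1 + a) ^+ 2 - alpha.
Proof.
have h := halpha1; have h2 := ha; have : 1 <= (1 + a) ^+ 2 by apply: exprn_ege1; rewrite lerDl.
lra.
Qed.

Lemma sparse_constant_gt0 : 0 < sparse_constant.
Proof. by rewrite divr_gt0// mulr_gt0// subr_gt0. Qed.

Lemma sparse_constant_le1 : sparse_constant <= 1.
Proof.
rewrite ler_pdivrMr// mul1r; have h0 := halpha0.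
have : 1 <= (1 + a) ^+ 2 by apply: exprn_ege1; rewrite lerDl.
lra.
Qed.

Lemma sparse_constantE : sparse_constant * (5 * (1 + a) ^+ 2 - alpha) = 2 * (1 - alpha).
Proof. by rewrite /sparse_constant mulfVK// gt_eqF. Qed.

Lemma form_lower_bound f : Cc f ->
  rsum (fun x => (sparse_constant * Deg b q m x - sparse_shift) * sqw m f x) <= rform f f.
Proof.
move=> Cf; have [r ur fr] := Cc_seq Cf.
have f0 x : x \notin r -> normc (f x) ^+ 2 = 0.
  by move=> /fr ->; rewrite Normc.normc0 expr0n.
have E (w : X -> R) : rsum (fun x => w x * normc (f x) ^+ 2) = \sum_(x <- r) w x * normc (f x) ^+ 2.
  have [|_ ->//] := @summ_rsum_seq R X (fun x => w x * normc (f x) ^+ 2) r ur.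
  by move=> x /f0 ->; rewrite mulr0.
have nE (w : X -> R) : nq w f = \sum_(x <- r) w x * normc (f x) ^+ 2.
  by rewrite -E /nq; congr rsum; apply/funext => x; rewrite /sqw mulrC.
have -> : rsum (fun x => (sparse_constant * Deg b q m x - sparse_shift) * sqw m f x) =
    sparse_constant * (degree_energy b f + nq qp f - nq qn f) - sparse_shift * nq m f.
  rewrite /degree_energy E !nE -big_split -sumrB !mulr_sumr -sumrB /=.
  rewrite (_ : (fun x => _) = fun x =>
     (sparse_constant * Deg b q m x - sparse_shift) * m x * normc (f x) ^+ 2).
    rewrite E; apply: eq_bigr => x _; rewrite /Deg -(wdegE (graph_b0 hG)) /pot_pos /pot_neg.
    have -> : q x = q^\+ x - q^\- x.
      by rewrite /funrpos /funrneg; case: (leP (q x) 0) => h;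
        [rewrite max_l|rewrite max_r]; lra.
    by field; rewrite gt_eqF// (graph_m_gt0 hG).
  by apply/funext => x; rewrite /sqw; ring.
have h1 := sparse_form_bound hG ha hsparse Cf; have h2 := hC Cf.
rewrite rformE -!nqE /sparse_shift.
have M0 := nq_ge0 (m_ge0 hG) f; have S0 : 0 <= nq bw (D f) + nq qp f.
  by rewrite addr_ge0// nq_ge0//; [exact: edge_weight_ge0 hG|exact: pot_pos_ge0 hG].
have g0 := sparse_constant_gt0; have g1 := sparse_constant_le1.
have gE := sparse_constantE; have al0 := halpha0.
have h3 := ler_wpM2l (ltW g0) h1.
have g1' : 0 <= 1 - sparse_constant by rewrite subr_ge0.
have h4 := ler_wpM2l g1' h2.
(* The value of the constant makes the total coefficient of the form at most
   one. *)
have coef : 0 <= 1 - (1 - sparse_constant) * alpha - sparse_constant * (5 / 2 * (1 + a) ^+ 2).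
  have := mulr_gt0 g0 al0; move: gE; rewrite mulrBr; lra.
have h5 := mulr_ge0 coef S0.
move: h3 h4 h5; move: sparse_constant (degree_energy b f) (nq _ _) (nq _ _) (nq _ _) (nq _ _).
move=> G DE E' P N M; move: ((1 + a) ^+ 2) => y; lra.
Qed.

(** The finitely many vertices at which the degree is too small are paid for by the
    values of the function there, which survive the passage to the closure. *)
Lemma form_ge_off_finite (K : seq X) (M : R) : uniq K ->
  (forall x, x \notin K -> M <= sparse_constant * Deg b q m x - sparse_shift) ->
  exists2 B, 0 <= B & forall f, dom f ->
    M * nq m f <= rform f f + B * \sum_(x <- K) normc (f x) ^+ 2.
Proof.
move=> uK hK; pose c x := (M - (sparse_constant * Deg b q m x - sparse_shift)) * m x.
pose B := \sum_(x <- K) `|c x|.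
have B0 : 0 <= B by exact: sumr_ge0.
have cB x : x \in K -> c x <= B.
  move=> xK; apply: le_trans (ler_norm _) _.
  by rewrite /B (big_rem x)//= lerDl sumr_ge0.
exists B => //.
have onCc f : Cc f -> M * nq m f <= rform f f + B * \sum_(x <- K) normc (f x) ^+ 2.
  move=> Cf; have [r ur fr] := Cc_seq Cf; have h := form_lower_bound Cf.
  apply: le_trans (_ : rsum (fun x => c x * normc (f x) ^+ 2) + rform f f <= _).
    apply: le_trans (lerD (lexx _) h); rewrite /nq.
    have f0 x : x \notin r -> normc (f x) ^+ 2 = 0.
      by move=> /fr ->; rewrite Normc.normc0 expr0n.
    have E (w : X -> R) : rsum (fun x => w x * normc (f x) ^+ 2) =
        \sum_(x <- r) w x * normc (f x) ^+ 2.
      have [|_ ->//] := @summ_rsum_seq R X (fun x => w x * normc (f x) ^+ 2) r ur.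
      by move=> x /f0 ->; rewrite mulr0.
    rewrite (_ : sqw m f = fun x => m x * normc (f x) ^+ 2); last first.
      by apply/funext => x; rewrite /sqw mulrC.
    rewrite (_ : (fun x => _ * (m x * _)) = fun x =>
      ((sparse_constant * Deg b q m x - sparse_shift) * m x) * normc (f x) ^+ 2); last first.
      by apply/funext => x; rewrite mulrA.
    rewrite !E -big_split mulr_sumr /=; apply: ler_sum => x _; rewrite /c.
    by rewrite le_eqVlt; apply/orP; left; apply/eqP; ring.
  rewrite addrC lerD2l mulr_sumr; pose v x := (if x \in K then B else 0) * normc (f x) ^+ 2.
  have [|sv rv] := @summ_rsum_seq R X v K uK.
    by move=> x /negbTE xK; rewrite /v xK mul0r.
  have [|sc _] := @summ_rsum_seq R X (fun x => c x * normc (f x) ^+ 2) r ur.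
    by move=> x /fr ->; rewrite Normc.normc0 expr0n mulr0.
  apply: le_trans (_ : rsum v <= _).
    apply: ler_rsum => // x; rewrite /v; apply: ler_wpM2r; first exact: sqr_ge0.
    case: ifPn => [/cB//|/hK h']; rewrite /c pmulr_lle0 ?(graph_m_gt0 hG)//.
    by rewrite subr_le0.
  rewrite rv !big_seq; apply: ler_sum => x xK; by rewrite /v xK.
move=> f /(dom_approx hG halpha0 halpha1 C0 hC)[u uf]; have [Cu _ _] := uf.
have pw := strong_approx_pointwise hG uf.
apply: (@ler_lim_seq _ (fun n => M * nq m (u n))
  (fun n => rform (u n) (u n) + B * \sum_(x <- K) normc (u n x) ^+ 2)).
- by apply: cvgMl_tmp; exact: strong_approx_nq_cvg uf.
- apply: cvgD; first exact: strong_approx_form2_cvg uf.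
  apply: cvgMl_tmp; elim: K {uK hK B B0 cB onCc} => [|x K IH].
    by under eq_fun do rewrite big_nil; rewrite big_nil; exact: cvg_cst.
  rewrite big_cons; have -> : (fun n => \sum_(y <- x :: K) normc (u n y) ^+ 2) =
      (fun n => normc (u n x) ^+ 2) \+ (fun n => \sum_(y <- K) normc (u n y) ^+ 2).
    by apply/funext => n; rewrite big_cons.
  by apply: cvgD; [exact: normc_sqr_cvg (pw x)|exact: IH].
- by move=> n; exact: onCc.
Qed.

End LowerBound.

(** * Infinite sets, vertex enumerations and dimensions *)

(** Dependent choice in which each term may depend on all previous ones and must
    differ from them. *)
Lemma fresh_sequence (X : choiceType) (P : seq X -> X -> Prop) :
  (forall s, exists2 x, x \notin s & P s x) ->
  exists x : nat -> X, injective x /\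
    forall n, exists2 s, (forall y, y \in s <-> exists2 i, (i < n)%N & y = x i) & P s (x n).
Proof.
move=> ex; have ex' s : exists x, x \notin s /\ P s x by have [x ? ?] := ex s; exists x.
have [F hF] := choice ex'.
pose L n := iter n (fun s => rcons s (F s)) [::].
pose x n := F (L n).
have Lx n y : y \in L n <-> exists2 i, (i < n)%N & y = x i.
  elim: n => [|n IH]; first by split=> // -[].
  rewrite /= mem_rcons inE; split=> [/orP[/eqP ->|/IH[i ni ->]]|[j]].
  - by exists n.
  - by exists i => //; rewrite ltnS ltnW.
  - rewrite ltnS leq_eqVlt => /orP[/eqP -> ->|nj yj]; first by rewrite eqxx.
    by apply/orP; right; apply/IH; exists j.
exists x; split=> [i j xij|n]; last by exists (L n); [exact: Lx|exact: (hF _).2].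
have fresh i' j' : (i' < j')%N -> x i' <> x j'.
  move=> ij e; have := (hF (L j')).1; rewrite -/(x j') -e => /negP; apply.
  by apply/Lx; exists i'.
case: (ltngtP i j) => [ij|ji|ij]; [|by case: (fresh _ _ ji)|by []].
by case: (fresh _ _ ij).
Qed.

Lemma infinite_injection (X : choiceType) (A : set X) : infinite_set A ->
  exists2 x : nat -> X, injective x & forall n, A (x n).
Proof.
move=> infA; have [|x [xi hx]] := @fresh_sequence X (fun _ y => A y).
  move=> s; have [y [Ay ys]] := infinite_setN0 (infinite_setD infA (finite_seq s)).
  by exists y => //; apply/negP.
by exists x => // n; have [] := hx n.
Qed.

Lemma injection_infinite (X : choiceType) (A : set X) (x : nat -> X) :
  injective x -> (forall n, A (x n)) -> infinite_set A.
Proof.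
move=> xi xA finA; apply: infinite_nat.
have : finite_set (x @` [set: nat]).
  by apply: sub_finite_set finA => _ [n _ <-].
by rewrite (eq_finite_set (inj_card_eq _))// => i j _ _; exact: xi.
Qed.

Section VertexDegrees.
Variables (R : realType) (X : choiceType) (b : X -> X -> R) (q m : X -> R).
Local Notation Deg := (Deg b q m).

(** The finite sets [K] in the supremum can be taken to be sublevel sets. *)
Lemma Dinfty_sublevelP :
  Dinfty b q m = +oo%E <-> forall M : R, finite_set [set x | Deg x <= M].
Proof.
split=> [Doo M|fin].
  have : (M%:E < Dinfty b q m)%E by rewrite Doo ltry.
  move=> /ereal_sup_gt[_ [K finK <-] hM]; apply: sub_finite_set finK => x /= xM.
  apply: contrapT => Kx; have : (ereal_inf [set (Deg x)%:E | x in ~` K] <= (Deg x)%:E)%E.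
    by apply: ereal_inf_lbound; exists x.
  by move=> /(lt_le_trans hM); rewrite lte_fin ltNge xM.
have large (M : R) : (M%:E <= Dinfty b q m)%E.
  apply: (@le_trans _ _ (ereal_inf [set (Deg x)%:E | x in ~` [set x | Deg x <= M]])); last first.
    by apply: ereal_sup_ubound; exists [set x | Deg x <= M]; first exact: fin.
  apply: le_ereal_inf_tmp => _ [x /= /negP xM <-].
  by rewrite lee_fin ltW// ltNge.
case: (Dinfty b q m) large => [r /(_ (r + 1))|//|/(_ 0)] //.
by rewrite lee_fin gerDl ler10.
Qed.

(** Always choose a vertex of least degree among those left: it exists, and every
    vertex is eventually chosen, because sublevel sets are finite. *)
Lemma vertex_enumeration_exists : infinite_set [set: X] ->
  (forall M : R, finite_set [set x | Deg x <= M]) -> exists x, vertex_enumeration b q m x.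
Proof.
move=> infX fin.
have [|x [xi hx]] := @fresh_sequence X (fun s x => forall y, y \notin s -> Deg x <= Deg y).
  move=> s; have [y0 [_ y0s]] := infinite_setN0 (infinite_setD infX (finite_seq s)).
  have [r ur rE] : exists2 r : seq X, uniq r & forall y, y \in r = (Deg y <= Deg y0) && (y \notin s).
    exists [seq y <- finmap.enum_fset (fset_set [set x | Deg x <= Deg y0]) | y \notin s].
      by rewrite filter_uniq// finmap.fset_uniq.
    move=> y; rewrite mem_filter andbC; congr (_ && _).
    by rewrite in_fset_set//; apply/idP/idP; rewrite ?inE.
  have y0r : y0 \in r by rewrite rE lexx; apply/negP.
  have [x xr xmin] := seq_argmin Deg y0r; exists x.
    by move: xr; rewrite rE => /andP[].
  move=> y ys; have [yy0|/ltW y0y] := leP (Deg y) (Deg y0).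
    by apply: xmin; rewrite rE yy0.
  exact: le_trans (xmin _ y0r) y0y.
have xmono n : Deg (x n) <= Deg (x n.+1).
  have [s sE] := hx n; apply; apply/negP => /sE[i ni /xi e].
  by move: ni; rewrite -e ltnNge leqnSn.
exists x; split=> //.
have surj y : exists n, x n = y.
  apply: contrapT => /forallNP ny.
  have low n : Deg (x n) <= Deg y.
    have [s sE] := hx n; apply; apply/negP => /sE[i _ yi]; exact: (ny i).
  exact: (@injection_infinite _ [set x | Deg x <= Deg y] x xi low (fin (Deg y))).
have [g gx] := choice surj.
by exists g => n; [apply: xi; rewrite gx|rewrite gx].
Qed.

(** Otherwise all vertices would lie in one sublevel set. *)
Lemma vertex_enumeration_unbounded x : infinite_set [set: X] ->
  (forall M : R, finite_set [set x | Deg x <= M]) -> vertex_enumeration b q m x ->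
  forall M, exists N, forall n, (N <= n)%N -> M < Deg (x n).
Proof.
move=> infX fin [[g xg gx] xmono] M.
have mono : {homo (fun n => Deg (x n)) : n k / (n <= k)%N >-> n <= k}.
  exact/nondecreasing_seqP.
apply: contrapT => /forallNP h; apply: infX; apply: sub_finite_set (fin M) => y _ /=.
rewrite -(gx y); have /existsNP[n /not_implyP[gn /negP]] := h (g y).
by rewrite -leNgt; apply: le_trans; exact: mono.
Qed.

End VertexDegrees.

Section Dimensions.
Variables (R : realType) (X : choiceType).
Implicit Types (E : set (X -> R[i])).

Lemma has_dim_basis_mem E d (v : 'I_d -> X -> R[i]) :
  (forall f, E f <-> exists c : 'I_d -> R[i], f = fun x => \sum_i c i * v i x) ->
  forall j, E (v j).
Proof.
move=> hE j; apply/hE; exists (fun i => (i == j)%:R); apply/funext => x.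
rewrite (bigD1 j)//= eqxx mul1r big1 ?addr0// => i /negbTE ->.
by rewrite mul0r.
Qed.

(** The matrix of coordinates has more rows than columns. *)
Lemma has_dim_dependent E d (w : 'I_d.+1 -> X -> R[i]) : has_dim E d ->
  (forall i, E (w i)) -> exists2 c : 'rV[R[i]]_d.+1, c != 0 &
    forall x, \sum_i c 0 i * w i x = 0.
Proof.
move=> [v [hE _]] Ew.
have /choice[A hA] : forall i, exists c : 'I_d -> R[i], w i = fun x => \sum_j c j * v j x.
  by move=> i; exact/hE.
have [c c0 cA] := exists_left_kernel (\matrix_(i, j) A i j).
exists c => // x; under eq_bigr do rewrite hA mulr_sumr.
rewrite exchange_big big1//= => j _.
transitivity ((c *m \matrix_(i, j) A i j) 0 j * v j x); last by rewrite cA mxE mul0r.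
by rewrite mxE mulr_suml; apply: eq_bigr => i _; rewrite mxE mulrA.
Qed.

Lemma has_dim_unique E d d' : has_dim E d -> has_dim E d' -> d = d'.
Proof.
wlog dd' : d d' / (d < d')%N.
  by move=> h hd hd'; case: (ltngtP d d') => [dd'|d'd|dd']; [exact: h|apply/esym; exact: h|by []].
move=> hd [v [hE free]]; exfalso.
have [c c0 hc] := has_dim_dependent hd (fun i => has_dim_basis_mem hE (widen_ord dd' i)).
pose c' (i : 'I_d') := if insub (i : nat) is Some j then c 0 j else 0 : R[i].
move/eqP: c0; apply; apply/rowP => i; rewrite mxE.
have := free c' _ (widen_ord dd' i); rewrite /c' /= valK; apply => x.
rewrite -[RHS](hc x) (bigID (fun j : 'I_d' => (j < d.+1)%N))/= [X in _ + X]big1 ?addr0; last first.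
  by move=> j /negbTE jd; rewrite insubF// mul0r.
rewrite (big_ord_narrow dd'); apply: eq_bigr => j _ /=.
by rewrite valK.
Qed.

End Dimensions.

(** * The magnetic operator through its inverse *)

Section Operator.
Variables (R : realType) (X : choiceType).
Variables (b theta : X -> X -> R) (q m : X -> R) (alpha C : R).
Hypothesis hG : magnetic_graph b theta m.
Hypotheses (halpha0 : 0 < alpha) (halpha1 : alpha < 1) (C0 : 0 <= C).
Local Notation normc := Normc.normc.
Local Notation D := (edge_diff theta).
Local Notation bw := (edge_weight b).
Local Notation qp := (pot_pos q m).
Local Notation qn := (pot_neg q m).
Local Notation rform := (rform b theta q m).
Local Notation Q := (Qform b theta q m).
Hypothesis hC : forall f, Cc f ->
  nq qn f <= alpha * (nq bw (D f) + nq qp f) + C * nq m f.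
Local Notation dom := (closure_dom m Q).
Local Notation V := (ell2_space (graph_m_gt0 hG)).
Local Notation ip := (@ell2_ip R X m (graph_m_gt0 hG)).
Local Notation rip := (rip ip).
Local Notation nsq := (nsq ip).
Local Notation H := (magnetic_operator b theta q m).
Local Notation Deg := (Deg b q m).
Local Notation c1 := (C + 1).
Local Notation hs := (ell2_hilbert (graph_m_gt0 hG)).

Variable T : {linear V -> V}.
Hypothesis hT : shifted_inverse q C T.

Let Tsym := inverse_sym hT.
Let opP := operatorP halpha0 halpha1 C0 hC hT.

Lemma ell2_delta (x : X) : ell2 m (delta R x).
Proof. by have [] := Cc_finite_energy q hG (Cc_delta R x). Qed.

Definition deltaV (x : X) : V := Ell2 (graph_m_gt0 hG) (ell2_delta x).

Lemma ip_deltaV (f : V) x : ip f (deltaV x) = f x * (m x)%:C%C.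
Proof. exact: inner_delta. Qed.

Lemma operator_eqP (f g : V) (z : R[i]) :
  H f (fun x => g x + z * f x) <-> T (g + (z + c1%:C%C) *: f) = f.
Proof.
have E : g + z *: f + c1%:C%C *: f = g + (z + c1%:C%C) *: f.
  by rewrite scalerDl addrA.
split=> [/opP[F [G [fF gG TF]]]|Tf]; last first.
  by apply/opP; exists f, (g + z *: f); rewrite E.
have {}fF : f = F by exact: ell2_space_eq.
have GE : G = g + z *: f by apply: ell2_space_eq; rewrite -gG.
by rewrite -fF GE E in TF.
Qed.

Lemma operator_lift f g : H f g -> exists F G : V, f = F /\ g = G.
Proof. by move=> /opP[F [G [? ? _]]]; exists F, G. Qed.

Lemma operator_lift_shift (g : V) f z : H f (fun x => g x + z * f x) ->
  exists2 F : V, f = F & T (g + (z + c1%:C%C) *: F) = F.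
Proof.
move=> Hf; have [F [_ [fF _]]] := operator_lift Hf; exists F => //.
by apply/operator_eqP; rewrite -fF.
Qed.

Lemma eigenspace_lift f z : eigenspace_of H z f ->
  exists2 F : V, f = F & (z + c1%:C%C) *: T F = F.
Proof.
move=> Hf; have [|F fF TF] := @operator_lift_shift 0 f z.
  move: Hf; rewrite /eigenspace_of /=; congr H; apply/funext => x.
  by rewrite add0r.
by exists F => //; rewrite -linearZ/= -{2}TF add0r.
Qed.

Lemma eigenspaceP (F : V) z : eigenspace_of H z F <-> (z + c1%:C%C) *: T F = F.
Proof.
split=> [/eigenspace_lift[G FG TG]|TF]; first by rewrite (ell2_space_eq FG).
have : H F (fun x => (0 : V) x + z * F x).
  by apply/operator_eqP; rewrite add0r linearZ.
by congr H; apply/funext => x; rewrite add0r.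
Qed.

Lemma inverse_form (x : V) : rip (T x) x = rform (T x) (T x) + c1 * nsq (T x).
Proof.
have [dx ex] := hT x.
have -> : rip (T x) x = rshifted b theta q m C (T x) (T x).
  by rewrite rshiftedE (ex _ dx) (ripC hs).
by [].
Qed.

(** The real and the imaginary part of a value of [T x] are real inner products of
    [x] with fixed vectors. *)
Lemma rip_delta_pair (x : V) y :
  rip x ((m y)^-1%:C%C *: T (deltaV y)) = Re (T x y) /\
  rip x (('i%C * (m y)^-1%:C%C) *: T (deltaV y)) = Im (T x y).
Proof.
have my0 : m y != 0 by rewrite gt_eqF// (graph_m_gt0 hG).
have ripE (f g : V) : rip f g = Re (ip f g) by [].
rewrite !ripE !(ipZr hs) conjcM !conjc_real -Tsym ip_deltaV.
have -> : (m y)^-1%:C%C * (T x y * (m y)%:C%C) = T x y.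
  by rewrite mulrCA -rmorphM/= mulVf// mulr1.
rewrite -mulrA; have -> : (m y)^-1%:C%C * (T x y * (m y)%:C%C) = T x y.
  by rewrite mulrCA -rmorphM/= mulVf// mulr1.
by split=> //; case: (ell2_fun (T x) y) => a d /=; ring.
Qed.

(** If the form of [H] exceeds a large multiple of the squared norm up to the values
    on a finite set, then so does [<T x, x>] in terms of [T x]; Young's
    inequality turns this into smallness of [<T x, x>] in terms of [x]. *)
Lemma inverse_quasi_compact :
  (forall M, exists (K : seq X) (B : R), 0 <= B /\ forall f, dom f ->
    M * nq m f <= rform f f + B * \sum_(x <- K) normc (f x) ^+ 2) ->
  quasi_compact ip T.
Proof.
move=> large e e0; have [K [B [B0 hB]]] := large (e^-1 - c1).
pose v1 y := (m y)^-1%:C%C *: T (deltaV y).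
pose v2 y := ('i%C * (m y)^-1%:C%C) *: T (deltaV y).
exists (map v1 K ++ map v2 K), B; split => // x.
rewrite big_cat !big_map /= -big_split /=.
rewrite (_ : \sum_(y <- K) _ = \sum_(y <- K) normc (T x y) ^+ 2); last first.
  apply: eq_bigr => y _; have [E1 E2] := rip_delta_pair x y.
  by rewrite normc2E -E1 -E2.
have [dx _] := hT x; have := hB _ dx; have := inverse_form x.
have := young hs (T x) x (t := e^-1) _; rewrite invr_gt0 invrK => /(_ e0).
have -> : nq m (T x) = nsq (T x) by rewrite nqE.
move: (nsq _) (nsq _) (rip _ _) (rform _ _) (\sum_(y <- K) _) => n1 n2 t F S; lra.
Qed.

(** From [(H - z) F = g] with [z + C + 1 = 1 / t], the vector
    [g / t + F / t^2] solves [(t - T) x = g]. *)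
Lemma resolvent_bounded_inverse (t : R) : 0 < t ->
  resolvent_set m H ((t^-1 - c1)%:C%C) -> bounded_inverse ip T t.
Proof.
move=> t0 [surj [C' hC']]; pose z : R[i] := (t^-1 - c1)%:C%C.
have zc : z + c1%:C%C = t^-1%:C%C by rewrite /z -rmorphD/= subrK.
have ex (g : V) : exists F : V, T (g + t^-1%:C%C *: F) = F /\ nsq F <= C' * nsq g.
  have [f [Hf _]] := surj _ (ell2_funP g).
  have [F fF TF] := operator_lift_shift Hf; exists F; split; first by rewrite -zc.
  by have := hC' _ _ Hf; rewrite fF !ell2_nsqE -EFinM lee_fin.
have [F hF] := choice ex.
pose G (g : V) := t^-1%:C%C *: g + (t^-2)%:C%C *: F g.
exists G, (2 * t^-2 + 2 * (t^-2) ^+ 2 * C') => g; have [TF NF] := hF g; split.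
  have tt : t%:C%C * t^-1%:C%C = 1 :> R[i] by rewrite -rmorphM/= mulfV ?gt_eqF.
  have tt2 : t%:C%C * (t^-2)%:C%C = t^-1%:C%C :> R[i].
    by rewrite -rmorphM/=; congr (_%:C)%C; field; rewrite gt_eqF.
  have t2 : (t^-2)%:C%C = t^-1%:C%C * t^-1%:C%C :> R[i].
    by rewrite -rmorphM/= -expr2 exprVn.
  rewrite /G scalerDr !scalerA tt tt2 scale1r.
  have -> : T (t^-1%:C%C *: g + (t^-2)%:C%C *: F g) = t^-1%:C%C *: F g.
    rewrite -[in RHS]TF t2 -scalerA -scalerDr linearZ/=.
    by [].
  by rewrite addrK.
apply: le_trans (nsqD_le hs _ _) _; rewrite !(nsqZ hs) exprVn.
have t20 : 0 <= (t^-2) ^+ 2 by exact: sqr_ge0.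
by have := ler_wpM2l t20 NF; lra.
Qed.

(** The map [t |-> 1 / t - (C + 1)] carries the positive spectrum of [T] into the
    spectrum of [H]. *)
Lemma purely_discrete_inverse : purely_discrete_spectrum m H ->
  discrete_positive_spectrum ip T.
Proof.
move=> pd t t0; pose z : R[i] := (t^-1 - c1)%:C%C.
have [res|spec] := pselect (resolvent_set m H z).
  by left; exact: resolvent_bounded_inverse.
right; have [[e e0 he] [d d0 hd]] := pd z spec; split.
  (* [|1 / t' - 1 / t| = |t - t'| / (t t') < e], as [t' > t / 2]. *)
  exists (Num.min (t / 2) (e * t ^+ 2 / 2)).
    by rewrite lt_min !divr_gt0// mulr_gt0// exprn_gt0.
  move=> t' t'0 tt'; rewrite lt_min => /andP[h1 h2].
  apply: resolvent_bounded_inverse => //; apply: contrapT => spec'.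
  have th : t / 2 < t' by move: h1; rewrite ltr_norml => /andP[]; lra.
  have := he _ spec'; rewrite /z -rmorphB/= => h.
  have : normc ((t'^-1 - c1 - (t^-1 - c1))%:C%C) < e.
    rewrite /= expr0n addr0 sqrtr_sqr.
    have -> : t'^-1 - c1 - (t^-1 - c1) = (t - t') / (t * t').
      by field; rewrite !gt_eqF.
    rewrite normrM [X in _ * X]ger0_norm ?invr_ge0 ?mulr_ge0 ?ltW//.
    rewrite ltr_pdivrMr ?mulr_gt0// distrC; apply: lt_le_trans h2 _.
    by have := mulr_gt0 e0 t0; nra.
  move=> /h /eqP; rewrite eq_complex /= eqxx andbT => /eqP /addIr /invr_inj /eqP.
  by rewrite (negbTE tt').
move=> [v ov Tv].
have vE i : eigenspace_of H z (v i).
  apply/eigenspaceP; rewrite /z -rmorphD/= subrK Tv scalerA -rmorphM/= mulVf ?gt_eqF//.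
  by rewrite scale1r.
have [c c0 hc] := has_dim_dependent hd (fun i : 'I_d.+1 => vE i).
move/eqP: c0; apply; apply/rowP => i; rewrite mxE.
pose c' j := if insub j is Some j' then c 0 j' else 0 : R[i].
have c'E (j : 'I_d.+1) : c' j = c 0 j by rewrite /c' valK.
have := ip_comb hs ov c' d.+1 i; rewrite ltn_ord c'E => <-.
have -> : comb v c' d.+1 = 0; last by rewrite (ip0l hs).
apply: ell2_space_eq; apply/funext => x; rewrite -[RHS](hc x).
have sumE (r : seq 'I_d.+1) : ell2_fun (\sum_(j <- r) c' j *: v j) x = \sum_(j <- r) c 0 j * v j x.
  elim: r => [|j r IH]; first by rewrite !big_nil.
  by rewrite !big_cons -IH -c'E.
exact: sumE.
Qed.

Lemma rform_delta x : rform (delta R x) (delta R x) = Deg x * m x.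
Proof.
have [_ _ b00 _ _] := hG.
have mx := graph_m_gt0 hG x.
have d1 : normc (1 : R[i]) = 1 by exact: Normc.normc1.
have nd y : normc (delta R x y) ^+ 2 = (y == x)%:R.
  by rewrite /delta; case: (y == x); rewrite ?d1 ?Normc.normc0 ?expr1n ?expr0n.
rewrite rformE -!nqE.
have nE (w : X -> R) : nq w (delta R x) = w x.
  rewrite /nq (_ : sqw _ _ = fun y => w x * (y == x)%:R).
    by rewrite rsumZ ?rsum_pred1 ?mulr1//; exact: summ_pred1.
  apply/funext => y; rewrite /sqw nd.
  by case: eqVneq => [->|_]; rewrite ?mulr1 ?mul1r// mulr0 mul0r.
rewrite !nE.
have -> : nq bw (D (delta R x)) = wdeg b x.
  pose g y : R := (y == x)%:R.
  have g0 y : 0 <= g y by rewrite ler0n.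
  have gx y : y \notin [:: x] -> g y = 0 by rewrite inE /g => /negbTE ->.
  have [s1 r1] := rsum_pair1 (graph_b0 hG) (graph_bsum hG) (isT : uniq [:: x]) gx.
  have [s2 r2] := rsum_pair2 (graph_b0 hG) (graph_bsym hG) (graph_bsum hG) g0 (isT : uniq [:: x]) gx.
  rewrite /nq (_ : sqw _ _ = fun p => 2^-1 * (b p.1 p.2 * g p.1 + b p.1 p.2 * g p.2)).
    rewrite rsumZ; last exact: summD.
    by rewrite rsumD// r1 r2 !big_seq1 /g eqxx mulr1; field.
  apply/funext => -[y y']; rewrite /sqw /edge_weight /edge_diff /g /=.
  have [->|yx] := eqVneq y x; have [->|y'x] := eqVneq y' x.
  - by rewrite b00 !mulr0 !mul0r addr0 mulr0.
  - rewrite /delta eqxx (negbTE y'x) mulr0 subr0 d1 expr1n /=; ring.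
  - rewrite /delta eqxx (negbTE yx) mulr1 sub0r normcN normc_expi expr1n /=; ring.
  - by rewrite /delta (negbTE yx) (negbTE y'x) mulr0 subr0 Normc.normc0 expr0n /=; ring.
rewrite /Defs.Deg -(wdegE (graph_b0 hG)) /pot_pos /pot_neg.
have -> : q x = q^\+ x - q^\- x.
  by rewrite /funrpos /funrneg; case: (leP (q x) 0) => h;
    [rewrite max_l|rewrite max_r]; lra.
by field; rewrite gt_eqF.
Qed.

End Operator.

(** * Uniqueness of eigenvalue enumerations *)

Lemma card_eq_seq (r : seq nat) : uniq r -> ([set n | n \in r] #= `I_(size r))%card.
Proof.
move=> ur.
have -> : [set n | n \in r] = nth 0%N r @` `I_(size r).
  apply/seteqP; split=> [n nr|_ [i ir <-]]; last exact: mem_nth.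
  by exists (index n r); rewrite /= ?index_mem ?nth_index.
apply: inj_card_eq => i j; rewrite !inE /= => ir jr.
by apply: (uniqP 0%N ur).
Qed.

Lemma card_eq_injection (A B : set nat) : (A #= B)%card ->
  exists f : nat -> nat, {in A &, injective f} /\ forall n, A n -> B (f n).
Proof.
move=> /pcard_eqP[f]; exists f; have [fS fI _] := 'bij_f; split=> //.
Qed.

Section EnumerationUnique.
Variables (R : realType) (X : choiceType).
Variable H : (X -> R[i]) -> (X -> R[i]) -> Prop.

(** Both sequences take each value equally often, so there is an injection [f] of
    the indices with [mu (f k) = lambda k]. If [lambda n < mu n], it would map
    the first [n + 1] indices into the first [n]. *)
Lemma eigenvalue_enumeration_le (lambda mu : nat -> R) :
  eigenvalue_enumeration H lambda -> eigenvalue_enumeration H mu ->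
  forall n, mu n <= lambda n.
Proof.
move=> [lmono ldim] [mmono mdim] n; rewrite leNgt; apply/negP => lt_n.
have card_z z : ([set k | (lambda k)%:C%C = z] #= [set k | (mu k)%:C%C = z])%card.
  have [d dE /card_eq_trans] := ldim z; apply; rewrite card_eq_sym.
  by have [d' d'E] := mdim z; rewrite (has_dim_unique dE d'E).
have [phi hphi] := choice (fun z => card_eq_injection (card_z z)).
pose f k := phi (lambda k)%:C%C k.
have muf k : mu (f k) = lambda k.
  have [_ h] := hphi (lambda k)%:C%C.
  by have := h k erefl; case.
have injf : injective f.
  move=> j k fjk; have ljk : lambda j = lambda k by rewrite -!muf fjk.
  have [inj _] := hphi (lambda j)%:C%C; apply: inj; rewrite ?inE//=.
    by rewrite ljk.
  by move: fjk; rewrite /f ljk.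
have flt (k : 'I_n.+1) : (f k < n)%N.
  rewrite ltnNge; apply/negP => /mmono; rewrite muf leNgt => /negP; apply.
  by apply: le_lt_trans lt_n; apply: lmono; rewrite -ltnS.
have inj' : injective (fun k : 'I_n.+1 => Ordinal (flt k)).
  by move=> j k [] /injf /val_inj.
by have := leq_card _ inj'; rewrite !card_ord ltnn.
Qed.

End EnumerationUnique.

Section EigenvectorExpansion.
Variables (R : realType) (V : lmodType R[i]) (ip : V -> V -> R[i]).
Hypothesis hs : hilbert_space ip.
Variables (T : {linear V -> V}) (M : R).
Hypothesis Tsym : forall x y, ip (T x) y = ip x (T y).
Hypothesis Tpos : forall x, 0 <= rip ip (T x) x.
Hypothesis M_gt0 : 0 < M.
Hypothesis TM : forall x, rip ip (T x) x <= M * nsq ip x.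
Hypothesis Tinj : forall x, T x = 0 -> x = 0.
Variables (v : nat -> V) (s : nat -> R).
Hypothesis hv : spectral_sequence ip T v s.
Hypothesis s0 : s n @[n --> \oo] --> (0 : R).

Lemma ip_sum_orthonormal (c : nat -> R[i]) (r : seq nat) j : uniq r ->
  ip (\sum_(n <- r) c n *: v n) (v j) = if j \in r then c j else 0.
Proof.
have [ov _ _ _] := hv; rewrite (ip_suml hs) => ur.
under eq_bigr do rewrite (ipZl hs) ov.
case: ifPn => jr; last first.
  rewrite big_seq big1// => n nr; case: eqVneq => [nj|_]; last by rewrite mulr0.
  by move: jr; rewrite -nj nr.
rewrite (bigD1_seq j)//= eqxx mulr1 big1 ?addr0// => n /negbTE ->.
by rewrite mulr0.
Qed.

(** Only the coefficients for which [s n] is the right eigenvalue survive, and a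
    vector without coefficients is zero. *)
Lemma eigenvector_expansion (z : R[i]) (r : seq nat) (f : V) : uniq r ->
  (forall n, z * (s n)%:C%C = 1 -> n \in r) -> z *: T f = f ->
  f = \sum_(n <- r) ip f (v n) *: v n.
Proof.
move=> ur hr Tf; apply/eqP; rewrite -subr_eq0; apply/eqP.
apply: (spectral_complete hs Tsym Tpos M_gt0 TM Tinj hv s0) => j.
rewrite (ipBl hs) ip_sum_orthonormal//; case: ifPn => jr; first by rewrite subrr.
rewrite subr0; apply/eqP; apply: contraNT jr => fj; apply: hr.
have := congr1 (fun x => ip x (v j)) Tf; rewrite (ipZl hs) (ip_T_spectral hs Tsym hv) mulrA.
move=> /eqP; rewrite -subr_eq0 -{2}[ip f _]mul1r -mulrBl mulf_eq0.
by rewrite (negbTE fj) orbF subr_eq0 => /eqP.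
Qed.

Lemma spectral_values_large (B : R) : exists N, forall n, (N <= n)%N -> B < (s n)^-1.
Proof.
have [_ _ sp _] := hv.
have e0 : 0 < (`|B| + 1)^-1 by rewrite invr_gt0; have := normr_ge0 B; lra.
have /cvgrPdist_lt /(_ _ e0) [N _ hN] := s0; exists N => n Nn.
have := hN n Nn; rewrite /= sub0r normrN (ger0_norm (ltW (sp n))) => h.
apply: (@lt_le_trans _ _ (`|B| + 1)); first by have := ler_norm B; lra.
by rewrite -[X in X <= _]invrK lef_pV2 ?posrE ?sp// ltW.
Qed.

End EigenvectorExpansion.

(** * Spectrum of the magnetic operator *)

Section SpectralResolution.
Variables (R : realType) (X : choiceType).
Variables (b theta : X -> X -> R) (q m : X -> R) (alpha C : R).
Hypothesis hG : magnetic_graph b theta m.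
Hypotheses (halpha0 : 0 < alpha) (halpha1 : alpha < 1) (C0 : 0 <= C).
Local Notation normc := Normc.normc.
Local Notation D := (edge_diff theta).
Local Notation bw := (edge_weight b).
Local Notation qp := (pot_pos q m).
Local Notation qn := (pot_neg q m).
Local Notation Q := (Qform b theta q m).
Hypothesis hC : forall f, Cc f ->
  nq qn f <= alpha * (nq bw (D f) + nq qp f) + C * nq m f.
Local Notation V := (ell2_space (graph_m_gt0 hG)).
Local Notation ip := (@ell2_ip R X m (graph_m_gt0 hG)).
Local Notation H := (magnetic_operator b theta q m).
Local Notation c1 := (C + 1).
Local Notation hs := (ell2_hilbert (graph_m_gt0 hG)).

Variable T : {linear V -> V}.
Hypothesis hT : shifted_inverse q C T.

Let Tsym := inverse_sym hT.
Let Tpos := inverse_pos halpha0 halpha1 C0 hC hT.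
Let Tle := inverse_le1 halpha0 halpha1 C0 hC hT.
Let Tinj := inverse_inj halpha0 halpha1 C0 hC hT.
Variables (v : nat -> V) (s : nat -> R).
Hypothesis hv : spectral_sequence ip T v s.
Hypothesis s0 : s n @[n --> \oo] --> (0 : R).

(** The eigenvalue of [H] that corresponds to the eigenvalue [s n] of its shifted
    inverse. *)
Definition inverse_eigenvalue (n : nat) : R := (s n)^-1 - c1.
Local Notation mu := inverse_eigenvalue.

Let sp n : 0 < s n.
Proof. by have [] := hv. Qed.

Lemma inverse_eigenvalueP n z :
  (mu n)%:C%C = z <-> (z + c1%:C%C) * (s n)%:C%C = 1.
Proof.
have sn : (s n)^-1%:C%C * (s n)%:C%C = 1 :> R[i].
  by rewrite -rmorphM/= mulVf// gt_eqF.
have snz : (s n)%:C%C != 0 :> R[i] by rewrite eq_complex /= eqxx andbT gt_eqF.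
split=> [<-|E]; first by rewrite -rmorphD/= subrK.
have : z + c1%:C%C = (s n)^-1%:C%C by apply: (mulIf snz); rewrite E.
by move=> zE; rewrite /mu rmorphB/= -zE addrK.
Qed.

Lemma inverse_eigenvalue_mono : {homo mu : n k / (n <= k)%N >-> n <= k}.
Proof.
move=> n k nk; rewrite lerD2r lef_pV2 ?posrE//.
exact: (spectral_noninc hs hv).
Qed.

Lemma inverse_eigenvalue_large (B : R) : exists N, forall n, (N <= n)%N -> B < mu n.
Proof.
have [N hN] := spectral_values_large hv s0 (B + c1); exists N => n /hN.
by rewrite ltrBrDr.
Qed.

(** Multiplicities are finite because the eigenvalues tend to infinity. *)
Lemma eigenvalue_indices (z : R[i]) : exists2 r : seq nat,
  uniq r & forall n, n \in r <-> (mu n)%:C%C = z.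
Proof.
have [N hN] := inverse_eigenvalue_large (Re z).
exists [seq n <- iota 0 N | (mu n)%:C%C == z]; first by rewrite filter_uniq ?iota_uniq.
move=> n; rewrite mem_filter mem_iota /= add0n; split=> [/andP[/eqP//]|E].
rewrite E eqxx /= ltnNge; apply/negP => /hN; rewrite -E /=.
by rewrite ltxx.
Qed.

Lemma eigenspace_dim (z : R[i]) (r : seq nat) : uniq r ->
  (forall n, n \in r <-> (mu n)%:C%C = z) -> has_dim (eigenspace_of H z) (size r).
Proof.
move=> ur hr; have [ov Tv _ _] := hv.
have valE (c : 'I_(size r) -> R[i]) x :
    \sum_i c i * v (nth 0%N r i) x = (\sum_i c i *: v (nth 0%N r i) : V) x.
  have sumE (t : seq 'I_(size r)) :
      ell2_fun (\sum_(j <- t) c j *: v (nth 0%N r j)) x =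
      \sum_(j <- t) c j * v (nth 0%N r j) x.
    elim: t => [|j t IH]; first by rewrite !big_nil.
    by rewrite !big_cons -IH.
  by rewrite sumE.
exists (fun i => ell2_fun (v (nth 0%N r i))); split=> [f|c c0' i].
  split=> [Hf|[c fE]].
    have [F fF TF] := eigenspace_lift halpha0 halpha1 C0 hC hT Hf.
    exists (fun i => ip F (v (nth 0%N r i))); apply/funext => x.
    rewrite valE fF; congr (ell2_fun _ x).
    rewrite [LHS](eigenvector_expansion hs Tsym Tpos ltr01 Tle Tinj hv s0 ur _ TF).
      by rewrite (big_nth 0%N) big_mkord.
    by move=> n /inverse_eigenvalueP /hr.
  have -> : f = ell2_fun (\sum_i c i *: v (nth 0%N r i)).
    by rewrite fE; apply/funext => x; rewrite valE.
  apply/(eigenspaceP halpha0 halpha1 C0 hC hT); rewrite linear_sum scaler_sumr.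
  apply: eq_bigr => i _; rewrite linearZ/= Tv scalerA scalerA.
  have /hr/inverse_eigenvalueP E : nth 0%N r i \in r by rewrite mem_nth.
  by rewrite mulrAC E mul1r.
have F0 : \sum_i c i *: v (nth 0%N r i) = 0.
  by apply: ell2_space_eq; apply/funext => x; rewrite -valE c0'.
have := congr1 (fun F => ip F (v (nth 0%N r i))) F0.
rewrite (ip0l hs) (ip_suml hs) (bigD1 i)//= (ipZl hs) ov eqxx mulr1.
rewrite big1 ?addr0// => j ji; rewrite (ipZl hs) ov nth_uniq//.
by rewrite (inj_eq val_inj) (negbTE ji) mulr0.
Qed.

Lemma inverse_eigenvalue_enumeration : eigenvalue_enumeration H mu.
Proof.
split=> [|z]; first exact: inverse_eigenvalue_mono.
have [r ur hr] := eigenvalue_indices z; exists (size r).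
  exact: eigenspace_dim.
rewrite -(_ : [set n | n \in r] = [set n | (mu n)%:C%C = z]); first exact: card_eq_seq.
by apply/seteqP; split=> n /= /hr.
Qed.

(** Away from the eigenvalues, [resolvent_exists] solves the equation
    [(1 - (z + C + 1) T) f = T g] with a bound. *)
Lemma spectrum_eigenvalue z : spectrum m H z -> exists n, (mu n)%:C%C = z.
Proof.
move=> spec; apply: contrapT => none; apply: spec.
have nz n : 1 - (z + c1%:C%C) * (s n)%:C%C != 0.
  by rewrite subr_eq0 eq_sym; apply/negP => /eqP/inverse_eigenvalueP E; apply: none; exists n.
have [B hB] := resolvent_exists hs Tsym Tpos ltr01 Tle Tinj hv s0 nz.
have TE (g f : V) : T (g + (z + c1%:C%C) *: f) = f <-> f - (z + c1%:C%C) *: T f = T g.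
  rewrite linearD/= linearZ/=.
  by split=> [E|<-]; rewrite ?subrK// -[X in X - _]E addrK.
have uniqF (g f f' : V) : T (g + (z + c1%:C%C) *: f) = f ->
    T (g + (z + c1%:C%C) *: f') = f' -> f = f'.
  move=> /TE E /TE E'; apply/eqP; rewrite -subr_eq0; apply/eqP.
  apply: (resolvent_unique hs Tsym Tpos ltr01 Tle Tinj hv s0 nz).
  by rewrite linearB/= scalerBr opprB [_ *: _ - _]addrC addrACA E [- f' + _]addrC -opprB E' subrr.
split=> [g lg|].
  pose G : V := Ell2 (graph_m_gt0 hG) lg.
  have [F [/TE TF _]] := hB G; exists (ell2_fun F); split.
    exact/(@operator_eqP _ _ _ _ _ _ _ _ hG halpha0 halpha1 C0 hC _ hT F G z).
  move=> f Hf; have [F' -> TF'] := @operator_lift_shift _ _ _ _ _ _ _ _ hG halpha0 halpha1 C0 hC _ hT G f z Hf.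
  by rewrite (uniqF _ _ _ TF TF').
exists B => f g Hf.
have lg : ell2 m g.
  have [[lf _] l _] := Hf.
  have -> : g = (fun x => g x + z * f x) - (fun x => z * f x).
    by apply/funext => x; rewrite [RHS]addrK.
  by apply: (ell2B (m_ge0 hG) l); exact: (ell2Z (m_ge0 hG)).
pose G : V := Ell2 (graph_m_gt0 hG) lg.
have [F' fF' TF'] := @operator_lift_shift _ _ _ _ _ _ _ _ hG halpha0 halpha1 C0 hC _ hT G f z Hf.
have [F [/TE TF NF]] := hB G; rewrite fF' (uniqF _ _ _ TF' TF).
by rewrite -[g]/(ell2_fun G) !ell2_nsqE -EFinM lee_fin.
Qed.

Lemma eigenvalue_isolated z N : exists2 e : R, 0 < e &
  forall n, (n < N)%N -> Normc.normc ((mu n)%:C%C - z) < e -> (mu n)%:C%C = z.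
Proof.
elim: N => [|N [e e0 he]]; first by exists 1.
have [E|E] := eqVneq (mu N)%:C%C z.
  exists e => // n; rewrite ltnS leq_eqVlt => /orP[/eqP ->//|]; exact: he.
have d0 : 0 < normc ((mu N)%:C%C - z).
  rewrite lt_neqAle normc_ge0 andbT eq_sym; apply: contraNneq E => /Normc.eq0_normc.
  by move=> /eqP; rewrite subr_eq0.
exists (Num.min e (normc ((mu N)%:C%C - z))); first by rewrite lt_min e0.
move=> n nN; rewrite lt_min => /andP[ne nd]; move: nN.
rewrite ltnS leq_eqVlt => /orP[/eqP nE|nN]; last exact: he.
by move: nd; rewrite nE ltxx.
Qed.

(** Only finitely many eigenvalues lie near a given point. *)
Lemma purely_discrete : purely_discrete_spectrum m H.
Proof.
move=> z /spectrum_eigenvalue[n0 n0z]; split; last first.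
  have [r ur hr] := eigenvalue_indices z; exists (size r); last exact: eigenspace_dim.
  by case: r {ur} hr => // /(_ n0)[_ /(_ n0z)].
have [N hN] := inverse_eigenvalue_large (Re z + 1).
have [e e0 he] := eigenvalue_isolated z N.
exists (Num.min e 1) => [|w]; first by rewrite lt_min e0 ltr01.
move=> /spectrum_eigenvalue[n <-]; rewrite lt_min => /andP[ne n1].
have [nN|nN] := ltnP n N; first exact: he.
have := hN n nN; rewrite -n0z /= => big.
exfalso; move: n1; rewrite -n0z -rmorphB/= expr0n addr0 sqrtr_sqr ltr_norml => /andP[_]; lra.
Qed.

End SpectralResolution.

(** * Degrees and eigenvalues *)

Section DegreesAndSpectrum.
Variables (R : realType) (X : choiceType).
Variables (b theta : X -> X -> R) (q m : X -> R) (alpha C : R).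
Hypothesis hG : magnetic_graph b theta m.
Hypotheses (halpha0 : 0 < alpha) (halpha1 : alpha < 1) (C0 : 0 <= C).
Local Notation D := (edge_diff theta).
Local Notation bw := (edge_weight b).
Local Notation qp := (pot_pos q m).
Local Notation qn := (pot_neg q m).
Local Notation rform := (rform b theta q m).
Local Notation Q := (Qform b theta q m).
Hypothesis hC : forall f, Cc f ->
  nq qn f <= alpha * (nq bw (D f) + nq qp f) + C * nq m f.
Local Notation dom := (closure_dom m Q).
Local Notation V := (ell2_space (graph_m_gt0 hG)).
Local Notation ip := (@ell2_ip R X m (graph_m_gt0 hG)).
Local Notation rip := (rip ip).
Local Notation nsq := (nsq ip).
Local Notation Deg := (Deg b q m).
Local Notation c1 := (C + 1).
Local Notation hs := (ell2_hilbert (graph_m_gt0 hG)).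

Variable T : {linear V -> V}.
Hypothesis hT : shifted_inverse q C T.

Let Tsym := inverse_sym hT.
Let domd x : dom (delta R x).
Proof. exact: (Cc_dom hG halpha0 halpha1 C0 hC (Cc_delta R x)). Qed.

(** Positivity of the shifted form at [L T d - d], where [d] is the indicator of
    [x] and [L = Deg x + C + 1]: the three terms of the square are
    [L^2 <T d, d>], [- 2 L m x] and [L m x]. *)
Lemma inverse_delta_ge x : m x / (Deg x + c1) <= rip (T (deltaV q hG x)) (deltaV q hG x)
  /\ 0 < Deg x + c1.
Proof.
have mx := graph_m_gt0 hG x.
have [dT eT] := hT (deltaV q hG x).
have fT := dom_finite_energy hG halpha0 halpha1 C0 hC dT.
have fd := Cc_finite_energy q hG (Cc_delta R x).
have nd : nq m (delta R x) = m x.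
  rewrite nqE -[rinner _ _ _]/(Re (inner m (delta R x) (delta R x))) inner_delta.
  by rewrite /delta eqxx mul1r.
have Sdd : rshifted b theta q m C (delta R x) (delta R x) = (Deg x + c1) * m x.
  by rewrite /rshifted (rform_delta q hG) -nqE nd [RHS]mulrDl.
have L0 : 0 < Deg x + c1.
  have := dom_coercive hG halpha0 halpha1 C0 hC (domd x); rewrite Sdd nd; nra.
split=> //; set L := Deg x + c1 in Sdd L0 *.
set t := rip _ _.
have STd : rshifted b theta q m C (T (deltaV q hG x)) (delta R x) = m x.
  by rewrite rshiftedE (eT _ (domd x)) -nd nqE.
have STT : rshifted b theta q m C (T (deltaV q hG x)) (T (deltaV q hG x)) = t.
  by rewrite rshiftedE (eT _ dT) /t (ripC hs).
pose F : X -> R[i] := fun y => (- L)%:C%C * T (deltaV q hG x) y.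
have dF : dom F by exact: (domZ hG halpha0 halpha1 C0 hC).
have fF := finite_energyZ hG (- L)%:C%C fT.
have := dom_coercive hG halpha0 halpha1 C0 hC (domD hG halpha0 halpha1 C0 hC dF (domd x)).
rewrite (rshifted_sqrD hG C fF fd) Sdd.
rewrite (rshiftedZl hG C (- L) fT fd) STd.
rewrite (rshiftedZl hG C (- L) fT fF) (rshiftedC b theta q m C _ F).
rewrite (rshiftedZl hG C (- L) fT fT) STT.
have := nq_ge0 (m_ge0 hG) (F + delta R x).
rewrite ler_pdivrMr// => h1 h2; rewrite -(ler_pM2l L0); nra.
Qed.

Definition normalized_delta x : V := (Num.sqrt (m x))^-1%:C%C *: deltaV q hG x.

Lemma normalized_delta_orthonormal (x : nat -> X) : injective x ->
  orthonormal_seq ip (fun n => normalized_delta (x n)).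
Proof.
move=> xi j k; rewrite /normalized_delta (ipZl hs) (ipZr hs) conjc_real ip_deltaV.
rewrite /= /delta (inj_eq xi); case: eqVneq => [->|_]; last by rewrite mul0r !mulr0.
have mx := graph_m_gt0 hG (x j).
rewrite mul1r -!rmorphM/= [X in X%:C%C](_ : _ = 1)//.
have r0 : Num.sqrt (m (x j)) != 0 by rewrite gt_eqF// sqrtr_gt0.
have E := sqr_sqrtr (ltW mx).
by move: r0 E; move: (Num.sqrt _) => r r0 <-; field.
Qed.

Lemma inverse_normalized_delta_ge x :
  (Deg x + c1)^-1 <= rip (T (normalized_delta x)) (normalized_delta x).
Proof.
have mx := graph_m_gt0 hG x; have [h _] := inverse_delta_ge x.
rewrite /normalized_delta linearZ/= (ripZl hs) (ripZr hs) mulrA.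
rewrite (_ : (Num.sqrt (m x))^-1 * (Num.sqrt (m x))^-1 = (m x)^-1).
  by rewrite -(ler_pM2l mx) [leRHS]mulrA mulfV ?gt_eqF// mul1r.
by rewrite -invfM -expr2 sqr_sqrtr// ltW.
Qed.

Lemma ell2_infinite_dimensional (es : seq V) : infinite_set [set: X] ->
  orthonormal_eigenvectors ip T es -> exists2 x, perp ip es x & x <> 0.
Proof.
move=> /infinite_injection[x xi _].
exact: (infinite_dimensional hs (normalized_delta_orthonormal xi)).
Qed.

(** Along infinitely many vertices of degree at most [M], the normalized indicators
    would keep [<T e, e>] above [1 / (M + C + 1)]. *)
Lemma spectral_sublevel_finite (v : nat -> V) (s : nat -> R) :
  spectral_sequence ip T v s -> s n @[n --> \oo] --> (0 : R) ->
  forall M, finite_set [set x | Deg x <= M].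
Proof.
move=> hv s0 M; apply: contrapT => /infinite_injection[x xi xM].
have [_ L0] := inverse_delta_ge (x 0%N).
have M0 : 0 < M + c1 by apply: lt_le_trans L0 _; rewrite lerD2r; exact: xM.
have Mi : 0 < (M + c1)^-1 by rewrite invr_gt0.
have [n] := spectral_form_small hs Tsym hv s0 (normalized_delta_orthonormal xi) Mi.
rewrite ltNge => /negP; apply; apply: le_trans (inverse_normalized_delta_ge _).
have [_ Ln] := inverse_delta_ge (x n).
by rewrite lef_pV2 ?posrE// lerD2r; exact: xM.
Qed.

Variables (a k : R).
Hypothesis a0 : 0 <= a.
Hypothesis hsparse : magnetic_sparse b theta q m a k.
Local Notation gam := (sparse_constant alpha a).
Local Notation shift := (sparse_shift alpha a k C).

(** The set off which the lower bound exceeds [M] is a sublevel set of the degree. *)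
Lemma sublevel_quasi_compact : (forall M, finite_set [set x | Deg x <= M]) ->
  quasi_compact ip T.
Proof.
move=> fin; apply: (inverse_quasi_compact hT) => M.
have g0 : 0 < gam by exact: sparse_constant_gt0.
have /finite_seqP[K0 K0E] := fin ((M + shift) / gam); exists (undup K0).
have [|x|B B0 hB] := @form_ge_off_finite _ _ _ _ _ _ _ _ _ _ hG halpha0 halpha1 a0 hsparse C0 hC (undup K0) M.
- exact: undup_uniq.
- rewrite mem_undup => xK; have : ~ [set` K0] x by move/negP: xK.
  rewrite -K0E /= => /negP; rewrite -ltNge ltr_pdivrMr// mulrC; lra.
- by exists B.
Qed.

(** [spectral_min_max] gives a vector that vanishes at the first [n] vertices and at
    which the form is at most [s_n^-1 - (C + 1)] times the squared norm; off
    these vertices the degree is at least [Deg (x n)]. *)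
Lemma inverse_eigenvalue_ge (v : nat -> V) (s : nat -> R) x n :
  spectral_sequence ip T v s -> vertex_enumeration b q m x ->
  gam * Deg (x n) - shift <= inverse_eigenvalue C s n.
Proof.
move=> hv [[x' xK x'K] xmono]; have g0 : 0 < gam by exact: sparse_constant_gt0.
have [f [g [f0 Tg fn fw]]] := spectral_min_max hs hv (fun j => deltaV q hG (x j)) n.
have fx j : (j < n)%N -> f (x j) = 0.
  move=> /fw; rewrite ip_deltaV => /eqP; rewrite mulf_eq0 => /orP[/eqP//|].
  by rewrite eq_complex/= eqxx andbT gt_eqF// (graph_m_gt0 hG).
pose K := [seq x j | j <- iota 0 n].
have [||B B0 hB] := @form_ge_off_finite _ _ _ _ _ _ _ _ _ _ hG halpha0 halpha1 a0 hsparse C0 hC K (gam * Deg (x n) - shift).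
- by rewrite map_inj_uniq ?iota_uniq//; exact: can_inj xK.
- move=> y yK; rewrite lerD2r ler_pM2l// -[y]x'K.
  have [lt|le] := ltnP (x' y) n.
    by move: yK; rewrite -[y]x'K map_f// mem_iota.
  elim: (x' y) le => [|j IH]; first by rewrite leqn0 => /eqP ->.
  by rewrite leq_eqVlt => /orP[/eqP ->//|/IH h]; exact: le_trans (xmono j).
have [dg _] := hT g; rewrite Tg in dg; have := hB _ dg; rewrite big_map big_seq big1 ?mulr0 ?addr0; last first.
  move=> j; rewrite mem_iota /= add0n => jn.
  by rewrite fx// Normc.normc0 expr0n.
have := inverse_form hT g; rewrite Tg (ripC hs) => E.
have -> : nq m f = nsq f by rewrite nqE.
have N0 : 0 < nsq f by exact: (nsq_gt0 hs).
have {}E : rform f f = rip g f - c1 * nsq f by rewrite E; ring.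
rewrite E => h; rewrite -(ler_pM2r N0); apply: le_trans h _.
by rewrite mulrBl [_^-1 * _]mulrC lerD2r.
Qed.

End DegreesAndSpectrum.

(** Eventually [lambda n / D n >= g - c / D n], and the error tends to zero. *)
Lemma limn_einf_ratio_ge (R : realType) (lambda D : nat -> R) (g c : R) :
  (forall M, exists N, forall n, (N <= n)%N -> M < D n) ->
  (forall n, g * D n - c <= lambda n) ->
  (g%:E <= limn_einf (fun n => (lambda n / D n)%:E))%E.
Proof.
move=> Dlarge hl; apply/lee_addgt0Pr => e e0.
have [N hN] := Dlarge (Num.max 1 (`|c| / e)).
rewrite limn_einf_lim -leeBlDr//; apply: lime_ge; first exact: is_cvg_einfs.
exists N => // n /= Nn; apply: le_ereal_inf_tmp => _ [k /= nk <-].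
rewrite -EFinB lee_fin; have := hN k (leq_trans Nn nk).
rewrite gt_max => /andP[D1]; rewrite ltr_pdivrMr// => ce.
have D0 : 0 < D k by lra.
rewrite ler_pdivlMr// mulrBl; apply: le_trans (hl k).
have := ler_norm c; lra.
Qed.

(** * Characterization of purely discrete spectrum *)

Theorem corollary3p5 (R : realType) (X : choiceType)
    (b theta : X -> X -> R) (q m : X -> R) (alpha a k : R)
    (hX : infinite_set [set: X])
    (hG : magnetic_graph b theta m)
    (halpha0 : 0 < alpha) (halpha1 : alpha < 1)
    (ha : 0 <= a) (hk : 0 <= k)
    (hsparse : magnetic_sparse b theta q m a k)
    (hq : Kclass b theta q m alpha) :
  let H := magnetic_operator b theta q m in
  (purely_discrete_spectrum m H <-> Dinfty b q m = +oo%E) /\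
  (purely_discrete_spectrum m H ->
     [/\ exists lambda, eigenvalue_enumeration H lambda,
         exists x, vertex_enumeration b q m x &
         forall (lambda : nat -> R) (x : nat -> X),
           eigenvalue_enumeration H lambda ->
           vertex_enumeration b q m x ->
           let ratio n := (lambda n / Deg b q m (x n))%:E in
           ((2 * (1 - alpha) / (5 * (1 + a) ^+ 2 - alpha))%:E
              <= limn_einf ratio)%E
           /\ (limn_einf ratio <= limn_esup ratio)%E]).
Proof.
move=> H; have [C C0 hC] := Kclass_nq hG hq.
have [T hT] := shifted_inverse_exists hG halpha0 halpha1 C0 hC.
have hs := ell2_hilbert (graph_m_gt0 hG).
have Tsym := inverse_sym hT.
have Tpos := inverse_pos halpha0 halpha1 C0 hC hT.
have Tle := inverse_le1 halpha0 halpha1 C0 hC hT.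
have Tinj := inverse_inj halpha0 halpha1 C0 hC hT.
have seqT top := @spectral_sequence_exists _ _ _ hs T _ Tsym Tpos ltr01 Tle Tinj
  (fun es => @ell2_infinite_dimensional _ _ _ _ q _ hG T es hX) top.
have disc : purely_discrete_spectrum m H -> exists v s,
    spectral_sequence (@ell2_ip _ _ _ (graph_m_gt0 hG)) T v s /\ s n @[n --> \oo] --> (0 : R).
  move=> /(purely_discrete_inverse halpha0 halpha1 C0 hC hT) dT.
  have [v [s hv]] := seqT (discrete_top_attained hs Tsym Tpos dT).
  by exists v, s; split=> //; exact: (discrete_spectral0 hs Tsym hv dT).
split; [split=> [/disc[v [s [hv s0]]]|/Dinfty_sublevelP fin]|].
- apply/Dinfty_sublevelP.
  exact: (spectral_sublevel_finite halpha0 halpha1 C0 hC hT hv s0).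
- have qc := sublevel_quasi_compact halpha0 halpha1 C0 hC hT ha hsparse fin.
  have [v [s hv]] := seqT (quasi_compact_top_attained hs Tsym Tpos qc).
  exact: (purely_discrete halpha0 halpha1 C0 hC hT hv (quasi_compact_spectral0 hs hv qc)).
move=> /disc[v [s [hv s0]]].
have fin := spectral_sublevel_finite halpha0 halpha1 C0 hC hT hv s0.
have mu_enum := inverse_eigenvalue_enumeration halpha0 halpha1 C0 hC hT hv s0.
split; [by eexists; exact: mu_enum | exact: vertex_enumeration_exists | ].
move=> lambda x lambda_enum x_enum ratio; split; last exact: limn_einf_sup.
apply: limn_einf_ratio_ge (vertex_enumeration_unbounded hX fin x_enum) _ => n.
apply: le_trans (eigenvalue_enumeration_le lambda_enum mu_enum n).
exact: (inverse_eigenvalue_ge halpha0 halpha1 C0 hC hT ha hsparse n hv x_enum).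
Qed.
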